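(* Assume $f$ satisfies (f1)--(f3) and $\tau$ satisfies ($\tau$1)--($\tau$5) of the context. Then the functions $$\mathbb R\times\Gamma\supset[0,\alpha]\times P\to\mathbb R^n,\quad (t,\gamma)\mapsto x(t,\gamma)\qquad\text{and}\qquad \mathbb R\times\Gamma\supset[0,\alpha]\times P\to C,\quad (t,\gamma)\mapsto x_t(\cdot,\gamma)$$ are both (Fr\'echet) differentiable with respect to $\gamma$ at every $\gamma\in P_2$, and $$D_2x(t,\gamma)h=z(t,\gamma,h),\qquad D_2x_t(\cdot,\gamma)h=z_t(\cdot,\gamma,h),\qquad h\in\Gamma,\ t\in[0,\alpha],\ \gamma\in P_2,$$ where $z(\cdot,\gamma,h)$ is the solution of the variational initial value problem given in the context. Moreover, the functions $$\mathbb R\times\Gamma\supset[0,\alpha]\times P_2\to\mathcal L(\Gamma,\mathbb R^n),\ (t,\gamma)\mapsto D_2x(t,\gamma)\qquad\text{and}\qquad \mathbb R\times\Gamma\supset[0,\alpha]\times P_2\to\mathcal L(\Gamma,C),\ (t,\gamma)\mapsto D_2x_t(\cdot,\gamma)$$ are continuous.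
   Context: **Spaces.** Fix $r>0$, $n\in\mathbb N$, a norm $|\cdot|$ on $\mathbb R^n$ and $T\in(0,\infty]$ (if $T=\infty$, $[0,T]$ means $[0,\infty)$). $C$ is the Banach space of continuous $\psi:[-r,0]\to\mathbb R^n$ with the max norm $|\psi|_C$; $W^{1,\infty}$ is the space of Lipschitz continuous $\psi:[-r,0]\to\mathbb R^n$ with $|\psi|_{W^{1,\infty}}=\max\{|\psi|_C,|\dot\psi|_{L^\infty}\}$; for other domains/ranges one writes $W^{1,\infty}([a,b],Y)$ etc. The segment of $x$ at $t$ is $x_t(\zeta)=x(t+\zeta)$, $\zeta\in[-r,0]$. $\Theta,\Xi$ are normed linear spaces; $\Omega_1\subset C$, $\Omega_2\subset\mathbb R^n$, $\Omega_3\subset\Theta$, $\Omega_4\subset\Xi$ are open. $\mathcal L(X,Y)$ denotes bounded linear operators; $D_i$ is the partial Fr\'echet derivative with respect to the $i$th argument. **Assumptions.** $f:[0,T]\times\Omega_1\times\Omega_2\times\Omega_3\to\mathbb R^n$, $\tau:[0,T]\times\Omega_1\times\Omega_4\to[0,r]$. Call $M_1,M_2,M_3,M_4$ admissible if $M_1\subset\Omega_1$ is closed in $C$ and bounded in $W^{1,\infty}$, $M_2\subset\Omega_2$ is compact, $M_3\subset\Omega_3$ and $M_4\subset\Omega_4$ are closed and bounded in $\Theta$, $\Xi$. ''Locally'' below means: for every finite $a\in(0,T]$ and all admissible sets there is a constant for which the estimate holds for all times in $[0,a]$, $\psi,\bar\psi\in M_1$, $u,\bar u\in M_2$, $\theta,\bar\theta\in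 M_3$, $\xi,\bar\xi\in M_4$. (f1) $f$ is continuous. (f2) Locally $|f(t,\psi,u,\theta)-f(t,\bar\psi,\bar u,\bar\theta)|\le L_1(|\psi-\bar\psi|_C+|u-\bar u|+|\theta-\bar\theta|_\Theta)$. (f3) $f$ is continuously differentiable with respect to its second, third and fourth arguments. ($\tau$1) $\tau$ is continuous. ($\tau$2) Locally $|\tau(t,\psi,\xi)-\tau(t,\bar\psi,\bar\xi)|\le L_2(|\psi-\bar\psi|_C+|\xi-\bar\xi|_\Xi)$. ($\tau$3) $\tau$ is continuously differentiable with respect to its second and third arguments. ($\tau$4) Locally $|\tau(t,\psi,\xi)-\tau(\bar t,\psi,\xi)|\le L_2|t-\bar t|$. ($\tau$5) For every finite $a\in(0,T]$ and admissible $M_1,M_4$ there is $L_4\ge0$ with $|\frac d{dt}\tau(t,y_t,\xi)-\frac d{dt}\tau(t,\bar y_t,\bar\xi)|\le L_4(|y_t-\bar y_t|_{W^{1,\infty}}+|\xi-\bar\xi|_\Xi)$ for a.e. $t\in[0,a]$, whenever $\xi,\bar\xi\in M_4$ and $y,\bar y\in W^{1,\infty}([-r,a],\mathbb R^n)$ satisfy $y_t,\bar y_t\in M_1$ for $t\in[0,a]$. **The initial value problem.** For $\gamma=(\phi,\theta,\xi)$: $$\dot x(t)=f(t,x_t,x(t-\tau(t,x_t,\xi)),\theta),\ t\in[0,T],\qquad x(t)=\phi(t),\ t\in[-r,0].$$ $\Gamma=W^{1,\infty}\times\Theta\times\Xi$ with $|\gamma|_\Gamma=|\phi|_{W^{1,\infty}}+|\theta|_\Theta+|\xi|_\Xi$,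 and $\Pi=\{(\phi,\theta,\xi)\in\Gamma:\phi\in\Omega_1,\ \phi(-\tau(0,\phi,\xi))\in\Omega_2,\ \theta\in\Omega_3,\ \xi\in\Omega_4\}$. Fix $\hat\gamma\in\Pi$. By the well-posedness theorem (valid under (f1), (f2), ($\tau$1), ($\tau$2)) one can fix $\delta>0$, a finite $\alpha\in(0,T]$, convex admissible sets $M_1,\dots,M_4$ and constants $N,L$ such that, with $P$ the open ball of $\Gamma$ of center $\hat\gamma$ and radius $\delta$: for every $\gamma=(\phi,\theta,\xi)\in P$ the problem has a unique solution $x(\cdot,\gamma)$ on $[-r,\alpha]$, and for $t\in[0,\alpha]$, $x_t(\cdot,\gamma)\in M_1$, $x(t-\tau(t,x_t(\cdot,\gamma),\xi),\gamma)\in M_2$, $\theta\in M_3$, $\xi\in M_4$, $|x_t(\cdot,\gamma)|_{W^{1,\infty}}\le N$, and $|x_t(\cdot,\gamma)-x_t(\cdot,\bar\gamma)|_{W^{1,\infty}}\le L|\gamma-\bar\gamma|_\Gamma$ for $\gamma,\bar\gamma\in P$. These objects are fixed. **The set $P_2$.** $\mathcal{PM}([a,b],[c,d])$ is the set of absolutely continuous $u:[a,b]\to[c,d]$ for which there is a finite mesh $a=t_0<\dots<t_m=b$ such that for each $i=0,\dots,m-1$ either $\operatorname{ess\,inf}_{[a',b']}\dot u>0$ for all $[a',b']\subset(t_i,t_{i+1})$, or $\operatorname{ess\,sup}_{[a',b']}\dot u<0$ for all $[a',b']\subset(t_i,t_{i+1})$. With $\alpha^*=\min\{r,\alpha\}$,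 $P_2$ is the set of $\gamma=(\phi,\theta,\xi)\in P$ such that the map $[0,\alpha^*]\ni t\mapsto t-\tau(t,x_t(\cdot,\gamma),\xi)$ belongs to $\mathcal{PM}([0,\alpha^*],[-r,\alpha^*])$. **Variational problem.** For $\gamma=(\phi,\theta,\xi)\in P_2$, $x=x(\cdot,\gamma)$, $u(t)=t-\tau(t,x_t,\xi)$ and a.e. $t\in[0,\alpha]$, define for $(h^\phi,h^\theta,h^\xi)\in C\times\Theta\times\Xi$ $$\begin{aligned}L(t,x)(h^\phi,h^\theta,h^\xi)={}&D_2f(t,x_t,x(u(t)),\theta)h^\phi+D_4f(t,x_t,x(u(t)),\theta)h^\theta\\&+D_3f(t,x_t,x(u(t)),\theta)\bigl[-\dot x(u(t))\bigl(D_2\tau(t,x_t,\xi)h^\phi+D_3\tau(t,x_t,\xi)h^\xi\bigr)+h^\phi(-\tau(t,x_t,\xi))\bigr].\end{aligned}$$ For $h=(h^\phi,h^\theta,h^\xi)\in C\times\Theta\times\Xi$, $z=z(\cdot,\gamma,h)$ is the unique continuous function on $[-r,\alpha]$, absolutely continuous on $[0,\alpha]$, with $\dot z(t)=L(t,x)(z_t,h^\theta,h^\xi)$ for a.e. $t\in[0,\alpha]$ and $z(t)=h^\phi(t)$ for $t\in[-r,0]$. *)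

(* Defs.v *)
From HB Require Import structures.
From mathcomp Require Import all_boot all_order all_algebra.
From mathcomp Require Import all_classical all_reals all_analysis.
From mathcomp Require Import ess_sup_inf ring lra.

Set Implicit Arguments.
Unset Strict Implicit.
Unset Printing Implicit Defensive.
Import Order.TTheory GRing.Theory Num.Theory.
Import numFieldNormedType.Exports.
Local Open Scope classical_set_scope.
Local Open Scope ring_scope.

(* An arbitrary norm on R^n, and R^n normed by it. *)
Record vnorm (R : realType) (n : nat) := VNorm {
  vnorm_fun :> 'rV[R]_n -> R;
  vnormD : forall x y, vnorm_fun (x + y) <= vnorm_fun x + vnorm_fun y;
  vnormZ : forall (c : R) x, vnorm_fun (c *: x) = `|c| * vnorm_fun x;
  vnorm_eq0 : forall x, vnorm_fun x = 0 -> x = 0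
}.

Definition rvec (R : realType) (n : nat) (nu : vnorm R n) : Type := 'rV[R]_n.

HB.instance Definition _ (R : realType) (n : nat) (nu : vnorm R n) :=
  GRing.Lmodule.copy (rvec nu) 'rV[R]_n.
HB.instance Definition _ (R : realType) (n : nat) (nu : vnorm R n) :=
  @Lmodule_isNormed.Build R (rvec nu) (vnorm_fun nu)
    (vnormD nu) (vnormZ nu) (@vnorm_eq0 R n nu).


Section vnorm_theory.
Context {R : realType} {n : nat} (nu : vnorm R n).

Lemma vnorm0 : nu 0 = 0. Proof. by rewrite -(scale0r 0) vnormZ normr0 mul0r. Qed.

Lemma vnormN v : nu (- v) = nu v.
Proof. by rewrite -scaleN1r vnormZ normrN1 mul1r. Qed.

Lemma vnorm_ge0 v : 0 <= nu v.
Proof.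
have := vnormD nu v (- v); rewrite subrr vnorm0 vnormN => ?; lra.
Qed.

Lemma vnorm_upper : exists2 K, 0 < K & forall v, nu v <= K * `|v|.
Proof.
exists (1 + \sum_i nu (delta_mx 0 i)); first by
  rewrite ltr_pwDl// sumr_ge0// => i _; exact: vnorm_ge0.
move=> v; rewrite mulrDl mul1r mulr_suml ler_wpDl//.
rewrite {1}[v]row_sum_delta.
have vsum (I : seq 'I_n) F : nu (\sum_(i <- I) F i) <= \sum_(i <- I) nu (F i).
  elim: I => [|i I IH]; first by rewrite !big_nil vnorm0.
  by rewrite !big_cons (le_trans (vnormD _ _ _))// lerD2l.
rewrite (le_trans (vsum _ _))// ler_sum// => i _.
rewrite vnormZ mulrC ler_wpM2l ?vnorm_ge0//.
by rewrite [leRHS]mx_normrE; exact: (le_bigmax _ _ (0, i)).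
Qed.

Lemma vnorm_continuous : continuous (nu : 'rV[R]_n -> R).
Proof.
have [K K0 Kub] := vnorm_upper.
move=> v; have FF := nbhs_filter v; apply/cvgrPdist_le => e e0; near=> w.
have : `|nu v - nu w| <= nu (v - w).
  rewrite ler_norml; apply/andP; split.
    by have := vnormD nu v (w - v); rewrite addrC subrK -opprB vnormN; lra.
  by have := vnormD nu w (v - w); rewrite addrC subrK; lra.
move=> /le_trans; apply; rewrite (le_trans (Kub _))// -ler_pdivlMl//.
near: w; apply: (cvgr_dist_le (F := nbhs v) id); first exact: cvg_id.
by rewrite /= mulr_gt0// invr_gt0.
Unshelve. all: by end_near. Qed.

Lemma vnorm_lower : exists2 K, 0 < K & forall v, `|v| <= K * nu v.
Proof.
pose S := [set v : 'rV[R]_n | `|v| = 1].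
have normS v : v != 0 -> S (`|v|^-1 *: v).
  by move=> v0; rewrite /S/= normrZ normfV normr_id mulVf ?normr_eq0.
have [S0|/set0P S0] := eqVneq S set0.
  exists 1 => // v; have [->|/normS] := eqVneq v 0; last by rewrite S0.
  by rewrite normr0 mul1r vnorm_ge0.
have cS : compact S.
  apply: bounded_closed_compact.
    by exists 1; split => // x x1 v /= ->; exact: ltW.
  apply: (@preimage_closed 'rV[R]_n R Num.norm [set x | x = 1]).
    by move=> x _; exact: norm_continuous.
  exact: closed_eq.
have cnu : {within S, continuous nu}.
  by apply: continuous_subspaceT; exact: vnorm_continuous.
have [c cS' cmin] := EVT_min_rV S0 cS cnu.
have c0 : 0 < nu c.
  rewrite lt_neqAle vnorm_ge0 andbT eq_sym; apply/eqP => /vnorm_eq0 c0.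
  by move: cS'; rewrite inE /S /= c0 normr0 => /esym/eqP; rewrite oner_eq0.
exists (nu c)^-1; first by rewrite invr_gt0.
move=> v; have [->|v0] := eqVneq v 0.
  by rewrite normr0 mulr_ge0 ?vnorm_ge0// invr_ge0 vnorm_ge0.
rewrite ler_pdivlMl// -ler_pdivlMr ?normr_gt0//.
rewrite mulrC -(ger0_norm (x := `|v|^-1)) ?invr_ge0// -vnormZ; apply: cmin.
by rewrite inE; exact: normS.
Qed.

Lemma rvec_derivable (g : R -> rvec nu) (t : R) :
  (forall i, derivable (fun s => (g s : 'rV[R]_n) 0 i) t 1) -> derivable g t 1.
Proof.
move=> dg; have : derivable (g : R -> 'rV[R]_n) t 1.
  by apply/derivable_mxP => i j; rewrite ord1; exact: dg.
move=> /cvg_ex[l /cvgrPdist_le gl]; apply/cvg_ex; exists (l : rvec nu).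
have [K K0 Kub] := vnorm_upper.
apply/cvgrPdist_le => e e0.
have /gl : 0 < K^-1 * e by rewrite mulr_gt0// invr_gt0.
apply: filterS => h; rewrite ler_pdivlMl// => /(le_trans _); apply.
exact: Kub.
Qed.

End vnorm_theory.

Section lipschitz_cumulative.
Context {R : realType}.
Variables (k : {posnum R}) (g : R -> R).
Hypothesis glip : forall s t, `|g s - g t| <= k%:num * `|s - t|.

(* t |-> k t + g t is nondecreasing; its Stieltjes measure is dominated by the
   Lebesgue measure, and its Radon-Nikodym derivative gives the almost
   everywhere derivative of the Lipschitz function g. *)
Definition lipcum (_ : forall s t, `|g s - g t| <= k%:num * `|s - t|) (t : R) :=
  k%:num * t + g t.

Let nd : {homo lipcum glip : x y / x <= y}.
Proof.
move=> x y xy; rewrite /lipcum -subr_ge0.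
have := lerNnormlW (glip y x).
have -> : `|y - x| = y - x by rewrite ger0_norm// subr_ge0.
by move=> ?; nra.
Qed.

Let rc : right_continuous (lipcum glip).
Proof.
apply/right_continuousW => x; apply: cvgD.
  by apply: cvgM; [exact: cvg_cst|exact: cvg_id].
apply/cvgrPdist_le => e e0; near=> t.
rewrite (le_trans (glip _ _))// -ler_pdivlMl//.
near: t; apply: cvgr_dist_le; first exact: cvg_id.
by rewrite mulr_gt0// invr_gt0.
Unshelve. all: by end_near. Qed.

HB.instance Definition _ := isCumulative.Build R _ R (lipcum glip) nd rc.
End lipschitz_cumulative.

Section ae_derivable.
Context {R : realType}.
Local Notation mu := (@lebesgue_measure R).

Lemma lipcum_dominates (k : {posnum R}) (g : R -> R)
    (gl : forall s t, `|g s - g t| <= k%:num * `|s - t|)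
    (gl' : forall s t, `|(- g s) - (- g t)| <= k%:num * `|s - t|) A :
  measurable A -> mu A = 0%E ->
  lebesgue_stieltjes_measure (lipcum gl) A = 0%E.
Proof.
move=> mA A0.
pose m1 := lebesgue_stieltjes_measure (lipcum gl).
pose m2 := lebesgue_stieltjes_measure (lipcum gl').
have c0 : 0 <= (2 * k%:num)^-1 by rewrite invr_ge0 mulr_ge0.
pose c := NngNum c0.
have mE B : mscale c (measure_add m1 m2) B = (c%:num%:E * (m1 B + m2 B))%E.
  by congr (_ * _)%E; exact: measure_addE.
have : mu A = mscale c (measure_add m1 m2) A.
  apply: lebesgue_measure_unique => // _ [[a b] _ <-].
  rewrite -[RHS]/(mscale c (measure_add m1 m2) _) mE.
  have [ab|ba] := ltP b a.
    have -> : (`](a, b).1, (a, b).2]%classic : set R) = set0.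
      by rewrite set_itv_ge// bnd_simp -leNgt ltW.
    by rewrite /m1 /m2 !measure0 adde0 mule0.
  rewrite /m1 /m2 /lebesgue_measure/= /lebesgue_stieltjes_measure/=.
  rewrite /measure_extension/= !measurable_mu_extE//=; try exact: is_ocitv.
  rewrite !wlength_itv_bnd//= -EFinD -EFinM; congr EFin.
  rewrite /lipcum /=; field.
  exact: lt0r_neq0.
rewrite A0 mE => /esym/eqP.
have ck : (c%:num%:E != 0 :> \bar R)%E by rewrite eqe/= invr_eq0 mulf_neq0.
rewrite mule_eq0 (negbTE ck)/=.
by rewrite padde_eq0// => /andP[/eqP].
Qed.


Lemma lipschitz_ae_derivable_itv (k : {posnum R}) (g : R -> R) (N : R) :
  0 < N ->
  (forall s t, `|g s - g t| <= k%:num * `|s - t|) ->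
  {ae mu, forall x : R, x \in `]- N, N[ -> derivable g x 1}.
Proof.
move=> N0 gl.
have gl' s t : `|(- g s) - (- g t)| <= k%:num * `|s - t|.
  by rewrite -opprD normrN.
pose F := lipcum gl.
pose m1 := lebesgue_stieltjes_measure F.
pose D : set (measurableTypeR R) := `]- N, N]%classic.
have mD : measurable D by exact: measurable_itv.
have m1E a b : a <= b -> m1 `]a, b]%classic = (F b - F a)%:E.
  move=> ab; rewrite /m1 /lebesgue_stieltjes_measure/= /measure_extension/=.
  by rewrite measurable_mu_extE//=; [rewrite wlength_itv_bnd|exact: is_ocitv].
have NN : - N <= N by lra.
have moo : (m1 D < +oo)%E by rewrite m1E// ltry.
pose nu := mfrestr mD moo.
have nuE (A : set (measurableTypeR R)) : nu A = m1 (A `&` D) by [].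
have numu : nu `<< mu.
  apply/null_content_dominatesP => A mA A0; rewrite nuE.
  apply: lipcum_dominates => //; first exact: measurableI.
  by apply: subset_measure0 A0 => //; exact: measurableI.
have [f [f0 ffin fint nuf]] := radon_nikodym_sigma_finite numu.
pose h := fine \o f.
have fh : f = EFin \o h by apply/funext => x; rewrite /h /= fineK.
have m1h A : measurable A -> m1 (A `&` D) = (\int[mu]_(x in A) (h x)%:E)%E.
  by move=> mA; have := nuf A mA; rewrite fh.
have hint A : measurable A -> mu.-integrable A (EFin \o h).
  by move=> mA; rewrite -fh; apply: integrableS fint.
have hloc : locally_integrable [set: R] h.
  by apply: open_integrable_locally; [exact: openT|exact: hint].
have /= := @FTC1 _ h (BRight (- N)) (fun y => hint _ (measurable_itv _)) hloc.
apply: filterS; first exact: (ae_filter_ringOfSetsType mu).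
move=> x /= H /[dup] xN; rewrite in_itv/= => /andP[Nx xN'].
have [|dG _] := H; first by rewrite /= lte_fin.
have dF : derivable F x 1.
  apply: (near_eq_derivable (f := fun y => \int[mu]_(t in `]- N, y]) h t + F (- N))).
  - near=> y.
    have yN : y \in `]- N, N[ by near: y; exact: near_in_itvoo.
    move: yN; rewrite in_itv/= => /andP[Ny yN].
    rewrite /Rintegral -m1h; last exact: measurable_itv.
    rewrite setIidl; last first.
      by apply: subset_itvl; rewrite bnd_simp ltW.
    by rewrite m1E ?ltW//= subrK.
  - by apply: derivableD; [exact: dG|exact: derivable_cst].
have -> : g = F - k%:num \*: (@id R).
  apply/funext => y; change (g y = k%:num * y + g y - k%:num * y).
  by rewrite addrAC subrr add0r.
by apply: derivableB; [exact: dF|apply: derivableZ; exact: derivable_id].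
Unshelve. all: by end_near. Qed.

Lemma lipschitz_ae_derivable (k : R) (g : R -> R) :
  (forall s t, `|g s - g t| <= k * `|s - t|) ->
  {ae mu, forall x : R, derivable g x 1}.
Proof.
move=> gl; have k0 : 0 < Num.max k 1 by rewrite lt_max ltr01 orbT.
have gl' s t : `|g s - g t| <= (PosNum k0)%:num * `|s - t|.
  by rewrite (le_trans (gl s t))// ler_wpM2r// le_max lexx.
have /ae_foralln : forall n : nat, {ae mu, forall x : R,
    x \in `]- n.+1%:R, n.+1%:R[ -> derivable g x 1}.
  by move=> n; exact: lipschitz_ae_derivable_itv gl'.
apply: (@filterS _ _ (ae_filter_ringOfSetsType mu)).
move=> x /(_ (Num.bound `|x|)); apply; rewrite in_itv/= -ltr_norml.
by rewrite (lt_le_trans (archi_boundP (normr_ge0 x)))// ler_nat.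
Qed.

End ae_derivable.

Section continuous_functions.
Context {R : realType}.

Definition clamp (r : {posnum R}) (t : R) : R :=
  Num.max (- r%:num) (Num.min t 0).

Lemma clamp_itv r t : clamp r t \in `[- r%:num, 0].
Proof.
rewrite in_itv/= le_max lexx/= ge_max oppr_le0 ge0/=.
by rewrite ge_min lexx orbT.
Qed.

Lemma clamp_id r t : t \in `[- r%:num, 0] -> clamp r t = t.
Proof. by rewrite in_itv/= => /andP[? ?]; rewrite /clamp min_l// max_r. Qed.

Lemma clampK r t : clamp r (clamp r t) = clamp r t.
Proof. exact/clamp_id/clamp_itv. Qed.

Lemma clamp_lip r s t : `|clamp r s - clamp r t| <= `|s - t|.
Proof.
have := gt0 r; set a := r%:num => a0; rewrite /clamp -/a.
have sub_le := ler_norm (s - t); have sub_ge := lerNnormlW (lexx `|s - t|).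
move: `|s - t| sub_le sub_ge => d sub_le sub_ge.
rewrite ler_norml; apply/andP; rewrite !maxEle !minEle.
by split; do ! case: ifPn => [|/negbTE/negbT]; rewrite -?ltNge; lra.
Qed.

Lemma clamp_continuous r : continuous (clamp r).
Proof.
move=> u; apply/(@cvgrPdist_le _ _ _ (nbhs u) (nbhs_filter u)) => e e0.
have := cvgr_dist_le (F := nbhs u) (FF := nbhs_filter u) id u cvg_id _ e0.
apply: (@filterS _ (nbhs u)) => s us.
exact: le_trans (clamp_lip _ _ _) us.
Qed.

Variables (V : normedModType R) (r : {posnum R}).

(* C([-r, 0], V): a function on [-r, 0] is represented by its extension to R
   which is constant on ]-oo, -r] and on [0, +oo[. *)
Definition is_Cfun : pred (R -> V) :=
  [pred g | `[< continuous g /\ forall t, g (clamp r t) = g t >]].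

Record Cspace := MkCspace { Cfun :> R -> V; _ : is_Cfun Cfun }.

HB.instance Definition _ := [isSub of Cspace for Cfun].
HB.instance Definition _ := [Choice of Cspace by <:].

Lemma Cfun_continuous (g : Cspace) : continuous (g : R -> V).
Proof. by case: g => g /= /asboolP[]. Qed.

Lemma Cfun_clamp (g : Cspace) t : g (clamp r t) = g t.
Proof. by case: g => g /= /asboolP[]. Qed.

Fact is_Cfun_submod_closed : submod_closed is_Cfun.
Proof.
split; first by apply/asboolP; split=> // x; exact: cvg_cst.
move=> c f g /asboolP[cf kf] /asboolP[cg kg]; apply/asboolP; split.
  by move=> x; apply: cvgD; [apply: cvgZl_tmp; exact: cf|exact: cg].
move=> t; change (c *: f (clamp r t) + g (clamp r t) = c *: f t + g t).
by rewrite kf kg.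
Qed.
HB.instance Definition _ :=
  GRing.isSubmodClosed.Build R (R -> V) is_Cfun is_Cfun_submod_closed.
HB.instance Definition _ := [SubChoice_isSubLmodule of Cspace by <:].

Definition Cnorm (g : Cspace) : R :=
  sup [set `|g t| | t in `[- r%:num, 0]%classic].

Lemma Cnorm_has_sup (g : Cspace) :
  has_sup [set `|g t| | t in `[- r%:num, 0]%classic].
Proof.
split; first by exists `|g 0|, 0 => //=; rewrite in_itv/= lexx oppr_le0 ge0.
have cg : {within `[- r%:num, 0], continuous (fun t => `|g t|)}.
  apply: continuous_subspaceT => t.
  by apply: continuous_comp; [exact: Cfun_continuous|exact: norm_continuous].
have [|c _ cmax] := EVT_max _ cg; first by rewrite oppr_le0 ge0.
by exists `|g c| => _ [t tr <-]; exact: cmax.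
Qed.

Lemma Cnorm_ub (g : Cspace) t : `|g t| <= Cnorm g.
Proof.
rewrite -Cfun_clamp; apply: sup_upper_bound; first exact: Cnorm_has_sup.
by exists (clamp r t) => //; exact: clamp_itv.
Qed.

Lemma Cnorm_le (g : Cspace) k :
  (forall t, t \in `[- r%:num, 0] -> `|g t| <= k) -> Cnorm g <= k.
Proof.
move=> gk; apply: sup_le_ub; first by case: (Cnorm_has_sup g).
by move=> _ [t tr <-]; exact: gk.
Qed.

Fact CnormD f g : Cnorm (f + g) <= Cnorm f + Cnorm g.
Proof.
apply: Cnorm_le => t _.
by rewrite (le_trans (ler_normD _ _))// lerD//; exact: Cnorm_ub.
Qed.

Fact CnormZ (c : R) f : Cnorm (c *: f) = `|c| * Cnorm f.
Proof.
have leZ (d : R) g : Cnorm (d *: g) <= `|d| * Cnorm g.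
  by apply: Cnorm_le => t _; rewrite normrZ ler_wpM2l//; exact: Cnorm_ub.
apply/eqP; rewrite eq_le leZ/=; have [->|c0] := eqVneq c 0.
  by rewrite normr0 mul0r (le_trans _ (Cnorm_ub _ 0)).
rewrite -ler_pdivlMl ?normr_gt0// -normfV.
by have := leZ c^-1 (c *: f); rewrite scalerK.
Qed.

Fact Cnorm_eq0 f : Cnorm f = 0 -> f = 0.
Proof.
move=> f0; apply/val_inj/funext => t; apply/eqP.
by rewrite -normr_le0 -[leRHS]f0; exact: Cnorm_ub.
Qed.

HB.instance Definition _ :=
  @Lmodule_isNormed.Build R Cspace Cnorm CnormD CnormZ Cnorm_eq0.

End continuous_functions.

(* Restriction of the Lebesgue measure to [a, b]. *)
Definition mu_itv {R : realType} (a b : R) :=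
  mrestr (@lebesgue_measure R) (measurable_itv `[a, b]).
HB.instance Definition _ (R : realType) (a b : R) := Measure.on (mu_itv a b).

Section Lipschitz_functions.
Context {R : realType} {n : nat}.
Variables (nu : vnorm R n) (r : {posnum R}).
Local Notation V := (rvec nu).
Local Notation C := (Cspace V r).
Local Notation J := `[- r%:num, 0].
Local Notation mu := (@lebesgue_measure R).

Local Notation mu_J := (mu_itv (- r%:num) 0).

Let aeS (m : {measure set (measurableTypeR R) -> \bar R}) (P Q : R -> Prop) :
  (forall t, P t -> Q t) -> {ae m, forall t, P t} -> {ae m, forall t, Q t}.
Proof.
by move=> PQ [N [mN N0 PN]]; exists N; split=> // t nQ; apply: PN => /= /PQ.
Qed.

Let ae_all (m : {measure set (measurableTypeR R) -> \bar R}) (P : R -> Prop) :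
  (forall t, P t) -> {ae m, forall t, P t}.
Proof.
by move=> Pt; exists set0; split=> // t /= /(_ (Pt t)).
Qed.

(* W^{1,oo}([-r, 0], R^n): the Lipschitz functions, as a subspace of C. *)
Definition is_Wfun : pred C :=
  [pred g : C | `[< [lipschitz (g : R -> V) t | t in [set` J]] >]].

Lemma is_WfunP (g : C) :
  is_Wfun g <-> exists k, forall s t, `|g s - g t| <= k * `|s - t|.
Proof.
split=> [/asboolP [M [_ gM]]|[k gk]].
  have M1 : M < M + 1 by rewrite ltrDl.
  exists (Num.max (M + 1) 0) => s t.
  have := gM _ M1 (clamp r s, clamp r t); rewrite /= !Cfun_clamp.
  move=> /(_ (conj (clamp_itv r s) (clamp_itv r t))) /le_trans; apply.
  rewrite (@le_trans _ _ (Num.max (M + 1) 0 * `|clamp r s - clamp r t|))//.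
    by rewrite ler_wpM2r// le_max lexx.
  by rewrite ler_wpM2l ?clamp_lip// le_max lexx orbT.
by apply/asboolP; exists k; split=> [|M kM [s t] _ /=];
  rewrite ?num_real// (le_trans (gk _ _))// ler_wpM2r// ltW.
Qed.

Fact is_Wfun_submod_closed : submod_closed is_Wfun.
Proof.
split; first by apply/is_WfunP; exists 0 => s t; rewrite subrr normr0 mul0r.
move=> c f g /is_WfunP[k fk] /is_WfunP[l gl]; apply/is_WfunP.
exists (`|c| * k + l) => s t.
have -> : (c *: f + g) s - (c *: f + g) t = c *: (f s - f t) + (g s - g t).
  change (c *: f s + g s - (c *: f t + g t) = c *: (f s - f t) + (g s - g t)).
  by rewrite scalerBr opprD addrACA.
rewrite (le_trans (ler_normD _ _))// mulrDl lerD// normrZ -mulrA.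
by rewrite ler_wpM2l.
Qed.
HB.instance Definition _ :=
  GRing.isSubmodClosed.Build R C is_Wfun is_Wfun_submod_closed.

Record Wspace := MkWspace { Wfun :> C; _ : is_Wfun Wfun }.

HB.instance Definition _ := [isSub of Wspace for Wfun].
HB.instance Definition _ := [Choice of Wspace by <:].
HB.instance Definition _ := [SubChoice_isSubLmodule of Wspace by <:].

Lemma Wfun_lip (g : Wspace) :
  exists2 k, 0 <= k & forall s t, `|g s - g t| <= k * `|s - t|.
Proof.
case: g => g /= /is_WfunP[k gk]; exists (Num.max k 0).
  by rewrite le_max lexx orbT.
by move=> s t; rewrite (le_trans (gk _ _))// ler_wpM2r// le_max lexx.
Qed.

Lemma Wfun_ae_derivable (g : Wspace) :
  {ae mu, forall t : R, derivable (g : R -> V) t 1}.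
Proof.
have [k k0 gk] := Wfun_lip g.
have [K K0 Klb] := vnorm_lower nu.
have /ae_foralln H : forall i : nat, {ae mu, forall t : R, forall ltn : (i < n)%N,
    derivable (fun s => (g s : 'rV[R]_n) 0 (Ordinal ltn)) t 1}.
  move=> i; case: (pselect (i < n)%N) => [ltn|nin]; last first.
    by apply: ae_all => t ltn; exfalso; exact: nin.
  have gil s t : `|(g s : 'rV[R]_n) 0 (Ordinal ltn) -
      (g t : 'rV[R]_n) 0 (Ordinal ltn)| <= (K * k) * `|s - t|.
    rewrite -mulrA (@le_trans _ _ `|(g s - g t : 'rV[R]_n)|)//.
      rewrite [leRHS]mx_normrE.
      have := le_bigmax 0 (fun ij => `|(g s - g t : 'rV[R]_n) ij.1 ij.2|)
        (0, Ordinal ltn).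
      by rewrite /= !mxE.
    by rewrite (le_trans (Klb _))// ler_pM2l//; exact: gk.
  apply: aeS (lipschitz_ae_derivable gil) => t dg ltn'.
  by rewrite (bool_irrelevance ltn' ltn).
apply: aeS H => t H.
apply: rvec_derivable => -[i ltn]; exact: H.
Qed.

Lemma ae_mu_J (P : R -> Prop) : {ae mu, forall t, P t} -> {ae mu_J, forall t, P t}.
Proof.
move=> [N [mN N0 PN]]; exists N; split => //.
apply/eqP; rewrite eq_le measure_ge0 andbT -N0.
by apply: le_measure; rewrite ?inE//; exact: measurableI.
Qed.

(* The L^oo norm of the almost everywhere derivative. It is finite on Wspace, so
   that [fine] in [Wnorm] loses nothing; the triangle inequality rests on the
   almost everywhere differentiability of Lipschitz functions. *)
Definition Wesssup (g : C) : \bar R :=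
  ess_sup mu_J (fun t => `|derive1 (g : R -> V) t|%:E).

Lemma Wesssup_fin (g : Wspace) : Wesssup g \is a fin_num.
Proof.
have [k k0 gk] := Wfun_lip g.
rewrite fin_numE -ltNye -ltey; apply/andP; split.
  rewrite (@lt_le_trans _ _ 0%E)//; apply: ess_sup_gee.
    change (0 < mu (setT `&` [set` J]))%E.
    by rewrite setTI lebesgue_measure_itv/= lte_fin oppr_lt0 gt0/= lte_fin opprK add0r.
  by apply: ae_all => t; rewrite lee_fin.
rewrite (@le_lt_trans _ _ k%:E) ?ltry//; apply/ess_supP.
apply: aeS (ae_mu_J (Wfun_ae_derivable g)) => t dg; rewrite lee_fin.
have cvg_g : `|h^-1 *: (g (h + t) - g t)| @[h --> 0^'] --> `|derive1 (g : R -> V) t|.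
  apply: cvg_norm; move: dg; rewrite /derivable derive1E /derive.
  rewrite (_ : (fun h => h^-1 *: _) = fun h => h^-1 *: (g (h + t) - g t))//.
  by apply/funext => h; rewrite /= [h *: 1]mulr1.
apply: cvgr_to_le cvg_g _; near=> h.
have h0 : h != 0 by near: h; exact: nbhs_dnbhs_neq.
rewrite normrZ normfV ler_pdivrMl ?normr_gt0// mulrC.
by rewrite (le_trans (gk _ _))// addrK.
Unshelve. all: by end_near. Qed.

Definition Wnorm (g : Wspace) : R := Num.max `|g : C| (fine (Wesssup g)).

Let Wess_ub (g : Wspace) :
  {ae mu_J, forall t, `|derive1 (g : R -> V) t| <= fine (Wesssup g)}.
Proof.
have := ess_sup_ge mu_J (fun t => `|derive1 (g : R -> V) t|%:E).
rewrite -/(Wesssup g) -(fineK (Wesssup_fin g)).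
by apply: aeS => t; rewrite lee_fin.
Qed.

Let Wess_le (g : Wspace) k :
  {ae mu_J, forall t, `|derive1 (g : R -> V) t| <= k} -> fine (Wesssup g) <= k.
Proof.
move=> gk; rewrite -lee_fin fineK ?Wesssup_fin//; apply/ess_supP.
by apply: aeS gk => t; rewrite lee_fin.
Qed.

Let aeI (P Q : R -> Prop) :
  {ae mu_J, forall t, P t} -> {ae mu_J, forall t, Q t} ->
  {ae mu_J, forall t, P t /\ Q t}.
Proof. exact: (@filterI _ _ (ae_filter_ringOfSetsType mu_J) P Q). Qed.

Fact WnormD f g : Wnorm (f + g) <= Wnorm f + Wnorm g.
Proof.
rewrite ge_max; apply/andP; split.
  rewrite (@le_trans _ _ (`|f : C| + `|g : C|)) ?ler_normD//.
  by rewrite lerD// le_max lexx.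
rewrite (@le_trans _ _ (fine (Wesssup f) + fine (Wesssup g)))//; last first.
  by rewrite lerD// le_max lexx orbT.
apply: Wess_le.
have := aeI (aeI (ae_mu_J (Wfun_ae_derivable f)) (ae_mu_J (Wfun_ae_derivable g)))
  (aeI (Wess_ub f) (Wess_ub g)).
apply: aeS => t [[df dg] [fub gub]].
have -> : derive1 ((f + g : Wspace) : R -> V) t = derive1 (f : R -> V) t + derive1 (g : R -> V) t.
  by rewrite !derive1E -deriveD.
apply: le_trans (ler_normD _ _) _.
exact: (lerD fub gub).
Qed.

Fact WnormZ (c : R) f : Wnorm (c *: f) = `|c| * Wnorm f.
Proof.
have leZ (d : R) g : Wnorm (d *: g) <= `|d| * Wnorm g.
  rewrite ge_max; apply/andP; split.
    by rewrite [leLHS]normrZ ler_wpM2l// le_max lexx.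
  rewrite (@le_trans _ _ (`|d| * fine (Wesssup g)))//; last first.
    by rewrite ler_wpM2l// le_max lexx orbT.
  apply: Wess_le; have := aeI (ae_mu_J (Wfun_ae_derivable g)) (Wess_ub g).
  apply: aeS => t [dg gub].
  have -> : derive1 ((d *: g : Wspace) : R -> V) t = d *: derive1 (g : R -> V) t.
    by rewrite !derive1E -deriveZ.
  by rewrite normrZ; exact: (ler_wpM2l (normr_ge0 d) gub).
apply/eqP; rewrite eq_le leZ/=; have [->|c0] := eqVneq c 0.
  by rewrite normr0 mul0r le_max normr_ge0.
rewrite -ler_pdivlMl ?normr_gt0// -normfV.
by have := leZ c^-1 (c *: f); rewrite scalerK.
Qed.

Fact Wnorm_eq0 f : Wnorm f = 0 -> f = 0.
Proof.
move=> f0; apply/val_inj/eqP; rewrite -[_ == _]normr_le0 -f0.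
by rewrite le_max lexx.
Qed.

HB.instance Definition _ :=
  @Lmodule_isNormed.Build R Wspace Wnorm WnormD WnormZ Wnorm_eq0.

End Lipschitz_functions.

Section parameter_space.
Context {R : realType} {n : nat}.
Variables (nu : vnorm R n) (r : {posnum R}) (Theta Xi : normedModType R).

(* The product space, normed by the sum of the three norms; the library's
   instance on products is the maximum norm, hence the alias. *)
Definition Gspace : Type := (Wspace nu r * Theta * Xi)%type.
HB.instance Definition _ := GRing.Lmodule.copy Gspace (Wspace nu r * Theta * Xi)%type.

Definition Gphi (g : Gspace) : Wspace nu r := g.1.1.
Definition Gtheta (g : Gspace) : Theta := g.1.2.
Definition Gxi (g : Gspace) : Xi := g.2.

Definition Gnorm (g : Gspace) : R := `|Gphi g| + `|Gtheta g| + `|Gxi g|.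

Fact GnormD g h : Gnorm (g + h) <= Gnorm g + Gnorm h.
Proof.
rewrite /Gnorm addrACA [X in _ <= X + _]addrACA.
by apply: lerD; [apply: lerD|]; exact: ler_normD.
Qed.

Fact GnormZ (c : R) g : Gnorm (c *: g) = `|c| * Gnorm g.
Proof.
rewrite /Gnorm !mulrDr; congr (_ + _ + _); exact: normrZ.
Qed.

Fact Gnorm_eq0 g : Gnorm g = 0 -> g = 0.
Proof.
move=> /eqP; rewrite /Gnorm !paddr_eq0 ?addr_ge0// !normr_eq0.
move=> /andP[/andP[/eqP + /eqP] + /eqP]; case: g => [[a b] c].
by rewrite /Gphi /Gtheta /Gxi /= => -> -> ->.
Qed.

HB.instance Definition _ :=
  @Lmodule_isNormed.Build R Gspace Gnorm GnormD GnormZ Gnorm_eq0.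

End parameter_space.

Section segments.
Context {R : realType} {n : nat}.
Variables (nu : vnorm R n) (r : {posnum R}).
Local Notation V := (rvec nu).
Local Notation J := `[- r%:num, 0].

(* x_t(s) = x (t + s) for s in [-r, 0]. Where x is not continuous (resp. not
   Lipschitz) on [t - r, t] the value is the default 0; see [segmentE] and
   [segmentWE] for the meaningful case. *)
Definition segment (x : R -> V) (t : R) : Cspace V r :=
  insubd 0 ((fun s => x (t + s)) \o clamp r).

Definition segmentW (x : R -> V) (t : R) : Wspace nu r :=
  insubd 0 (segment x t).

Lemma shift_clamp_itv (t s : R) : `[t - r%:num, t]%classic (t + clamp r s).
Proof. by have := clamp_itv r s; rewrite /= !in_itv/= => /andP[? ?]; lra. Qed.

Lemma segment_is_Cfun (x : R -> V) (t : R) :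
  {within `[t - r%:num, t], continuous x} ->
  is_Cfun r ((fun s => x (t + s)) \o clamp r).
Proof.
move=> /subspace_continuousP cx.
apply/asboolP; split=> [u|u]; last by rewrite /= clampK.
have := cx (t + clamp r u) (shift_clamp_itv _ _).
apply: cvg_comp => B; rewrite /within /= => AB.
have cc : {for u, continuous (fun s => t + clamp r s)}.
  by apply: continuousD; [exact: cst_continuous|exact: clamp_continuous].
have := cc _ AB; apply: (@filterS _ (nbhs u)) => s /=; apply.
exact: shift_clamp_itv.
Qed.

Lemma segmentE (x : R -> V) (t : R) : {within `[t - r%:num, t], continuous x} ->
  forall s, s \in J -> segment x t s = x (t + s).
Proof.
move=> cx s sJ; rewrite /segment /insubd (insubT _ (segment_is_Cfun cx)) /=.
by rewrite clamp_id.
Qed.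

Lemma segmentWE (x : R -> V) (t : R) :
  [lipschitz x s | s in `[t - r%:num, t]%classic] ->
  segmentW x t = segment x t :> Cspace V r.
Proof.
move=> [M [_ xM]].
have xk : exists2 k, 0 <= k & forall s u, `[t - r%:num, t]%classic s ->
    `[t - r%:num, t]%classic u -> `|x s - x u| <= k * `|s - u|.
  exists (Num.max (M + 1) 0); first by rewrite le_max lexx orbT.
  move=> s u As Au; have M1 : M < M + 1 by rewrite ltrDl.
  have /= /(_ (conj As Au)) := xM _ M1 (s, u).
  by move=> /le_trans; apply; rewrite ler_wpM2r// le_max lexx.
have {xk} [k k0 xk] := xk.
have cx : {within `[t - r%:num, t], continuous x}.
  apply/subspace_continuousP => s As; apply/cvgrPdist_le => e e0.
  have e1 : 0 < (k + 1)^-1 * e by rewrite mulr_gt0// invr_gt0 ltr_wpDl.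
  apply: (@filterS _ (within _ (nbhs s)) _ (fun u =>
    `[t - r%:num, t]%classic u /\ `|s - u| <= (k + 1)^-1 * e)).
    move=> u [Au su]; rewrite (le_trans (xk _ _ As Au))//.
    rewrite (@le_trans _ _ ((k + 1) * `|s - u|))//.
      by rewrite ler_wpM2r// lerDl.
    by rewrite -ler_pdivlMl// ltr_wpDl.
  have := cvgr_dist_le (F := nbhs s) (FF := nbhs_filter s) id s cvg_id _ e1.
  by apply: filterS => u su Au.
rewrite /segmentW /insubd insubT //=; apply/is_WfunP; exists k => s u.
rewrite /segment /insubd (insubT _ (segment_is_Cfun cx)) /=.
rewrite (le_trans (xk _ _ (shift_clamp_itv _ _) (shift_clamp_itv _ _)))//.
by rewrite ler_wpM2l// opprD addrACA subrr add0r clamp_lip.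
Qed.

End segments.

Section calculus.
Context {R : realType}.
Local Notation mu := (@lebesgue_measure R).

(* Derivative relative to A: one-sided at the endpoints of an interval. *)
Definition has_deriv_within (V : normedModType R) (A : set R) (x : R -> V)
    (t : R) (v : V) : Prop :=
  (s - t)^-1 *: (x s - x t) @[s --> within A t^'] --> v.

(* Extended-real valued, so that it is meaningful for any map. *)
Definition opnorm (U V : normedModType R) (A : U -> V) : \bar R :=
  ereal_sup [set `|A h|%:E | h in [set h | `|h| <= 1]].

(* Continuity on D of a family of bounded linear operators, for the operator
   norm. *)
Definition op_continuous (X : topologicalType) (U V : normedModType R)
    (D : set X) (A : X -> U -> V) : Prop :=
  forall p, D p ->
    opnorm (fun h => A q h - A p h) @[q --> within D (nbhs p)] --> 0%E.

Definition abs_continuous (V : normedModType R) (a b : R) (u : R -> V) : Prop :=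
  forall e, 0 < e -> exists2 d, 0 < d &
    forall (m : nat) (s t : 'I_m -> R),
      (forall i, a <= s i <= t i /\ t i <= b) ->
      trivIset setT (fun i => `]s i, t i[%classic) ->
      \sum_(i < m) (t i - s i) < d ->
      \sum_(i < m) `|u (t i) - u (s i)| < e.

(* Piecewise strictly monotone absolutely continuous functions from [a, b] to
   [c, d]; the mesh is a :: s. *)
Definition PM (a b c d : R) (u : R -> R) : Prop :=
  [/\ abs_continuous a b u,
      (forall t : R, t \in `[a, b] -> u t \in `[c, d]) &
      exists2 s : seq R, itv_partition a b s &
        forall i, (i < size s)%N ->
          let t_i := nth b (a :: s) i in
          let t_i1 := nth b (a :: s) i.+1 in
          (forall a' b' : R, t_i < a' -> a' < b' -> b' < t_i1 ->
            (0 < ess_inf (mu_itv a' b') (EFin \o derive1 u))%E) \/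
          (forall a' b' : R, t_i < a' -> a' < b' -> b' < t_i1 ->
            (ess_sup (mu_itv a' b') (EFin \o derive1 u) < 0)%E)].

End calculus.

Section delay_equation.
Context {R : realType} {n : nat}.
Variables (nu : vnorm R n) (r : {posnum R}) (Theta Xi : normedModType R).
Local Notation V := (rvec nu).
Local Notation C := (Cspace V r).
Local Notation W := (Wspace nu r).
Local Notation Gamma := (Gspace nu r Theta Xi).
Local Notation mu := (@lebesgue_measure R).
Variables (T : \bar R) (O1 : set C) (O2 : set V) (O3 : set Theta) (O4 : set Xi).
Variables (f : R -> C -> V -> Theta -> V) (tau : R -> C -> Xi -> R).

(* [0, T], that is [0, +oo[ when T = +oo. The functions f and tau are total and
   only their values on f_dom and tau_dom are meaningful. *)
Definition times : set R := [set t | 0 <= t /\ (t%:E <= T)%E].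

Definition bounded_in_W (M : set C) : Prop :=
  exists2 B : set W, bounded_set B & M = [set (w : C) | w in B].

Definition admissible1 (M1 : set C) : Prop :=
  [/\ M1 `<=` O1, closed M1 & bounded_in_W M1].
Definition admissible2 (M2 : set V) : Prop := M2 `<=` O2 /\ compact M2.
Definition admissible3 (M3 : set Theta) : Prop :=
  [/\ M3 `<=` O3, closed M3 & bounded_set M3].
Definition admissible4 (M4 : set Xi) : Prop :=
  [/\ M4 `<=` O4, closed M4 & bounded_set M4].

Definition f_dom : set (R * C * V * Theta) :=
  [set p | [/\ times p.1.1.1, O1 p.1.1.2, O2 p.1.2 & O3 p.2]].
Definition tau_dom : set (R * C * Xi) :=
  [set p | [/\ times p.1.1, O1 p.1.2 & O4 p.2]].

(* D_i f is the partial Frechet derivative in the i-th argument, the time being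
   the first one. *)
Definition D2f (t : R) (psi : C) (u : V) (theta : Theta) : C -> V :=
  'd (fun psi' => f t psi' u theta) psi.
Definition D3f (t : R) (psi : C) (u : V) (theta : Theta) : V -> V :=
  'd (fun u' => f t psi u' theta) u.
Definition D4f (t : R) (psi : C) (u : V) (theta : Theta) : Theta -> V :=
  'd (fun theta' => f t psi u theta') theta.
Definition D2tau (t : R) (psi : C) (xi : Xi) : C -> R :=
  'd (fun psi' => tau t psi' xi) psi.
Definition D3tau (t : R) (psi : C) (xi : Xi) : Xi -> R :=
  'd (fun xi' => tau t psi xi') xi.

Definition f1 : Prop :=
  {within f_dom, continuous (fun p => f p.1.1.1 p.1.1.2 p.1.2 p.2)}.

Definition f2 : Prop :=
  forall (a : R) M1 M2 M3, 0 < a -> (a%:E <= T)%E ->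
  admissible1 M1 -> admissible2 M2 -> admissible3 M3 ->
  exists L1 : R, forall (t : R) psi psi' u u' theta theta',
    t \in `[0, a] -> M1 psi -> M1 psi' -> M2 u -> M2 u' ->
    M3 theta -> M3 theta' ->
    `|f t psi u theta - f t psi' u' theta'|
      <= L1 * (`|psi - psi'| + `|u - u'| + `|theta - theta'|).

Definition f3 : Prop :=
  [/\ forall p, f_dom p ->
        [/\ differentiable (fun psi => f p.1.1.1 psi p.1.2 p.2) p.1.1.2,
            differentiable (fun u => f p.1.1.1 p.1.1.2 u p.2) p.1.2 &
            differentiable (fun theta => f p.1.1.1 p.1.1.2 p.1.2 theta) p.2],
      op_continuous f_dom (fun p => D2f p.1.1.1 p.1.1.2 p.1.2 p.2),
      op_continuous f_dom (fun p => D3f p.1.1.1 p.1.1.2 p.1.2 p.2) &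
      op_continuous f_dom (fun p => D4f p.1.1.1 p.1.1.2 p.1.2 p.2)].

Definition tau1 : Prop :=
  {within tau_dom, continuous (fun p => tau p.1.1 p.1.2 p.2)}.

Definition tau2 : Prop :=
  forall (a : R) M1 M4, 0 < a -> (a%:E <= T)%E ->
  admissible1 M1 -> admissible4 M4 ->
  exists L2 : R, forall (t : R) psi psi' xi xi',
    t \in `[0, a] -> M1 psi -> M1 psi' -> M4 xi -> M4 xi' ->
    `|tau t psi xi - tau t psi' xi'| <= L2 * (`|psi - psi'| + `|xi - xi'|).

Definition tau3 : Prop :=
  [/\ forall p, tau_dom p ->
        differentiable (fun psi => tau p.1.1 psi p.2) p.1.2 /\
        differentiable (fun xi => tau p.1.1 p.1.2 xi) p.2,
      op_continuous tau_dom (fun p => D2tau p.1.1 p.1.2 p.2) &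
      op_continuous tau_dom (fun p => D3tau p.1.1 p.1.2 p.2)].

Definition tau4 : Prop :=
  forall (a : R) M1 M4, 0 < a -> (a%:E <= T)%E ->
  admissible1 M1 -> admissible4 M4 ->
  exists L2 : R, forall (t t' : R) psi xi,
    t \in `[0, a] -> t' \in `[0, a] -> M1 psi -> M4 xi ->
    `|tau t psi xi - tau t' psi xi| <= L2 * `|t - t'|.

Definition tau5 : Prop :=
  forall (a : R) M1 M4, 0 < a -> (a%:E <= T)%E ->
  admissible1 M1 -> admissible4 M4 ->
  exists2 L4 : R, 0 <= L4 & forall xi xi' (y y' : R -> V),
    M4 xi -> M4 xi' ->
    [lipschitz y t | t in `[- r%:num, a]%classic] ->
    [lipschitz y' t | t in `[- r%:num, a]%classic] ->
    (forall t : R, t \in `[0, a] -> M1 (segment r y t) /\ M1 (segment r y' t)) ->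
    {ae mu, forall t : R, t \in `[0, a] ->
      `|derive1 (fun s => tau s (segment r y s) xi) t
        - derive1 (fun s => tau s (segment r y' s) xi') t|
      <= L4 * (`|segmentW r y t - segmentW r y' t| + `|xi - xi'|)}.

Definition is_solution (alpha : R) (g : Gamma) (x : R -> V) : Prop :=
  [/\ {within `[- r%:num, alpha], continuous x},
      forall t : R, t \in `[- r%:num, 0] -> x t = Gphi g t,
      forall t : R, t \in `[0, alpha] ->
        O1 (segment r x t) /\ O2 (x (t - tau t (segment r x t) (Gxi g))) &
      forall t : R, t \in `[0, alpha] ->
        has_deriv_within `[0, alpha] x t
          (f t (segment r x t) (x (t - tau t (segment r x t) (Gxi g)))
             (Gtheta g))].

Definition is_unique_solution (alpha : R) (g : Gamma) (x : R -> V) : Prop :=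
  is_solution alpha g x /\
  forall y, is_solution alpha g y ->
    forall t : R, t \in `[- r%:num, alpha] -> y t = x t.

Definition Pi : set Gamma :=
  [set g | [/\ O1 (Gphi g), O2 (Gphi g (- tau 0 (Gphi g) (Gxi g))),
               O3 (Gtheta g) & O4 (Gxi g)]].

Definition delayed_time (x : R -> V) (xi : Xi) (t : R) : R :=
  t - tau t (segment r x t) xi.

Definition P2 (P : set Gamma) (x : Gamma -> R -> V) (alpha : R) : set Gamma :=
  [set g | P g /\
    PM 0 (Num.min r%:num alpha) (- r%:num) (Num.min r%:num alpha)
      (delayed_time (x g) (Gxi g))].

(* The two-sided derivative of x may fail to exist at -r, at 0 and on a null
   subset of [-r, 0]; when t - tau (t, x_t, xi) is in PM it avoids these points
   for almost every t. *)
Definition variational_op (g : Gamma) (x : R -> V) (t : R)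
    (hphi : C) (htheta : Theta) (hxi : Xi) : V :=
  let xi := Gxi g in
  let theta := Gtheta g in
  let x_t := segment r x t in
  let u := delayed_time x xi t in
  D2f t x_t (x u) theta hphi + D4f t x_t (x u) theta htheta
  + D3f t x_t (x u) theta
      (- ((D2tau t x_t xi hphi + D3tau t x_t xi hxi) *: derive1 x u)
       + hphi (- tau t x_t xi)).

Definition is_variational_solution (alpha : R) (g : Gamma) (x : R -> V)
    (hphi : C) (htheta : Theta) (hxi : Xi) (z : R -> V) : Prop :=
  [/\ {within `[- r%:num, alpha], continuous z},
      abs_continuous 0 alpha z,
      forall t : R, t \in `[- r%:num, 0] -> z t = hphi t &
      {ae mu, forall t : R, t \in `[0, alpha] ->
        is_derive t 1 z (variational_op g x t (segment r z t) htheta hxi)}].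

Definition is_unique_variational_solution (alpha : R) (g : Gamma) (x : R -> V)
    (hphi : C) (htheta : Theta) (hxi : Xi) (z : R -> V) : Prop :=
  is_variational_solution alpha g x hphi htheta hxi z /\
  forall z', is_variational_solution alpha g x hphi htheta hxi z' ->
    forall t : R, t \in `[- r%:num, alpha] -> z' t = z t.

End delay_equation.

(* Main.v *)
(* Fix g in P2 and g + h in P, and let y = x(., g + h) - x(., g), u(t) = t - tau(t, x_t, xi)
   and u_h be the same function for g + h. By hypothesis y is bounded by L|h| and has
   Lipschitz constant L|h|, so that dy/dt differs from the variational operator applied
   to y_t only by terms uniformly o(|h|) and by x(u_h) - x(u) - (u_h - u) x'(u), where
   x = x(., g). A Lipschitz function is uniformly differentiable off a set E of small
   measure, and as u is piecewise strictly monotone, with derivative bounded away from 0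
   off short intervals, u^-1(E) has small measure too. On such an exceptional set only
   the Lipschitz constants are used: a mean value inequality and a Gronwall lemma with
   an exceptional set of small measure replace Lebesgue integration. They show that the
   difference quotients (x(., g + k h) - x(., g)) / k form a Cauchy family as k -> 0;
   their limit z satisfies the variational equation at the density points of the
   complements of the exceptional sets. The same Gronwall lemma gives the uniqueness of
   z, hence its linearity in h, the Frechet estimate, and the continuity in g; for the
   latter, (tau5) makes u_h - u Lipschitz with a small constant, so that the bound on
   the measure of u^-1(E) also holds for u_h, with the same constants. *)
Require Import Defs.
From HB Require Import structures.
From mathcomp Require Import all_boot all_order all_algebra.
From mathcomp Require Import all_classical all_reals all_analysis.
From mathcomp Require Import measurable_realfun ess_sup_inf ring lra.
Set Implicit Arguments.
Unset Strict Implicit.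
Unset Printing Implicit Defensive.
Import Order.TTheory GRing.Theory Num.Theory.
Import numFieldNormedType.Exports.
Local Open Scope classical_set_scope.
Local Open Scope ring_scope.


(** * Derivatives and real induction *)

(** The obstacle is the term x'(u(t)). On [-r, 0] the function x is only Lipschitz, so x'(u(t))
    makes sense for almost every t only because u pulls null sets back to null sets, and in general
    it is continuous neither in t nor in g. What survives is continuity off small sets. These are
    harmless because every function compared here (increments of x in g, their quotients by k,
    variational solutions) has a Lipschitz constant proportional to |h|: a set of measure m costs
    O(m |h|). The order of choices is forced. For a given e, short intervals around the mesh points
    of u are cut off, of total length about e; this fixes the expansion factor of u on the rest,
    hence a constant C; only then is E chosen, with measure about e / (C + 1), and last the radius d
    of the neighbourhood of g. No existence theorem for the variational equation is invoked: the
    solutions x(., g + k h) are given, and any two of their quotients are approximate solutions of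
    one linear problem with the same initial value, which Gronwall compares. *)

Definition hasd (R : realType) (V : normedModType R) (F : R -> V) (t : R) (v : V) :=
  forall e, 0 < e -> exists2 d, 0 < d & forall s, `|s - t| <= d ->
    `|F s - F t - (s - t) *: v| <= e * `|s - t|.

Section hasd.
Context {R : realType} {V : normedModType R}.
Implicit Types (F G : R -> V) (t : R) (v w : V).

(** Mean value arguments by real induction consume increments over short steps, [s = t] included, so
    the proof works with [hasd] and returns to [is_derive] only at its interface. *)
Lemma hasd_is_derive F t v : hasd F t v <-> is_derive t 1 F v.
Proof.
split=> [H|[dF dv] e e0].
  have Fv : h^-1 *: ((F \o shift t) h - F t) @[h --> 0^'] --> v.
    apply/cvgrPdist_le => e e0; have [d d0 Hd] := H e e0.
    near=> h.
    have h0 : h != 0 by near: h; exact: nbhs_dnbhs_neq.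
    have hd : `|h| <= d.
      by near: h; apply: nbhs_dnbhs; near do rewrite ltW//; exact: dnbhs0_lt.
    have := Hd (h + t); rewrite addrK => /(_ hd).
    rewrite distrC -ler_pdivrMr ?normr_gt0// mulrC -normfV -normrZ.
    by rewrite scalerBr scalerA mulVf// scale1r.
  have Fv' : (fun h => h^-1 *: (F (h *: 1 + t) - F t)) @ 0^' --> v.
    by apply: cvg_trans Fv; apply: near_eq_cvg; near=> h; rewrite /= [h *: 1]mulr1.
  by split; [apply/cvg_ex; exists v|exact: cvg_lim].
have : (fun h => h^-1 *: (F (h *: 1 + t) - F t)) @ 0^' --> v.
  by rewrite -dv; exact: dF.
move=> /cvgrPdist_le /(_ _ e0) /nbhs_ballP[d /= d0 Hd]; exists (d / 2); first by rewrite divr_gt0.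
move=> s sd; have [->|st] := eqVneq s t.
  by rewrite !subrr scale0r subrr !normr0 mulr0.
have st0 : s - t != 0 by rewrite subr_eq0.
have := Hd (s - t); rewrite /ball/= sub0r normrN => /(_ _ st0).
rewrite [(s - t) *: 1]mulr1 subrK => H.
have : `|s - t| < d by rewrite (le_lt_trans sd)// ltr_pdivrMr// mulr2n mulrDr mulr1 ltrDl.
move=> /H; rewrite distrC -[leLHS](mulKf (x := `|s - t|)) ?normr_eq0//.
rewrite ler_pdivrMl ?normr_gt0// [leRHS]mulrC -normrZ => H'.
by move: H'; rewrite scalerBr scalerA divff// scale1r.
Unshelve. all: by end_near. Qed.

Lemma hasd_derive1 F t v : hasd F t v -> derive1 F t = v.
Proof. by move=> /hasd_is_derive[_ <-]; rewrite derive1E. Qed.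

Lemma derivable_hasd F t : derivable F t 1 <-> hasd F t (derive1 F t).
Proof.
split=> [dF|/hasd_is_derive[]//]; apply/hasd_is_derive.
by rewrite derive1E; exact/derivableP.
Qed.

Lemma hasdD F G t v w : hasd F t v -> hasd G t w -> hasd (fun s => F s + G s) t (v + w).
Proof. by move=> /hasd_is_derive ? /hasd_is_derive ?; apply/hasd_is_derive; exact: is_deriveD. Qed.

Lemma hasdB F G t v w : hasd F t v -> hasd G t w -> hasd (fun s => F s - G s) t (v - w).
Proof. by move=> /hasd_is_derive ? /hasd_is_derive ?; apply/hasd_is_derive; exact: is_deriveB. Qed.

Lemma hasdZ (c : R) F t v : hasd F t v -> hasd (fun s => c *: F s) t (c *: v).
Proof. by move=> /hasd_is_derive ?; apply/hasd_is_derive; exact: is_deriveZ. Qed.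

Lemma hasd_lin (c : V) t : hasd (fun s : R => s *: c) t c.
Proof.
by move=> e e0; exists 1 => // s _; rewrite -scalerBl subrr normr0 mulr_ge0// ltW.
Qed.

Lemma hasd_local F G t v d : 0 < d -> (forall s, `|s - t| <= d -> F s = G s) ->
  hasd F t v -> hasd G t v.
Proof.
move=> d0 FG H e e0; have [d' d'0 Hd] := H e e0.
exists (Num.min d d'); first by rewrite lt_min d0.
move=> s; rewrite le_min => /andP[sd sd'].
by rewrite -!FG ?subrr ?normr0 ?(ltW d0)//; exact: Hd.
Qed.

Lemma hasd_le F t v k d : 0 < d ->
  (forall s, `|s - t| <= d -> `|F s - F t| <= k * `|s - t|) ->
  hasd F t v -> `|v| <= k.
Proof.
move=> d0 Fk H; apply/ler_addgt0Pl => e e0.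
have [d' d'0 Hd] := H e e0; pose m := Num.min d d'.
have m0 : 0 < m by rewrite lt_min d0.
have mE : `|t + m - t| = m by rewrite addrAC subrr add0r gtr0_norm.
have md : m <= d by rewrite /m ge_min lexx.
have md' : m <= d' by rewrite /m ge_min lexx orbT.
have := Hd (t + m); rewrite mE => /(_ md').
have := Fk (t + m); rewrite mE => /(_ md).
rewrite [t + m]addrC addrK => h1 h2.
rewrite -(ler_pM2l m0) -[in leLHS](gtr0_norm m0) -normrZ.
rewrite -[m *: v](subrK (F (m + t) - F t)) mulrDr [m * e]mulrC [m * k]mulrC.
by rewrite (le_trans (ler_normD _ _))// lerD// distrC.
Qed.

End hasd.

(** * Real induction on a compact interval *)

Section cousin.
Context {R : realType}.

(** Let [c] be the supremum of the points reached from [a]. The left half of the local hypothesis at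
    [c] shows that [c] is reached, the right half that the process goes on past [c] unless [c = b].
    This stands in for every compactness argument on an interval below. *)
Lemma cousin (Q : R -> R -> Prop) a b : a <= b ->
  (forall s t u, a <= s <= t -> t <= u <= b -> Q s t -> Q t u -> Q s u) ->
  (forall t, a <= t <= b -> exists2 d, 0 < d &
     (forall s, a <= s -> t - d <= s <= t -> Q s t) /\
     (forall u, u <= b -> t <= u <= t + d -> Q t u)) ->
  Q a b.
Proof.
move=> ab tr loc; pose S := [set t | a <= t <= b /\ Q a t].
have Sa : S a.
  split; first by rewrite lexx.
  have [|d d0 [+ _]] := loc a; first by rewrite lexx.
  by apply => //; rewrite lexx andbT lerBlDr lerDl ltW.
have hS : has_sup S by split; [exists a|exists b => t [/andP[]]].
pose c := sup S.
have ac : a <= c by exact: sup_upper_bound.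
have cb : c <= b by apply: sup_le_ub; [exists a|move=> t [/andP[]]].
have [|d d0 [lc rc]] := loc c; first by rewrite ac.
have [t [/andP[at' tb] Qat] ct] := sup_adherent d0 hS.
have tc : t <= c by apply: sup_upper_bound => //; split; rewrite ?at'.
have Qac : Q a c.
  apply: (tr a t c); rewrite ?lexx ?at' ?tc ?cb//.
  by apply: lc => //; rewrite tc ltW.
(* A reached point cannot exceed [c], so the minimum must be [b], not [c + d]. *)
pose u := Num.min b (c + d).
have cu : c <= u by rewrite le_min cb lerDl ltW.
have ub : u <= b by rewrite ge_min lexx.
have Qau : Q a u.
  apply: (tr a c u); rewrite ?lexx ?ac ?cu ?ub//.
  by apply: rc => //; rewrite cu ge_min lexx orbT.
have uc : u <= c by apply: sup_upper_bound => //; split; rewrite ?(le_trans ac)//.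
have ubE : u = b.
  move: uc; rewrite /u /Num.min/Order.min; case: ifP => // _ h.
  by move: d0; rewrite ltNge -(lerD2l c) addr0 h.
by rewrite -ubE.
Qed.

End cousin.

(** * A reflexive decision procedure for linear identities in normed modules *)

Section linear_normalisation.
Context {R : realType} {V : normedModType R}.

Inductive lterm :=
  | LVar of nat | LAdd of lterm & lterm | LOpp of lterm | LScale of R & lterm | LZero.

Fixpoint leval (e : seq V) t : V :=
  match t with
  | LVar i => nth 0 e i
  | LAdd a b => leval e a + leval e b
  | LOpp a => - leval e a
  | LScale c a => c *: leval e a
  | LZero => 0
  end.

Fixpoint lcoef t (i : nat) : R :=
  match t with
  | LVar j => if Nat.eqb j i then 1 else 0
  | LAdd a b => lcoef a i + lcoef b i
  | LOpp a => - lcoef a i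
  | LScale c a => c * lcoef a i
  | LZero => 0
  end.

Lemma levalE e t : leval e t = \sum_(i < size e) lcoef t i *: nth 0 e i.
Proof.
elim: t => [j|a IHa b IHb|a IHa|c a IHa|] /=; rewrite ?IHa ?IHb.
- have [je|je] := ltnP j (size e).
    rewrite (bigD1 (Ordinal je))//= PeanoNat.Nat.eqb_refl scale1r big1 ?addr0// => i ij.
    case: PeanoNat.Nat.eqb_spec => [ji|_]; last by rewrite scale0r.
    by move: ij; rewrite -val_eqE/= ji eqxx.
  rewrite nth_default// big1// => i _; case: PeanoNat.Nat.eqb_spec => [ji|_].
    by move: je; rewrite ji leqNgt ltn_ord.
  by rewrite scale0r.
- by rewrite -big_split/=; apply: eq_bigr => i _; rewrite scalerDl.
- by rewrite -sumrN; apply: eq_bigr => i _; rewrite scaleNr.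
- by rewrite scaler_sumr; apply: eq_bigr => i _; rewrite scalerA.
- by rewrite big1// => i _; rewrite scale0r.
Qed.

(** A recursive conjunction over the atoms, so that on reified terms [cbn] unfolds it into one ring
    identity per atom. *)
Fixpoint lsame n a b : Prop :=
  if n is n'.+1 then lcoef a n' = lcoef b n' /\ lsame n' a b else True.

Lemma leval_eq e a b : lsame (size e) a b -> leval e a = leval e b.
Proof.
move=> H; rewrite !levalE; apply: eq_bigr => -[i /= ie] _; congr (_ *: _).
elim: (size e) ie H => // m IH; rewrite ltnS leq_eqVlt => /predU1P[-> []//|im [_]].
exact: IH.
Qed.

End linear_normalisation.

Ltac lmod_mem x e :=
  match e with
  | nil => constr:(false)
  | x :: _ => constr:(true)
  | _ :: ?e' => lmod_mem x e'
  end.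
Ltac lmod_atoms t e :=
  lazymatch t with
  | GRing.add ?a ?b => let e' := lmod_atoms a e in lmod_atoms b e'
  | GRing.opp ?a => lmod_atoms a e
  | GRing.scale _ ?a => lmod_atoms a e
  | GRing.zero => e
  | _ => lazymatch lmod_mem t e with true => e | false => constr:(t :: e) end
  end.
Ltac lmod_index x e :=
  match e with
  | x :: _ => constr:(0%N)
  | _ :: ?e' => let i := lmod_index x e' in constr:(S i)
  end.
Ltac lmod_reify R t e :=
  lazymatch t with
  | GRing.add ?a ?b =>
      let a' := lmod_reify R a e in let b' := lmod_reify R b e in constr:(LAdd a' b')
  | GRing.opp ?a => let a' := lmod_reify R a e in constr:(LOpp a')
  | GRing.scale ?c ?a => let a' := lmod_reify R a e in constr:(LScale (c : R) a')
  | GRing.zero => constr:(@LZero R)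
  | _ => let i := lmod_index t e in constr:(@LVar R i)
  end.
(* Decides linear identities in a normed module over [R], up to ring identities
   between the coefficients. *)
Ltac lmod R := lazymatch goal with |- @eq ?V ?a ?b =>
  let e0 := lmod_atoms a (@nil V) in
  let e := lmod_atoms b e0 in
  let a' := lmod_reify R a e in
  let b' := lmod_reify R b e in
  transitivity (leval e a'); [reflexivity|];
  transitivity (leval e b'); [|reflexivity];
  apply: leval_eq; cbn -[GRing.add GRing.opp GRing.mul GRing.zero GRing.one];
  repeat (split; [ring|]); exact I end.


(** * Mean value inequalities with an exceptional set *)

Section mean_value.
Context {R : realType}.
Local Notation mu := (@lebesgue_measure R).

Lemma mu_oc_itv (s t : R) : s <= t -> mu (`]s, t]%classic : set R) = (t - s)%:E.
Proof.
move=> st; rewrite lebesgue_measure_itv/= lte_fin.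
by move: st; rewrite le_eqVlt => /predU1P[->|->//]; rewrite ltxx subrr.
Qed.

Lemma mu_set1 (a : R) : mu [set a] = 0%E.
Proof. by rewrite lebesgue_measure_set1. Qed.

Lemma mu_setU_le (A B : set R) (a b : R) : measurable A -> measurable B ->
  (mu A <= a%:E)%E -> (mu B <= b%:E)%E -> (mu (A `|` B) <= (a + b)%:E)%E.
Proof.
move=> mA mB Aa Bb; apply: le_trans (measureU2 mu mA mB) _.
by rewrite EFinD leeD.
Qed.

Lemma mu_setU_null (A Z : set R) (a : R) : measurable A -> measurable Z ->
  (mu A <= a%:E)%E -> mu Z = 0%E -> (mu (A `|` Z) <= a%:E)%E.
Proof.
move=> mA mZ Aa Z0; rewrite -[a]addr0; apply: mu_setU_le => //.
by move: Z0 => /= ->.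
Qed.

Lemma mu_le (A B : set R) : measurable A -> measurable B -> A `<=` B -> (mu A <= mu B)%E.
Proof. by move=> mA mB AB; apply: le_measure; rewrite ?inE. Qed.

Lemma outer_open (B : set R) (m e : R) : measurable B -> (mu B <= m%:E)%E -> 0 < e ->
  exists U : set R, [/\ open U, B `<=` U & (mu U <= (m + e)%:E)%E].
Proof.
move=> mB Bm e0.
have [|U [oU BU Ue]] := lebesgue_regularity_outer mB _ e0.
  by rewrite (le_lt_trans Bm)// ltry.
exists U; split => //.
rewrite -[U](setUIDK U B) (le_trans (measureU2 _ _ _))//.
- by apply: measurableI => //; exact: open_measurable.
- by apply: measurableD => //; exact: open_measurable.
by rewrite EFinD leeD//; [rewrite setIidr|exact: ltW].
Qed.

Section open_length.
Variable U : set R.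
Hypothesis oU : open U.

(** The interval is half-open so that the lengths over adjacent steps add up exactly, as the
    concatenation of steps in [cousin] requires. *)
Definition open_length (s t : R) : R := fine (mu (U `&` `]s, t]%classic)).

Let mU : measurable U. Proof. exact: open_measurable. Qed.

Lemma open_length_fin s t : s <= t -> (mu (U `&` `]s, t]%classic) < +oo)%E.
Proof.
move=> st; rewrite (@le_lt_trans _ _ (t - s)%:E) ?ltry// -mu_oc_itv//.
by apply: le_measure; rewrite ?inE//; exact: measurableI.
Qed.

Lemma open_length_ge0 s t : 0 <= open_length s t.
Proof. exact: fine_ge0. Qed.

Lemma open_length_add s t u : s <= t -> t <= u ->
  open_length s u = open_length s t + open_length t u.
Proof.
move=> st tu; rewrite /open_length -fineD ?ge0_fin_numE ?open_length_fin//.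
congr fine; rewrite -measureU//.
- congr (mu _); rewrite -setIUr; congr (_ `&` _).
  apply/seteqP; split=> x; rewrite /= !in_itv/=.
    by move=> /andP[sx xu]; case: (leP x t) => xt; [left|right]; rewrite ?sx ?xu.
  by move=> [|] /andP[h1 h2]; apply/andP; split; lra.
- exact: measurableI.
- exact: measurableI.
- rewrite -subset0 => x [[_ +] [_ +]]; rewrite /= !in_itv/=.
  by move=> /andP[h1 h2] /andP[h3 h4]; move: h3; rewrite ltNge h2.
Qed.

Lemma open_length_sub s t : s <= t -> (forall x, s < x <= t -> U x) ->
  open_length s t = t - s.
Proof.
move=> st sU; rewrite /open_length (_ : U `&` _ = `]s, t]%classic) ?mu_oc_itv//.
by apply/setIidr => x; rewrite /= in_itv/=; exact: sU.
Qed.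

Lemma open_length_le s t m : (mu U <= m%:E)%E -> open_length s t <= m.
Proof.
move=> Um; have Ufin : (mu (U `&` `]s, t]%classic) <= m%:E)%E.
  by rewrite (le_trans _ Um)//; apply: le_measure; rewrite ?inE//; exact: measurableI.
rewrite -lee_fin /open_length fineK// ge0_fin_numE//.
by rewrite (le_lt_trans Ufin) ?ltry.
Qed.

End open_length.

Variable V : normedModType R.
Implicit Types F : R -> V.

(* Real induction: a step from a point of an open neighbourhood [U] of [B] is
   charged to the measure of [U], any other step to the derivative. *)
Lemma mvt_bad F a b k M m (B : set R) : a <= b -> 0 <= M ->
  (forall s t, a <= s <= b -> a <= t <= b -> `|F s - F t| <= M * `|s - t|) ->
  measurable B -> (mu B <= m%:E)%E ->
  (forall t, a < t < b -> ~ B t -> exists2 v, hasd F t v & `|v| <= k) ->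
  `|F b - F a| <= Num.max k 0 * (b - a) + M * m.
Proof.
move=> ab M0 FM mB Bm Fk; apply/ler_addgt0Pl => e0 e0_gt0.
set k' := Num.max k 0.
have k'0 : 0 <= k' by rewrite le_max lexx orbT.
(* The slack [e] is spent twice: on the slope, over the length [b - a], and on the measure of [U],
   with the factor [M]. The final 1 keeps the denominator positive. *)
pose e := e0 / (b - a + M + 1).
have D0 : 0 < b - a + M + 1 by rewrite ltr_wpDl// addr_ge0// subr_ge0.
have e_gt0 : 0 < e by rewrite divr_gt0.
(* Derivatives are known only inside ]a, b[; the endpoints join the exceptional set at no cost in
   measure. *)
have mab : measurable [set a; b] by apply: measurableU; exact: measurable_set1.
have mB' : measurable (B `|` [set a; b]) by exact: measurableU.
have B'm : (mu (B `|` [set a; b]) <= m%:E)%E.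
  rewrite (le_trans (measureU2 _ _ _))//.
  rewrite -[leRHS]adde0 leeD// le_eqVlt; apply/orP; left; apply/eqP.
  exact/countable_lebesgue_measure0/finite_set_countable/finite_set2.
have [U [oU BU Um]] := outer_open mB' B'm e_gt0.
pose Q s t := `|F t - F s| <= (k' + e) * (t - s) + M * open_length U s t.
have ke0 : 0 <= k' + e by rewrite addr_ge0// ltW.
have Qab : Q a b.
  apply: (@cousin _ Q) => // [s t u /andP[as_ st] /andP[tu ub] Qst Qtu|t /andP[at_ tb]].
    rewrite /Q (open_length_add oU st tu) -(subrK (F t) (F u)) -addrA.
    rewrite (le_trans (ler_normD _ _))// (le_trans (lerD Qtu Qst))//.
    by rewrite le_eqVlt; apply/orP; left; apply/eqP; ring.
  have [Ut|nUt] := pselect (U t).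
    have /nbhs_ballP[d /= d0 dU] := open_nbhs_nbhs (conj oU Ut).
    exists (d / 2); first by rewrite divr_gt0.
    split=> [s as_ /andP[ts st]|u ub /andP[tu ud]]; rewrite /Q.
      rewrite open_length_sub//; last first.
        move=> x /andP[sx xt]; apply: dU; rewrite /ball/= ger0_norm ?subr_ge0//.
        by lra.
      have := FM t s; rewrite at_ tb as_ (le_trans st tb) => /(_ erefl erefl).
      move=> /le_trans; apply; rewrite ger0_norm ?subr_ge0// lerDr mulr_ge0//.
      by rewrite subr_ge0.
    rewrite open_length_sub//; last first.
      move=> x /andP[sx xt]; apply: dU; rewrite /ball/= distrC ger0_norm ?subr_ge0 ?ltW//.
      by lra.
    have := FM u t; rewrite at_ tb ub (le_trans at_ tu) => /(_ erefl erefl).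
    move=> /le_trans; apply; rewrite ger0_norm ?subr_ge0// lerDr mulr_ge0//.
    by rewrite subr_ge0.
  have nB : ~ (B `|` [set a; b]) t by move=> /BU.
  have tab : a < t < b.
    rewrite !lt_neqAle at_ tb !andbT; apply/andP; split; apply/eqP => tE; apply: nB.
      by right; left.
    by right; right.
  have [|v Fv vk] := Fk _ tab; first by move=> Bt; apply: nB; left.
  have [d d0 Hd] := Fv _ e_gt0; exists d => //.
  have est s : `|s - t| <= d -> `|F s - F t| <= (k' + e) * `|s - t|.
    move=> sd; rewrite -[F s - F t](subrK ((s - t) *: v)) mulrDl addrC.
    rewrite (le_trans (ler_normD _ _))// lerD//; last exact: Hd.
    by rewrite normrZ mulrC ler_wpM2r// (le_trans vk)// le_max lexx.
  split=> [s as_ /andP[ts st]|u ub /andP[tu ud]]; rewrite /Q.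
    rewrite distrC (le_trans (est s _))//.
      by rewrite distrC ger0_norm ?subr_ge0//; lra.
    by rewrite distrC ger0_norm ?subr_ge0// lerDl mulr_ge0// open_length_ge0.
  rewrite (le_trans (est u _))//.
    by rewrite ger0_norm ?subr_ge0//; lra.
  by rewrite ger0_norm ?subr_ge0// lerDl mulr_ge0// open_length_ge0.
have := ler_wpM2l M0 (open_length_le oU a b Um).
have : e * (b - a + M + 1) = e0 by rewrite /e divfK ?gt_eqF.
by move: Qab; rewrite /Q => ? ? ?; nra.
Qed.

End mean_value.

(** * Absolutely continuous functions *)

Section absolute_continuity.
Context {R : realType} {V : normedModType R}.
Local Notation mu := (@lebesgue_measure R).

(** Ordered families of nonoverlapping intervals between [s] and [t]. Lists replace the indexed
    families of [abs_continuous] because they concatenate, which makes them usable in real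
    induction. *)
Fixpoint chain (s : R) (l : seq (R * R)) (t : R) : bool :=
  if l is p :: l' then [&& s <= p.1, p.1 <= p.2 & chain p.2 l' t] else s <= t.

Lemma chain_le s l t : chain s l t -> s <= t.
Proof.
elim: l s => //= -[p q] l IH s /= /and3P[sp pq /IH qt].
exact: le_trans (le_trans sp pq) qt.
Qed.

Lemma chain_cat s l t l' u : chain s l t -> chain t l' u -> chain s (l ++ l') u.
Proof.
elim: l s => [|[p q] l IH] s /=.
  case: l' => [|[p q] l'] /=; first exact: le_trans.
  by move=> st /and3P[tp -> ->]; rewrite (le_trans st tp).
by move=> /and3P[-> -> /IH H] /H.
Qed.

Lemma chain_bounds s l t p : chain s l t -> p \in l -> [/\ s <= p.1, p.1 <= p.2 & p.2 <= t].
Proof.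
elim: l s => // -[x y] l IH s /= /and3P[sx xy yl].
rewrite inE => /predU1P[->/=|pl]; first by split=> //; exact: chain_le yl.
by have [yp ? ?] := IH _ yl pl; split=> //; rewrite (le_trans sx)// (le_trans xy).
Qed.

Lemma chain_pairwise s l t : chain s l t -> pairwise (fun p q : R * R => p.2 <= q.1) l.
Proof.
elim: l s => //= -[x y] l IH s /= /and3P[sx xy yl]; rewrite (IH _ yl) andbT.
by apply/allP => q /(chain_bounds yl)[].
Qed.

Lemma chain_length (U : set R) s l t : open U -> chain s l t ->
  (forall p, p \in l -> forall x : R, p.1 < x <= p.2 -> U x) ->
  \sum_(p <- l) (p.2 - p.1) <= open_length U s t.
Proof.
move=> oU; elim: l s => [|[x y] l IH] s /=.
  by move=> st _; rewrite big_nil open_length_ge0.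
move=> /and3P[sx xy yl] lU; rewrite big_cons /=.
have yt := chain_le yl.
rewrite (open_length_add oU (le_trans sx xy) yt) (open_length_add oU sx xy).
rewrite lerD//; last by apply: IH => // p pl; apply: lU; rewrite inE pl orbT.
rewrite (open_length_sub xy) ?lerDr ?open_length_ge0// => z zxy.
by apply: (lU (x, y)) => //; rewrite inE eqxx.
Qed.

Lemma abs_continuousS (F : R -> V) a b a' b' : a <= a' -> b' <= b ->
  abs_continuous a b F -> abs_continuous a' b' F.
Proof.
move=> aa bb H e /H[d d0 Hd]; exists d => // m s t st tr; apply: Hd => // i.
by have [/andP[h1 ->] h2] := st i; rewrite (le_trans aa h1) (le_trans h2).
Qed.

(** The induction is that of [mvt_bad], but no Lipschitz constant is at hand to charge the steps
    near [B]. They are collected in a chain instead, whose total length is at most the measure of an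
    open set around [B]; absolute continuity then makes the sum of the increments small. *)
Lemma ac_mvt (F : R -> V) a b k (B : set R) : a <= b -> 0 <= k ->
  abs_continuous a b F -> measurable B -> mu B = 0%E ->
  (forall t, a < t < b -> ~ B t -> exists2 v, hasd F t v & `|v| <= k) ->
  `|F b - F a| <= k * (b - a).
Proof.
move=> ab k0 acF mB B0 Fk; apply/ler_addgt0Pl => e0 e0_gt0.
pose e := e0 / (b - a + 1).
have D0 : 0 < b - a + 1 by rewrite ltr_wpDl// subr_ge0.
have e_gt0 : 0 < e by rewrite divr_gt0.
have [d d0 Hd] := acF _ e_gt0.
have mab : measurable [set a; b] by apply: measurableU; exact: measurable_set1.
have mB' : measurable (B `|` [set a; b]) by exact: measurableU.
have B'0 : (mu (B `|` [set a; b]) <= 0%:E)%E.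
  rewrite (le_trans (measureU2 _ _ _))// -[leRHS]adde0 leeD// le_eqVlt.
    by apply/orP; left; apply/eqP; exact: B0.
  apply/orP; left; apply/eqP.
  exact/countable_lebesgue_measure0/finite_set_countable/finite_set2.
(* Half of [d], since [outer_open] yields a weak inequality and absolute continuity asks for a total
   length strictly below [d]. *)
have d20 : 0 < d / 2 by rewrite divr_gt0.
have [U [oU BU Um]] := outer_open mB' B'0 d20.
have ke0 : 0 <= k + e by rewrite addr_ge0// ltW.
pose Q s t := exists l, [/\ chain s l t,
  (forall p, p \in l -> forall x : R, p.1 < x <= p.2 -> U x) &
  `|F t - F s| <= (k + e) * (t - s) + \sum_(p <- l) `|F p.2 - F p.1|].
have Qab : Q a b.
  apply: (@cousin _ Q) => // [s t u _ _ [l [sl lU lF]] [l' [sl' lU' lF']]|t /andP[at_ tb]].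
    exists (l ++ l'); split; first exact: chain_cat sl'.
      by move=> p; rewrite mem_cat => /orP[/lU|/lU'].
    rewrite big_cat/= -(subrK (F t) (F u)) -addrA (le_trans (ler_normD _ _))//.
    by rewrite (le_trans (lerD lF' lF))//; lra.
  have [Ut|nUt] := pselect (U t).
    have /nbhs_ballP[r /= r0 rU] := open_nbhs_nbhs (conj oU Ut).
    have one s u : s <= u -> (forall x, s < x <= u -> U x) -> Q s u.
      move=> su sU; exists [:: (s, u)]; rewrite big_seq1 /= su !lexx; split=> //.
        by move=> p; rewrite inE => /eqP ->.
      by rewrite lerDr mulr_ge0// subr_ge0.
    exists (r / 2); first by rewrite divr_gt0.
    split=> [s as_ /andP[ts st]|u ub /andP[tu ud]]; apply: one => // x /andP[x1 x2].
      by apply: rU; rewrite /ball/= ger0_norm ?subr_ge0//; lra.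
    by apply: rU; rewrite /ball/= distrC ger0_norm ?subr_ge0 ?ltW//; lra.
  have nB : ~ (B `|` [set a; b]) t by move=> /BU.
  have tab : a < t < b.
    rewrite !lt_neqAle at_ tb !andbT; apply/andP; split; apply/eqP => tE; apply: nB.
      by right; left.
    by right; right.
  have [|v Fv vk] := Fk _ tab; first by move=> Bt; apply: nB; left.
  have [r r0 Hr] := Fv _ e_gt0; exists r => //.
  have est s : `|s - t| <= r -> `|F s - F t| <= (k + e) * `|s - t|.
    move=> sd; rewrite -[F s - F t](subrK ((s - t) *: v)) mulrDl addrC.
    rewrite (le_trans (ler_normD _ _))// lerD//; last exact: Hr.
    by rewrite normrZ mulrC ler_wpM2r.
  split=> [s as_ /andP[ts st]|u ub /andP[tu ud]]; exists [::]; rewrite big_nil addr0 /=;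
    split=> //.
    by rewrite distrC (le_trans (est s _))// distrC ger0_norm ?subr_ge0//; lra.
  by rewrite (le_trans (est u _))// ger0_norm ?subr_ge0//; lra.
have [l [al lU lF]] := Qab.
have suml (G : R * R -> R) : \sum_(p <- l) G p = \sum_(i < size l) G (nth (0, 0) l i).
  by rewrite (big_nth (0, 0)) big_mkord.
have : \sum_(p <- l) `|F p.2 - F p.1| < e.
  rewrite suml; apply: Hd.
  - move=> i; have [|h1 h2 h3] := @chain_bounds _ _ _ (nth (0, 0) l i) al.
      exact: mem_nth.
    by rewrite h1 h2.
  - have pw i j : (i < j)%N -> (j < size l)%N -> (nth (0, 0) l i).2 <= (nth (0, 0) l j).1.
      move=> ij jl; have /(pairwiseP (0, 0)) := chain_pairwise al.
      by apply => //; rewrite inE (ltn_trans ij jl).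
    move=> i j _ _ [x [/=]]; rewrite !in_itv/= => /andP[i1 i2] /andP[j1 j2].
    apply/val_inj => /=; case: (ltngtP i j) => // [ij|ji].
      by have := lt_trans (lt_le_trans i2 (pw _ _ ij (ltn_ord j))) j1; rewrite ltxx.
    by have := lt_trans (lt_le_trans j2 (pw _ _ ji (ltn_ord i))) i1; rewrite ltxx.
  - rewrite -(suml (fun p => p.2 - p.1)).
    rewrite (le_lt_trans (chain_length oU al lU))//.
    rewrite (le_lt_trans (open_length_le oU a b Um))//; lra.
have : e * (b - a + 1) = e0 by rewrite /e divfK ?gt_eqF.
by move: lF => ? ? ?; nra.
Qed.

Lemma ac_lip (F : R -> V) a b k (B : set R) : 0 <= k ->
  abs_continuous a b F -> measurable B -> mu B = 0%E ->
  (forall t, a < t < b -> ~ B t -> exists2 v, hasd F t v & `|v| <= k) ->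
  forall s t, a <= s <= b -> a <= t <= b -> `|F s - F t| <= k * `|s - t|.
Proof.
move=> k0 acF mB B0 Fk.
have le_case s t : a <= s -> s <= t -> t <= b -> `|F t - F s| <= k * (t - s).
  move=> as_ st tb; apply: ac_mvt (abs_continuousS as_ tb acF) mB B0 _ => // x /andP[x1 x2].
  by apply: Fk; rewrite (le_lt_trans as_ x1) (lt_le_trans x2 tb).
move=> s t /andP[as_ sb] /andP[at_ tb]; case: (leP s t) => [st|/ltW ts].
  rewrite distrC [in leRHS]distrC (ger0_norm (x := t - s)) ?subr_ge0//; exact: le_case.
rewrite (ger0_norm (x := s - t)) ?subr_ge0//; exact: le_case.
Qed.

Lemma lip_ac (F : R -> V) a b k : 0 <= k ->
  (forall s t, a <= s <= b -> a <= t <= b -> `|F s - F t| <= k * `|s - t|) ->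
  abs_continuous a b F.
Proof.
move=> k0 Fk e e0; exists (e / (k + 1)); first by rewrite divr_gt0// ltr_wpDl.
move=> m s t st _ sd.
rewrite (@le_lt_trans _ _ (k * \sum_(i < m) (t i - s i)))//.
  rewrite mulr_sumr ler_sum// => i _; have [/andP[as_ st_] tb] := st i.
  rewrite (le_trans (Fk _ _ _ _)) ?as_ ?tb ?(le_trans as_ st_) ?(le_trans st_ tb)//.
  by rewrite ger0_norm// subr_ge0.
have S0 : 0 <= \sum_(i < m) (t i - s i).
  by apply: sumr_ge0 => i _; have [/andP[_ ?] _] := st i; rewrite subr_ge0.
have : e / (k + 1) * (k + 1) = e by rewrite divfK// gt_eqF// ltr_wpDl.
by move: (e / _) sd => z zd zE; nra.
Qed.

End absolute_continuity.

(** * A Gronwall inequality with an exceptional set *)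

Section gronwall.
Context {R : realType} {V : normedModType R}.
Local Notation mu := (@lebesgue_measure R).

Lemma mvt_bad_lip (F : R -> V) a b k M m (B : set R) : 0 <= M -> 0 <= k ->
  (forall s t, a <= s <= b -> a <= t <= b -> `|F s - F t| <= M * `|s - t|) ->
  measurable B -> (mu B <= m%:E)%E ->
  (forall t, a < t < b -> ~ B t -> exists2 v, hasd F t v & `|v| <= k) ->
  forall s t, a <= s -> s <= t -> t <= b -> `|F t - F s| <= k * (t - s) + M * m.
Proof.
move=> M0 k0 FM mB Bm Fk s t as_ st tb.
rewrite -[k in leRHS](max_idPl k0).
apply: mvt_bad mB Bm _ => // [x y /andP[h1 h2] /andP[h3 h4]|x /andP[x1 x2]].
  by apply: FM; lra.
by apply: Fk; lra.
Qed.

(* On a step of length [p] with [K * p <= 1 / 2] the supremum of [w] is absorbed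
   into the left-hand side. *)
Lemma gronwall (K a : R) : 0 <= K -> 0 < a -> exists2 C, 1 <= C &
  forall (r : R) (w : R -> V) (A e M m : R) (B : set R),
  0 <= r -> 0 <= A -> 0 <= e -> 0 <= M -> 0 <= m ->
  (forall s t, - r <= s <= a -> - r <= t <= a -> `|w s - w t| <= M * `|s - t|) ->
  (forall t, - r <= t <= 0 -> `|w t| <= A) ->
  measurable B -> (mu B <= m%:E)%E ->
  (forall t, 0 < t < a -> ~ B t -> exists2 v, hasd w t v &
     forall S, (forall s, - r <= s <= t -> `|w s| <= S) -> `|v| <= K * S + e) ->
  forall t, - r <= t <= a -> `|w t| <= C * (A + e + M * m).
Proof.
move=> K0 a0; have D0 : 0 < 2 * K + 1 by rewrite ltr_wpDl// mulr_ge0.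
(* This choice gives both [K * p <= 1 / 2] and [p <= 1]. *)
have [p p0 pE] : exists2 p, 0 < p & p * (2 * K + 1) = 1.
  by exists (2 * K + 1)^-1; rewrite ?invr_gt0// mulVf// gt_eqF.
pose N := Num.bound (a / p).
(* [N] steps of length [p] cover [0, a]. On each of them S <= 4^n X + X + S / 2, whence S <= 2 (4^n
   X + X) <= 4^(n+1) X. The constant depends on [K] and [a] alone, so it serves all directions and
   all exceptional sets at once. *)
exists (4 ^+ N); first by rewrite exprn_ege1// ler1n.
move=> r w A e M m B r0 A0 e0 M0 m0 wM wA mB Bm wd.
pose X := A + e + M * m.
have X0 : 0 <= X by rewrite !addr_ge0// mulr_ge0.
have step n t : - r <= t <= a -> t <= n%:R * p -> `|w t| <= 4 ^+ n * X.
  elim: n t => [|n IH] t /andP[rt ta].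
    rewrite mul0r expr0 mul1r => t0; rewrite (le_trans (wA t _)) ?rt//.
    by rewrite /X -addrA lerDl addr_ge0// mulr_ge0.
  move=> tn; pose c := Num.min (n.+1%:R * p) a.
  have ca : c <= a by rewrite ge_min lexx orbT.
  have cn : c <= n.+1%:R * p by rewrite ge_min lexx.
  have tc : t <= c by rewrite le_min tn.
  have rc : - r <= c by exact: le_trans rt tc.
  pose E := [set `|w s| | s in [set s | - r <= s <= c]].
  (* The Lipschitz bound makes the supremum finite; otherwise S / 2 could not be absorbed. *)
  have hE : has_sup E.
    split; first by exists `|w c|, c => //=; rewrite rc lexx.
    exists (A + M * (a + r)) => _ [s /= /andP[rs sc] <-].
    rewrite -[w s](subrK (w 0)) addrC (le_trans (ler_normD _ _))// lerD//.
      by apply: wA; rewrite oppr_le0 r0 lexx.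
    rewrite (le_trans (wM _ _ _ _)) ?rs ?(le_trans sc ca) ?oppr_le0 ?r0 ?(ltW a0)//.
    by rewrite subr0 ler_wpM2l// ler_norml; lra.
  pose S := sup E.
  have wS s : - r <= s <= c -> `|w s| <= S.
    by move=> rs; apply: sup_upper_bound => //; exists s.
  have S0 : 0 <= S by rewrite (le_trans _ (wS c _)) ?rc ?lexx.
  have key s : - r <= s <= c -> `|w s| <= 4 ^+ n * X + X + S / 2.
    move=> /andP[rs sc]; case: (leP s (n%:R * p)) => [sn|ns].
      rewrite (le_trans (IH s _ sn)) ?rs ?(le_trans sc ca)//.
      by rewrite -addrA lerDl addr_ge0// divr_ge0.
    have n0 : 0 <= n%:R * p by rewrite mulr_ge0// ltW.
    have rn : - r <= n%:R * p by rewrite (le_trans _ n0)// oppr_le0.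
    have wn := IH (n%:R * p); rewrite rn (le_trans (ltW ns) (le_trans sc ca)) lexx in wn.
    have {}wn := wn erefl erefl.
    have sp : s - n%:R * p <= p.
      by have := le_trans sc cn; rewrite -natr1 mulrDl mul1r; lra.
    have : `|w s - w (n%:R * p)| <= (K * S + e) * (s - n%:R * p) + M * m.
      apply: (mvt_bad_lip (a := 0) (b := c) M0 _ _ mB Bm _) => //.
      - by rewrite addr_ge0// mulr_ge0.
      - move=> x y /andP[h1 h2] /andP[h3 h4]; apply: wM; lra.
      - move=> x /andP[x1 x2] nBx; have [|v wv vS] := wd x _ nBx; first by lra.
        by exists v => //; apply: vS => y /andP[y1 y2]; apply: wS; lra.
      - exact: ltW.
    move=> h; rewrite -[w s](subrK (w (n%:R * p))).
    rewrite (le_trans (ler_normD _ _))//.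
    have h1 : (K * S + e) * (s - n%:R * p) <= S / 2 + e.
      have q0 : 0 <= s - n%:R * p by rewrite subr_ge0 ltW.
      move: (s - _) q0 sp => q q0 qp.
      have Kp0 : 0 <= K * p by rewrite mulr_ge0// ltW.
      have Kp : 2 * (K * p) + p = 1 by move: pE; lra.
      have : K * q <= 2^-1 by have := ler_wpM2l K0 qp; lra.
      have : q <= 1 by lra.
      have h1 : K * q <= 2^-1 by have := ler_wpM2l K0 qp; lra.
      have h2 : q <= 1 by lra.
      have -> : (K * S + e) * q = S * (K * q) + e * q by ring.
      by have := ler_wpM2l S0 h1; have := ler_wpM2l e0 h2; rewrite mulr1; lra.
    have : e + M * m <= X by rewrite /X -addrA lerDr.
    by move: wn h h1; move: (4 ^+ n * X) => Y; lra.
  have : S <= 4 ^+ n * X + X + S / 2.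
    by apply: sup_le_ub => [|_ [s /= rs <-]]; [case: hE|exact: key].
  have : X <= 4 ^+ n * X by rewrite ler_peMl// exprn_ege1// ler1n.
  have := wS t; rewrite rt tc => /(_ erefl).
  rewrite exprS -mulrA; lra.
move=> t /andP[rt ta]; apply: step; rewrite ?rt//.
rewrite (le_trans ta)// -ler_pdivrMr//; apply: ltW.
by apply: archi_boundP; rewrite divr_ge0// ltW.
Qed.

End gronwall.


(** * Lipschitz functions of a real variable *)

Section egorov.
Context {R : realType} {V : normedModType R}.
Local Notation mu := (@lebesgue_measure R).

Lemma ae_null (P : R -> Prop) : {ae mu, forall t, P t} <->
  exists Z : set R, [/\ measurable Z, mu Z = 0%E & forall t, ~ Z t -> P t].
Proof.
split=> [[Z [mZ Z0 PZ]]|[Z [mZ Z0 PZ]]]; exists Z; split=> // t.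
  by move=> nZ; apply: contrapT => nP; apply: nZ; exact: PZ.
by move=> nP; apply: contrapT => nZ; apply: nP; exact: PZ.
Qed.

Lemma lip_cont (W : normedModType R) (F : R -> W) N :
  (forall s t, `|F s - F t| <= N * `|s - t|) -> continuous F.
Proof.
move=> FN t; apply/cvgrPdist_le => e e0.
have N0 : 0 < Num.max N 0 + 1 by rewrite ltr_wpDl// le_max lexx orbT.
have dl : 0 < e / (Num.max N 0 + 1) by rewrite divr_gt0.
have := cvgr_dist_le (F := nbhs t) (FF := nbhs_filter t) id t cvg_id _ dl.
apply: filterS => s ts; rewrite (le_trans (FN _ _))//.
rewrite (@le_trans _ _ ((Num.max N 0 + 1) * `|t - s|))//.
  by rewrite ler_wpM2r// (le_trans (_ : N <= Num.max N 0)) ?le_max ?lexx// lerDl.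
by rewrite mulrC -ler_pdivlMr.
Qed.

(* [E] is made of the open sets where two difference quotients with steps at most
   [1 / k] differ by more than [e / 3]; they shrink to a null set as [k] grows. *)
Lemma lip_egorov (X : R -> V) N p q : 0 <= N -> p <= q ->
  (forall s t, `|X s - X t| <= N * `|s - t|) ->
  {ae mu, forall t, derivable X t 1} ->
  forall e eta, 0 < e -> 0 < eta -> exists E : set R, [/\ measurable E,
    (mu E <= eta%:E)%E & exists2 d, 0 < d &
    (forall s, p <= s <= q -> ~ E s -> derivable X s 1 /\
       forall s', `|s' - s| <= d ->
         `|X s' - X s - (s' - s) *: derive1 X s| <= e * `|s' - s|) /\
    (forall s s', p <= s <= q -> p <= s' <= q -> ~ E s -> ~ E s' -> `|s - s'| <= d ->
       `|derive1 X s - derive1 X s'| <= e)].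
Proof.
move=> N0 pq XN /ae_null[Z [mZ Z0 dX]] e eta e0 eta0.
have e30 : 0 < e / 3 by rewrite divr_gt0.
pose Q h s := h^-1 *: (X (s + h) - X s).
have QN h s s' : h != 0 -> `|Q h s - Q h s'| <= `|h|^-1 * (2 * N * `|s - s'|).
  move=> h0; rewrite /Q -scalerBr normrZ normfV ler_wpM2l ?invr_ge0//.
  have -> : X (s + h) - X s - (X (s' + h) - X s') = (X (s + h) - X (s' + h)) - (X s - X s').
    by lmod R.
  rewrite (le_trans (ler_normB _ _))// -mulrA [leRHS]mulr_natl mulr2n lerD//.
  by rewrite (le_trans (XN _ _))// opprD addrACA subrr addr0.
pose B k : set R := \bigcup_(h in [set h | h != 0 /\ `|h| <= k.+1%:R^-1])
  \bigcup_(h' in [set h | h != 0 /\ `|h| <= k.+1%:R^-1])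
    [set s | e / 3 < `|Q h s - Q h' s|].
(* [B k] is an uncountable union over pairs of steps; it is measurable because it is open, each
   difference quotient [Q h] being continuous. *)
have oB k : open (B k).
  apply: bigcup_open => h [h0 _]; apply: bigcup_open => h' [h'0 _].
  have QC g : g != 0 -> continuous (Q g).
    by move=> g0; apply: (@lip_cont _ _ (`|g|^-1 * (2 * N))) => s t; rewrite -mulrA QN.
  apply: (@open_comp _ _ (fun s => `|Q h s - Q h' s|) [set y | e / 3 < y]).
    move=> s _; apply: (@continuous_comp _ _ _ (fun s => Q h s - Q h' s)).
      by apply: continuousB; exact: QC.
    exact: norm_continuous.
  exact: open_gt.
(* The cut to [p, q] gives finite measure, which continuity of the measure from above requires. *)
pose F k := B k `&` `[p, q]%classic.
have mF k : measurable (F k) by apply: measurableI => //; exact: open_measurable.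
have Fdecr : nonincreasing_seq F.
  move=> k l kl; apply/subsetPset => s [Bs ps]; split=> //.
  have lk : (l.+1%:R^-1 : R) <= k.+1%:R^-1.
    by rewrite lef_pV2 ?posrE// ler_nat ltnS.
  case: Bs => h [h0 hl] [h' [h'0 h'l]] Qs.
  by exists h; [split=> //; exact: le_trans lk|exists h' => //; split=> //; exact: le_trans lk].
(* Where the derivative exists, all quotients with small steps lie within [e / 6] of it, hence
   within [e / 3] of each other. *)
have Fcap : \bigcap_k F k `<=` Z.
  move=> s Fs; apply: contrapT => /dX /derivable_hasd Xs.
  have e60 : 0 < e / 6 by rewrite divr_gt0.
  have [d d0 Hd] := Xs _ e60.
  have qd h : h != 0 -> `|h| <= d -> `|Q h s - derive1 X s| <= e / 6.
    move=> h0 hd; have := Hd (s + h); rewrite [s + h - s]addrAC subrr add0r => /(_ hd).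
    rewrite -[Q h s - _](scalerK h0) normrZ normfV scalerBr ?/Q ?scalerKV//.
    by rewrite ler_pdivrMl ?normr_gt0// mulrC.
  have [k kd] : exists k, (k.+1%:R^-1 : R) <= d.
    exists (Num.bound d^-1); rewrite -[leRHS]invrK lef_pV2 ?posrE ?invr_gt0//.
    have /archi_boundP /ltW /le_trans : 0 <= d^-1 by rewrite invr_ge0 ltW.
    by apply; rewrite ler_nat.
  have [[h [h0 hk] [h' [h'0 h'k]]] + _] := Fs k I.
  rewrite /= ltNge => /negP; apply.
  rewrite -(subrK (derive1 X s) (Q h s)) -addrA (le_trans (ler_normD _ _))//.
  have := qd _ h0 (le_trans hk kd); have := qd _ h'0 (le_trans h'k kd).
  by rewrite [`|Q h' s - _|]distrC; lra.
have F00 : (mu (F 0%N) < +oo)%E.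
  rewrite (@le_lt_trans _ _ (mu `[p, q]%classic))//; last first.
    by rewrite /= lebesgue_measure_itv/=; case: ifP => _; rewrite ltry.
  by apply: mu_le => //; exact: subIsetr.
have mcap : measurable (\bigcap_k F k) by exact: bigcap_measurable.
have cap0 : mu (\bigcap_k F k) = 0%E.
  apply/eqP; rewrite eq_le measure_ge0 andbT -Z0.
  by apply: le_measure; rewrite ?inE.
have : mu \o F @ \oo --> 0%E.
  by rewrite -cap0; exact: nonincreasing_cvg_mu F00 mF mcap Fdecr.
move=> /fine_cvgP[_ /cvgrPdist_le /(_ _ eta0)] [k _] /(_ k (leqnn _)) /=.
rewrite sub0r normrN ger0_norm ?fine_ge0// => Fk.
exists (F k `|` Z); split; first exact: measurableU.
  apply: mu_setU_null => //; rewrite -lee_fin fineK// in Fk.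
  rewrite ge0_fin_numE// (le_lt_trans _ F00)//.
  by apply: mu_le => //; exact/subsetPset/Fdecr.
pose d0 : R := k.+1%:R^-1.
have d00 : 0 < d0 by rewrite invr_gt0.
(* Off [F k] the quotient at [h] is within [e / 3] of the quotient at every small [h']; letting [h']
   tend to 0 compares it with the derivative. *)
have QX s h : p <= s <= q -> ~ (F k `|` Z) s -> h != 0 -> `|h| <= d0 ->
    `|Q h s - derive1 X s| <= e / 3.
  move=> spq nE h0 hd; have nZ : ~ Z s by move=> Zs; apply: nE; right.
  apply/ler_addgt0Pl => e' e'0.
  have [d' d'0 Hd] := (derivable_hasd _ _).1 (dX _ nZ) _ e'0.
  pose h' := Num.min d' d0.
  have h'0 : 0 < h' by rewrite lt_min d'0.
  have h'd : `|h'| <= d' by rewrite gtr0_norm// ge_min lexx.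
  have h'k : `|h'| <= d0 by rewrite gtr0_norm// ge_min lexx orbT.
  rewrite -(subrK (Q h' s) (Q h s)) -addrA addrC (le_trans (ler_normD _ _))// lerD//.
    have := Hd (s + h'); rewrite [s + h' - s]addrAC subrr add0r => /(_ h'd).
    have h'n : h' != 0 by rewrite gt_eqF.
    rewrite -[Q h' s - _](scalerK h'n) normrZ normfV scalerBr ?/Q ?scalerKV//.
    by rewrite ler_pdivrMl ?normr_gt0// mulrC.
  rewrite leNgt; apply/negP => lt; apply: nE; left; split.
    by exists h => //; exists h' => //; split=> //; rewrite gt_eqF.
  by rewrite /= in_itv.
(* [Q d0] has Lipschitz constant at most 2 N / d0, so the second bound keeps its variation below
   [e / 3]. The other two thirds of [e] replace the derivatives at [s] and [s'] by [Q d0]. *)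
pose d := Num.min d0 (e / 3 * d0 / (2 * N + 1)).
have D0 : 0 < 2 * N + 1 by rewrite ltr_wpDl// mulr_ge0.
have dd0 : 0 < d by rewrite lt_min d00 !divr_gt0// mulr_gt0.
exists d => //; split=> [s spq nE|s s' spq spq' nE nE' ss].
  split; first by apply: dX => Zs; apply: nE; right.
  move=> s' sd; have [->|ss] := eqVneq s' s.
    by rewrite !subrr scale0r subrr !normr0 mulr0.
  have h0 : s' - s != 0 by rewrite subr_eq0.
  have := QX _ _ spq nE h0 (le_trans sd _); rewrite /d ge_min lexx => /(_ isT) h.
  rewrite (_ : _ - _ = (s' - s) *: (Q (s' - s) s - derive1 X s)); last first.
    by rewrite scalerBr /Q scalerKV// [s + (s' - s)]addrC subrK.
  rewrite normrZ mulrC ler_wpM2r// (le_trans h)//; lra.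
have d0n : d0 != 0 by rewrite gt_eqF.
have nd0 : `|d0| <= d0 by rewrite gtr0_norm.
have h1 := QX _ _ spq nE d0n nd0.
have h2 := QX _ _ spq' nE' d0n nd0.
have h3 : `|Q d0 s - Q d0 s'| <= e / 3.
  rewrite (le_trans (QN _ _ _ d0n))// gtr0_norm// ler_pdivrMl//.
  have : `|s - s'| <= e / 3 * d0 / (2 * N + 1) by rewrite (le_trans ss)// /d ge_min lexx orbT.
  rewrite ler_pdivlMr// mulrC [d0 * _]mulrC; have := normr_ge0 (s - s'); nra.
rewrite (_ : _ - _ = - (Q d0 s - derive1 X s) + ((Q d0 s - Q d0 s') + (Q d0 s' - derive1 X s'))); last first.
  by lmod R.
rewrite (le_trans (ler_normD _ _))// normrN.
have := ler_normD (Q d0 s - Q d0 s') (Q d0 s' - derive1 X s').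
lra.
Qed.

Lemma density_point (T : set R) : measurable T -> {ae mu, forall t : R, ~ T t ->
  forall e, 0 < e -> exists2 d, 0 < d & forall r, 0 < r -> r < d ->
    (mu (T `&` ball t r) <= (e * r)%:E)%E}.
Proof.
move=> mT; have := lebesgue_density mT.
apply: (@filterS _ _ (ae_filter_ringOfSetsType mu)) => t + nTt e e0.
rewrite indicE memNset//= => /fine_cvgP[_ /cvgrPdist_le].
(* The ball of radius [r] has length 2 r: density at most [e / 2] means measure at most [e * r]. *)
have e20 : 0 < e / 2 by rewrite divr_gt0.
move=> /(_ _ e20) [d /= d0 Hd]; exists d => // r r0 rd.
have bE := lebesgue_measure_ball t (ltW r0).
have {Hd} : `|0 - fine (mu (T `&` ball t r) * (mu (ball t r))^-1)| <= e / 2.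
  by apply: Hd => //; rewrite /= sub0r normrN gtr0_norm.
rewrite bE sub0r normrN.
have Tfin : mu (T `&` ball t r) \is a fin_num.
  rewrite ge0_fin_numE// (@le_lt_trans _ _ (mu (ball t r)))//; last by rewrite bE ltry.
  by apply: mu_le; [apply: measurableI => //| |exact: subIsetr]; exact: measurable_ball.
rewrite -(fineK Tfin) inver mulrn_eq0 (gt_eqF r0)/= ger0_norm.
  rewrite lee_fin ler_pdivrMr ?pmulrn_lgt0// -mulr_natr; lra.
by rewrite mulr_ge0 ?fine_ge0// invr_ge0 mulrn_wge0// ltW.
Qed.

Lemma natV_small (e : R) : 0 < e -> exists n0, forall k, (n0 <= k)%N -> k.+1%:R^-1 <= e.
Proof.
move=> e0; exists (Num.bound e^-1) => k nk.
have /archi_boundP eb : 0 <= e^-1 by rewrite invr_ge0 ltW.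
rewrite -[leRHS]invrK lef_pV2 ?posrE ?invr_gt0//.
by rewrite (le_trans (ltW eb))// ler_nat (leq_trans nk).
Qed.

(** The failures of [Q] lie in the intersection of exceptional sets of measure at most 1 / (k + 1).
    Estimates valid off small sets are thus converted into almost everywhere statements. *)
Lemma ae_small (Q : R -> Prop) :
  (forall e, 0 < e -> exists B : set R, [/\ measurable B, (mu B <= e%:E)%E &
     forall t, ~ B t -> Q t]) -> {ae mu, forall t, Q t}.
Proof.
move=> H; have /choice[B HB] : forall k : nat, exists B : set R,
    [/\ measurable B, (mu B <= (k.+1%:R^-1)%:E)%E & forall t, ~ B t -> Q t].
  by move=> k; apply: H; rewrite invr_gt0.
exists (\bigcap_k B k); split.
- by apply: bigcap_measurable => // k _; have [] := HB k.
- apply/eqP; rewrite eq_le measure_ge0 andbT; apply/lee_addgt0Pr => e e0.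
  have /archi_boundP eb : 0 <= e^-1 by rewrite invr_ge0 ltW.
  set k := Num.bound e^-1 in eb; rewrite add0e.
  have [mB Bk _] := HB k.
  rewrite (@le_trans _ _ (mu (B k)))//.
    apply: mu_le => //; last exact: bigcap_inf.
    by apply: bigcap_measurable => // j _; have [] := HB j.
  rewrite (le_trans Bk)// lee_fin -[leRHS]invrK lef_pV2 ?posrE ?invr_gt0//.
  by rewrite (le_trans (ltW eb))// ler_nat.
- by move=> t nQ k _; apply: contrapT => nB; apply: nQ; have [_ _] := HB k; apply.
Qed.

End egorov.

(** * Almost everywhere differentiability on an interval *)

Section lipschitz_intervals.
Context {R : realType}.
Local Notation mu := (@lebesgue_measure R).

(** Composition with this projection extends a function that is Lipschitz on [a, b] to one that is
    Lipschitz on the line, with the same constant and the same derivatives inside. *)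
Definition itv_proj (a b t : R) : R := Num.max a (Num.min t b).

Lemma itv_proj_in a b t : a <= b -> a <= itv_proj a b t <= b.
Proof. by move=> ab; rewrite /itv_proj maxEle minEle; do ! case: ifPn; lra. Qed.

Lemma itv_proj_id a b t : a <= t <= b -> itv_proj a b t = t.
Proof. by move=> /andP[? ?]; rewrite /itv_proj min_l// max_r. Qed.

Lemma itv_proj_lip a b s t : a <= b -> `|itv_proj a b s - itv_proj a b t| <= `|s - t|.
Proof.
move=> ab; rewrite /itv_proj.
have sub_le := ler_norm (s - t); have sub_ge := lerNnormlW (lexx `|s - t|).
move: `|s - t| sub_le sub_ge => d sub_le sub_ge.
rewrite ler_norml; apply/andP; rewrite !maxEle !minEle.
by split; do ! case: ifPn => [|/negbTE/negbT]; rewrite -?ltNge; lra.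
Qed.

Lemma lip_itv_proj (V : normedModType R) (F : R -> V) a b k : a <= b -> 0 <= k ->
  (forall s t, a <= s <= b -> a <= t <= b -> `|F s - F t| <= k * `|s - t|) ->
  forall s t, `|F (itv_proj a b s) - F (itv_proj a b t)| <= k * `|s - t|.
Proof.
move=> ab k0 Fk s t; rewrite (le_trans (Fk _ _ _ _)) ?itv_proj_in//.
by rewrite ler_wpM2l// itv_proj_lip.
Qed.

Lemma hasd_itv_proj (V : normedModType R) (F : R -> V) a b t v : a < t < b ->
  hasd (F \o itv_proj a b) t v <-> hasd F t v.
Proof.
move=> /andP[at_ tb]; pose d := Num.min (t - a) (b - t).
have d0 : 0 < d by rewrite lt_min !subr_gt0 at_.
have E s : `|s - t| <= d -> itv_proj a b s = s.
  by rewrite le_min !ler_norml => /andP[/andP[? ?] /andP[? ?]]; apply: itv_proj_id; lra.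
by split; apply: hasd_local d0 _ => s /E /= ->.
Qed.

Lemma lip_itv_hasd_real (F : R -> R) a b k : a <= b -> 0 <= k ->
  (forall s t, a <= s <= b -> a <= t <= b -> `|F s - F t| <= k * `|s - t|) ->
  exists Z : set R, [/\ measurable Z, mu Z = 0%E &
    forall t, a < t < b -> ~ Z t -> hasd F t (derive1 F t)].
Proof.
move=> ab k0 Fk.
have /ae_null[Z [mZ Z0 dF]] := lipschitz_ae_derivable (lip_itv_proj ab k0 Fk).
exists Z; split=> // t tab /dF /derivable_hasd /(hasd_itv_proj _ _ tab) H.
by rewrite (hasd_derive1 H).
Qed.

Context {n : nat} (nu : vnorm R n).

Lemma lip_ae_derivable_rvec (F : R -> rvec nu) k : 0 <= k ->
  (forall s t, `|F s - F t| <= k * `|s - t|) ->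
  {ae mu, forall t, derivable F t 1}.
Proof.
move=> k0 Fk; have [K K0 Klb] := vnorm_lower nu.
have Fi (i : 'I_n) s t : `|(F s : 'rV[R]_n) 0 i - (F t : 'rV[R]_n) 0 i| <= (K * k) * `|s - t|.
  rewrite -mulrA (@le_trans _ _ `|(F s - F t : 'rV[R]_n)|)//.
    rewrite [leRHS]mx_normrE.
    have := le_bigmax 0 (fun ij => `|(F s - F t : 'rV[R]_n) ij.1 ij.2|) (0, i).
    by rewrite /= !mxE.
  by rewrite (le_trans (Klb _))// ler_pM2l//; exact: Fk.
have /ae_foralln : forall i : nat, {ae mu, forall t : R, forall ltn : (i < n)%N,
    derivable (fun s => (F s : 'rV[R]_n) 0 (Ordinal ltn)) t 1}.
  move=> i; case: (pselect (i < n)%N) => [ltn|nin]; last first.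
    by apply/ae_null; exists set0; split => // t _ ltn; exfalso; exact: nin.
  have /ae_null[Z [mZ Z0 dF]] := lipschitz_ae_derivable (Fi (Ordinal ltn)).
  apply/ae_null; exists Z; split=> // t /dF + ltn'.
  by rewrite (bool_irrelevance ltn' ltn).
move=> /ae_null[Z [mZ Z0 dF]]; apply/ae_null; exists Z; split=> // t /dF H.
by apply: rvec_derivable => -[i ltn]; exact: H.
Qed.

Lemma lip_itv_hasd (F : R -> rvec nu) a b k : a <= b -> 0 <= k ->
  (forall s t, a <= s <= b -> a <= t <= b -> `|F s - F t| <= k * `|s - t|) ->
  exists Z : set R, [/\ measurable Z, mu Z = 0%E &
    forall t, a < t < b -> ~ Z t -> hasd F t (derive1 F t)].
Proof.
move=> ab k0 Fk.
have /ae_null[Z [mZ Z0 dF]] := lip_ae_derivable_rvec k0 (lip_itv_proj ab k0 Fk).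
exists Z; split=> // t tab /dF /derivable_hasd /(hasd_itv_proj _ _ tab) H.
by rewrite (hasd_derive1 H).
Qed.

End lipschitz_intervals.

(** * Measure of preimages under expanding and piecewise monotone functions *)

Section piecewise_monotone.
Context {R : realType}.
Local Notation mu := (@lebesgue_measure R).

(** A map that expands distances by [c] sends a set of diameter more than l / c to a set of diameter
    more than l. So the part of [A] that [v] sends into an interval of length l fits in an interval
    of length l / c, and a cover of [E] pulls back to a cover of [A]. *)
Lemma expand_measure (v : R -> R) a b c (E A : set R) (m : R) : 0 < c ->
  (forall s t, a <= s <= b -> a <= t <= b -> c * `|s - t| <= `|v s - v t|) ->
  measurable A -> (forall t, A t -> a <= t <= b /\ E (v t)) ->
  (mu E <= m%:E)%E -> (mu A <= (c^-1 * m)%:E)%E.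
Proof.
move=> c0 vc mA AE Em; have ci0 : 0 <= c^-1 by rewrite invr_ge0 ltW.
apply/lee_addgt0Pr => e e0.
have : (mu E < (m + c * e)%:E)%E.
  by rewrite (le_lt_trans Em)// lte_fin ltrDl mulr_gt0.
(* The Lebesgue measure unfolds to an infimum over countable covers by half-open intervals; this
   picks a nearly optimal one. The excess [c * e] becomes [e] after division by [c]. *)
move=> /ereal_inf_lt[z [/= M [mM EM] sMz] zm].
(* The interval starts at the infimum of the part of [A] sent into [M k]; an empty part needs a
   separate case, its infimum being meaningless. *)
pose I k : set R := if pselect ((A `&` v @^-1` M k) !=set0) is left H then
  `[inf (A `&` v @^-1` M k), inf (A `&` v @^-1` M k) + c^-1 * fine (mu (M k))]%classic
  else set0.
have Mfin k : exists l, [/\ 0 <= l, mu (M k) = l%:E, wlength idfun (M k) = l%:E &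
    forall x y, M k x -> M k y -> `|x - y| <= l].
  have /ocitvP[->|[[p q] /= pq ->]] := mM k.
    by exists 0; split=> //; rewrite ?measure0 ?wlength0.
  exists (q - p); rewrite wlength_itv_bnd/= ?(ltW pq)// mu_oc_itv ?(ltW pq)// subr_ge0.
  split=> //; first exact: ltW.
  by move=> x y /=; rewrite !in_itv/= ler_norml => /andP[? ?] /andP[? ?]; lra.
have mI k : measurable (I k).
  by rewrite /I; case: pselect => // _; exact: measurable_itv.
have AI : A `<=` \bigcup_k I k.
  move=> t At; have [tab Evt] := AE _ At; have [k _ Mk] := EM _ Evt.
  exists k => //; rewrite /I; have ne : (A `&` v @^-1` M k) !=set0 by exists t.
  case: pselect => // {}ne.
  have [l [l0 ml _ Ml]] := Mfin k; rewrite ml /=.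
  have lbt s : (A `&` v @^-1` M k) s -> t - c^-1 * l <= s.
    move=> [As Ms]; have [sab _] := AE _ As.
    have := vc _ _ tab sab; have := Ml _ _ Mk Ms => h1 /le_trans /(_ h1).
    rewrite -ler_pdivlMl// => h2; have := le_trans (ler_norm _) h2; lra.
  rewrite in_itv/=; apply/andP; split.
    apply: ge_inf => //; exists (t - c^-1 * l) => s; exact: lbt.
  rewrite -lerBlDr; apply: lb_le_inf => //.
rewrite (@le_trans _ _ (\sum_(k <oo) mu (I k))%E)//.
  exact: measure_sigma_subadditive.
rewrite (@le_trans _ _ (\sum_(k <oo) (c^-1%:E * wlength idfun (M k))))%E//.
  apply: lee_nneseries => [//|k _]; have [l [l0 ml wl _]] := Mfin k.
  rewrite wl /I; case: pselect => [ne|_]; last by rewrite measure0 mule_ge0// lee_fin.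
  rewrite ml/= lebesgue_measure_itv/= lte_fin; case: ifP => _.
    by rewrite -EFinD addrAC subrr add0r EFinM.
  by rewrite mule_ge0// lee_fin.
rewrite nneseriesZl; last first.
  by move=> k _; have [l [l0 _ -> _]] := Mfin k; rewrite lee_fin.
rewrite sMz (@le_trans _ _ (c^-1%:E * (m + c * e)%:E))%E//.
  by rewrite lee_wpmul2l ?lee_fin// ltW.
by rewrite -EFinM -EFinD lee_fin mulrDr mulrA mulVf ?gt_eqF// mul1r.
Qed.

(** The mean value inequality bounds norms only, so a one-sided bound is obtained by centring: w'
    lies in [c, K + c], at distance at most [h = K / 2] from the midpoint [m]. Applied to w(x) - m
    x, it yields the slope [m - h = c]. *)
Lemma expand_of_derive (w : R -> R) a b c K (Z : set R) : 0 < c -> 0 <= K ->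
  (forall s t, a <= s <= b -> a <= t <= b -> `|w s - w t| <= K * `|s - t|) ->
  measurable Z -> mu Z = 0%E ->
  (forall t, a < t < b -> ~ Z t -> exists2 d, hasd w t d & c <= d) ->
  forall s t, a <= s -> s <= t -> t <= b -> c * (t - s) <= w t - w s.
Proof.
move=> c0 K0 wK mZ Z0 wc s t as_ st tb.
pose m := (K + 2 * c) / 2; pose h := K / 2.
have h0 : 0 <= h by rewrite divr_ge0.
have Z0' : (mu Z <= 0%:E)%E by move: Z0 => /= ->.
pose G x := w x - x *: m.
have Gl x y : a <= x <= b -> a <= y <= b -> `|G x - G y| <= (K + m) * `|x - y|.
  move=> xab yab; rewrite (_ : G x - G y = (w x - w y) - (x - y) * m); last first.
    by rewrite /G /GRing.scale/=; ring.
  rewrite (le_trans (ler_normB _ _))// [leRHS]mulrDl lerD ?wK// normrM mulrC ler_wpM2r//.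
  by rewrite ger0_norm// divr_ge0// addr_ge0// mulr_ge0// ltW.
have m0 : 0 <= m by rewrite divr_ge0// addr_ge0// mulr_ge0// ltW.
have Km : 0 <= K + m by rewrite addr_ge0.
have := mvt_bad_lip Km h0 Gl mZ Z0' _ as_ st tb; rewrite mulr0 addr0 => /(_ _) H.
have {H} : `|G t - G s| <= h * (t - s).
  apply: H => x xab nZ; have [d wd cd] := wc _ xab nZ.
  exists (d - m); first exact: hasdB wd (hasd_lin _ _).
  have dK : `|d| <= K + c.
    rewrite (@le_trans _ _ K) ?lerDl ?(ltW c0)//.
    move: xab => /andP[ax xb].
    have q0 : 0 < Num.min (x - a) (b - x) by rewrite lt_min !subr_gt0 ax.
    apply: hasd_le q0 _ wd => y yq; apply: wK; last lra.
    by move: yq; rewrite le_min !ler_norml => /andP[/andP[? ?] /andP[? ?]]; lra.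
  by move: dK; rewrite /m /h !ler_norml; lra.
rewrite ler_norml /G /h /m /GRing.scale/= => /andP[+ _].
by move=> ?; lra.
Qed.

Lemma mu_itv_ae (a b : R) (P : R -> Prop) : {ae mu_itv a b, forall t, P t} ->
  exists Z : set R, [/\ measurable Z, mu Z = 0%E & forall t, a <= t <= b -> ~ Z t -> P t].
Proof.
move=> [Z [mZ Z0 PZ]]; exists (Z `&` `[a, b]%classic); split.
- exact: measurableI.
- exact: Z0.
- move=> t tab nZ; apply: contrapT => nP; apply: nZ; split; first exact: PZ.
  by rewrite /= in_itv.
Qed.

Lemma ess_inf_expand (u : R -> R) a b K : a <= b -> 0 <= K ->
  (forall s t, a <= s <= b -> a <= t <= b -> `|u s - u t| <= K * `|s - t|) ->
  (0 < ess_inf (mu_itv a b) (EFin \o derive1 u))%E ->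
  exists2 c, 0 < c & forall s t, a <= s <= b -> a <= t <= b ->
    c * `|s - t| <= `|u s - u t|.
Proof.
move=> ab K0 uK u0.
(* When the essential infimum is infinite any positive constant will do, and 1 is taken. *)
have [c c0 cu] : exists2 c : R, 0 < c & (c%:E <= ess_inf (mu_itv a b) (EFin \o derive1 u))%E.
  case: (ess_inf _ _) u0 => [c|_|//]; last by exists 1 => //; rewrite leey.
  by rewrite lte_fin => c0; exists c.
have [Z [mZ Z0 cZ]] := mu_itv_ae (ess_inf_le (mu_itv a b) (EFin \o derive1 u)).
have [Z' [mZ' Z'0 dZ]] := lip_itv_hasd_real ab K0 uK.
exists c => //.
have le_case s t : a <= s -> s <= t -> t <= b -> c * (t - s) <= u t - u s.
  move=> as_ st tb; apply: (expand_of_derive c0 K0 uK (measurableU _ _ mZ mZ') _ _ as_ st tb).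
    apply/eqP; rewrite eq_le measure_ge0 andbT; apply: mu_setU_null => //.
    by move: Z0 => /= ->.
  move=> x /andP[ax xb] nZ; exists (derive1 u x).
    by apply: dZ; rewrite ?ax// => Zx; apply: nZ; right.
  rewrite -lee_fin (le_trans cu)//; apply: cZ; rewrite ?(ltW ax) ?(ltW xb)//.
  by move=> Zx; apply: nZ; left.
move=> s t /andP[as_ sb] /andP[at_ tb]; case: (leP s t) => [st|/ltW ts].
  rewrite distrC [in leRHS]distrC ger0_norm ?subr_ge0//.
  by rewrite (le_trans (le_case _ _ as_ st tb))// ler_norm.
rewrite ger0_norm ?subr_ge0//.
by rewrite (le_trans (le_case _ _ at_ ts sb))// ler_norm.
Qed.

Lemma ess_sup_expand (u : R -> R) a b K : a <= b -> 0 <= K ->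
  (forall s t, a <= s <= b -> a <= t <= b -> `|u s - u t| <= K * `|s - t|) ->
  (ess_sup (mu_itv a b) (EFin \o derive1 u) < 0)%E ->
  exists2 c, 0 < c & forall s t, a <= s <= b -> a <= t <= b ->
    c * `|s - t| <= `|u s - u t|.
Proof.
move=> ab K0 uK u0.
have [c c0 cu] : exists2 c : R, 0 < c & (ess_sup (mu_itv a b) (EFin \o derive1 u) <= (- c)%:E)%E.
  case: (ess_sup _ _) u0 => [c|//|_]; last by exists 1 => //; rewrite leNye.
  by rewrite lte_fin => c0; exists (- c); rewrite ?oppr_gt0// opprK.
have [Z [mZ Z0 cZ]] := mu_itv_ae (ess_sup_ge (mu_itv a b) (EFin \o derive1 u)).
have [Z' [mZ' Z'0 dZ]] := lip_itv_hasd_real ab K0 uK.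
have uK' s t : a <= s <= b -> a <= t <= b -> `|- u s - - u t| <= K * `|s - t|.
  by move=> sab tab; rewrite -opprD normrN; exact: uK.
exists c => //.
have le_case s t : a <= s -> s <= t -> t <= b -> c * (t - s) <= - u t - - u s.
  move=> as_ st tb; apply: (expand_of_derive (w := fun t => - u t) c0 K0 uK'
    (measurableU _ _ mZ mZ') _ _ as_ st tb).
    apply/eqP; rewrite eq_le measure_ge0 andbT; apply: mu_setU_null => //.
    by move: Z0 => /= ->.
  move=> x /andP[ax xb] nZ; exists (- derive1 u x).
    apply/hasd_is_derive/is_deriveN/hasd_is_derive.
    by apply: dZ; rewrite ?ax// => Zx; apply: nZ; right.
  rewrite lerNr -lee_fin (le_trans _ cu)//; apply: cZ; rewrite ?(ltW ax) ?(ltW xb)//.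
  by move=> Zx; apply: nZ; left.
move=> s t /andP[as_ sb] /andP[at_ tb]; case: (leP s t) => [st|/ltW ts].
  rewrite distrC ger0_norm ?subr_ge0//.
  by rewrite (le_trans (le_case _ _ as_ st tb))// opprK addrC ler_norm.
rewrite ger0_norm ?subr_ge0// distrC.
by rewrite (le_trans (le_case _ _ at_ ts sb))// opprK addrC ler_norm.
Qed.

(* The bound holds for all [v] near [u] in the Lipschitz seminorm, with the same
   constants; only short intervals around the mesh points are discarded. *)
Lemma pm_pullback (u : R -> R) a b K s : itv_partition a b s -> 0 <= K ->
  (forall x y, a <= x <= b -> a <= y <= b -> `|u x - u y| <= K * `|x - y|) ->
  (forall i, (i < size s)%N ->
    let t_i := nth b (a :: s) i in let t_i1 := nth b (a :: s) i.+1 in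
    (forall a' b' : R, t_i < a' -> a' < b' -> b' < t_i1 ->
      (0 < ess_inf (mu_itv a' b') (EFin \o derive1 u))%E) \/
    (forall a' b' : R, t_i < a' -> a' < b' -> b' < t_i1 ->
      (ess_sup (mu_itv a' b') (EFin \o derive1 u) < 0)%E)) ->
  forall eta, 0 < eta -> exists C kappa, [/\ 0 <= C, 0 < kappa &
    forall v : R -> R,
      (forall x y, a <= x <= b -> a <= y <= b ->
         `|(v x - u x) - (v y - u y)| <= kappa * `|x - y|) ->
      forall (E A : set R) m, measurable A -> (mu E <= m%:E)%E ->
      (forall t, A t -> a <= t <= b /\ E (v t)) -> (mu A <= (eta + C * m)%:E)%E].
Proof.
move=> + K0; elim: s a => [|a1 s IH] a.
  move=> /= [_ /eqP /= ab] _ _ eta eta0; exists 0, 1; split=> // v _ E A m mA _ AE.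
  rewrite mul0r addr0 (@le_trans _ _ (mu [set a]))//.
    apply: mu_le => // t /AE[/andP[h1 h2] _] /=; apply/eqP; rewrite eq_le h1 andbT.
    by rewrite ab.
  by rewrite lebesgue_measure_set1 lee_fin ltW.
move=> /[dup] ps /itv_partition_cons ps1 uK up eta eta0.
have aa1 : a < a1 by case: ps => /= /andP[].
have a1b : a1 <= b by exact: itv_partition_le ps1.
have eta20 : 0 < eta / 2 by rewrite divr_gt0.
have [||C1 [k1 [C10 k10 H1]]] := IH a1 ps1 _ _ _ eta20.
- by move=> x y /andP[x1 x2] /andP[y1 y2]; apply: uK; lra.
- by move=> i; have := up i.+1.
(* The two discarded intervals of length [sg] cost at most [eta / 2]; the other half of [eta] goes
   to the remaining cells. The second bound leaves a nonempty middle interval. *)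
pose sg := Num.min (eta / 4) ((a1 - a) / 4).
have sg0 : 0 < sg by rewrite lt_min !divr_gt0// subr_gt0.
have sg1 : sg <= eta / 4 by rewrite ge_min lexx.
have sg2 : sg <= (a1 - a) / 4 by rewrite ge_min lexx orbT.
pose a' := a + sg; pose b' := a1 - sg.
have uK' x y : a' <= x <= b' -> a' <= y <= b' -> `|u x - u y| <= K * `|x - y|.
  by rewrite /a' /b' => /andP[x1 x2] /andP[y1 y2]; apply: uK; lra.
have aa' : a < a' by rewrite /a' ltrDl.
have ab' : a' < b' by rewrite /a' /b'; lra.
have bb' : b' < a1 by rewrite /b' gtrBl.
have [c c0 uc] : exists2 c, 0 < c & forall x y, a' <= x <= b' -> a' <= y <= b' ->
    c * `|x - y| <= `|u x - u y|.
  have := up 0 isT => /= -[] /(_ a' b' aa' ab' bb').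
    exact: ess_inf_expand (ltW ab') K0 uK'.
  exact: ess_sup_expand (ltW ab') K0 uK'.
have c20 : 0 < c / 2 by rewrite divr_gt0.
(* A perturbation with Lipschitz constant at most [c / 2] leaves half of the expansion factor [c] of
   [u]. *)
exists (C1 + (c / 2)^-1), (Num.min k1 (c / 2)); split.
- by rewrite addr_ge0// invr_ge0 ltW.
- by rewrite lt_min k10.
move=> v vu E A m mA Em AE.
pose A1 := A `&` `[a1, b]%classic; pose A2 := A `&` `[a', b']%classic.
have mA1 : measurable A1 by exact: measurableI.
have mA2 : measurable A2 by exact: measurableI.
have mL : measurable (`[a, a']%classic : set R) by exact: measurable_itv.
have mR : measurable (`[b', a1]%classic : set R) by exact: measurable_itv.
have muitv (x y : R) : x <= y -> (mu (`[x, y]%classic : set R) <= (y - x)%:E)%E.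
  move=> xy; rewrite lebesgue_measure_itv/= lte_fin; case: ifP => _ //.
  by rewrite lee_fin subr_ge0.
have h1 : (mu A1 <= (eta / 2 + C1 * m)%:E)%E.
  apply: (H1 v _ E) => //.
    move=> x y /andP[x1 x2] /andP[y1 y2]; rewrite (le_trans (vu _ _ _ _))//; try lra.
    by rewrite ler_wpM2r// ge_min lexx.
  move=> t [/AE[_ Evt]]; rewrite /= in_itv/= => tab; split=> //.
have h2 : (mu A2 <= ((c / 2)^-1 * m)%:E)%E.
  apply: (@expand_measure v a' b' _ E) => //.
    move=> x y xab yab; have xab' : a <= x <= b by move: xab => /andP[? ?]; lra.
    have yab' : a <= y <= b by move: yab => /andP[? ?]; lra.
    have h3 := uc _ _ xab yab.
    have h4 : `|(v x - u x) - (v y - u y)| <= c / 2 * `|x - y|.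
      by rewrite (le_trans (vu _ _ xab' yab'))// ler_wpM2r// ge_min lexx orbT.
    have : `|u x - u y| <= `|v x - v y| + `|(v x - u x) - (v y - u y)|.
      rewrite (le_trans _ (ler_normB _ _))// le_eqVlt; apply/orP; left; apply/eqP.
      by congr (`| _ |); ring.
    by move: h3 h4; move: `|u x - u y| `|v x - v y| => ? ?; lra.
  by move=> t [/AE[_ Evt]]; rewrite /= in_itv/= => tab; split=> //.
have AU : A `<=` (A1 `|` A2) `|` (`[a, a']%classic `|` `[b', a1]%classic).
  move=> t At; have [/andP[at_ tb] _] := AE _ At; rewrite /A1 /A2 /= !in_itv/= at_ tb andbT.
  case: (leP a1 t) => t1; first by left; left.
  case: (leP t a') => t2; first by right; left.
  case: (leP b' t) => t3; first by right; right; rewrite (ltW t1).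
  by left; right; split=> //; rewrite !ltW.
have := mu_setU_le (measurableU _ _ mA1 mA2) (measurableU _ _ mL mR)
  (mu_setU_le mA1 mA2 h1 h2) (mu_setU_le mL mR (muitv _ _ (ltW aa')) (muitv _ _ (ltW bb'))).
move=> h; rewrite (@le_trans _ _ (mu ((A1 `|` A2) `|` (`[a, a']%classic `|` `[b', a1]%classic))))//.
  by apply: mu_le => //; apply: measurableU; exact: measurableU.
rewrite (le_trans h)// lee_fin /a' /b'; lra.
Qed.

End piecewise_monotone.


(** * Operator-valued continuity and differentials *)

Section operators.
Context {R : realType}.

(** A bound on the unit ball spreads to every [h] by homogeneity. *)
Lemma op_continuousE (X : pseudoMetricType R) (U W : normedModType R) (D : set X)
    (A : X -> U -> W) : op_continuous D A ->
  (forall p (c : R) h, A p (c *: h) = c *: A p h) ->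
  forall p, D p -> forall e, 0 < e -> exists2 d, 0 < d &
    forall q, D q -> ball p d q -> forall h, `|A q h - A p h| <= e * `|h|.
Proof.
move=> cA hA p Dp e e0.
have : nbhs (0%E : \bar R) [set y | (y < e%:E)%E].
  by apply: open_nbhs_nbhs; split; [exact: open_ereal_lt_ereal|rewrite /= lte_fin].
move=> /(cA p Dp) /nbhs_ballP[d /= d0 H]; exists d => // q Dq pq h.
have /= {}H := H q pq Dq.
have [->|h0] := eqVneq h 0.
  by rewrite -(scale0r 0) !hA !scale0r subrr !normr0 mulr0.
have nh : `|h| != 0 by rewrite normr_eq0.
rewrite -(scalerKV nh h) !hA -scalerBr !normrZ normr_id mulrCA ler_wpM2l//.
rewrite normfV normr_id mulVf// mulr1 -lee_fin (le_trans _ (ltW H))//.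
by apply: ereal_sup_ubound; exists (`|h|^-1 *: h); [rewrite /= normrZ normfV normr_id mulVf|rewrite !hA].
Qed.

Lemma op_continuousI (X : topologicalType) (U W : normedModType R) (D : set X)
    (A : X -> U -> W) :
  (forall p, D p -> forall e, 0 < e -> \forall q \near p, D q -> forall h,
     `|A q h - A p h| <= e * `|h|) -> op_continuous D A.
Proof.
move=> H p Dp.
have le_op q e : 0 < e -> (forall h, `|A q h - A p h| <= e * `|h|) ->
    (opnorm (fun h => (A q h - A p h)%R) <= e%:E)%E.
  move=> e0 Ae; apply: ge_ereal_sup => _ [h /= h1 <-]; rewrite lee_fin.
  by rewrite (le_trans (Ae h))// ler_piMr// ltW.
have op_ge0 q : (0 <= opnorm (fun h => (A q h - A p h)%R))%E.
  rewrite (@le_trans _ _ (`|A q 0 - A p 0|%R%:E))//.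
  by apply: ereal_sup_ubound; exists 0 => //=; rewrite normr0.
apply/fine_cvgP; split.
  apply: filterS (H p Dp 1 ltr01) => q + Dq => /(_ Dq) Hq.
  by rewrite ge0_fin_numE// (le_lt_trans (le_op _ _ ltr01 Hq))// ltry.
apply/cvgrPdist_le => e e0; apply: filterS (H p Dp e e0) => q + Dq => /(_ Dq) Hq.
have opq := le_op _ _ e0 Hq.
rewrite sub0r normrN ger0_norm ?fine_ge0//= -lee_fin fineK//.
by rewrite ge0_fin_numE// (le_lt_trans opq)// ltry.
Qed.

Lemma diff_eps (U W : normedModType R) (g : U -> W) y : differentiable g y ->
  forall e, 0 < e -> exists2 d, 0 < d &
    forall h, `|h| <= d -> `|g (y + h) - g y - 'd g y h| <= e * `|h|.
Proof.
move=> /diff_locallyP[_ /eqaddoP gE] e e0.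
have /nbhs_ballP[d /= d0 Hd] := gE e e0.
exists (d / 2); first by rewrite divr_gt0.
move=> h hd; rewrite [y + h]addrC -addrA -opprD; apply: Hd.
rewrite -ball_normE /= sub0r normrN (le_lt_trans hd)//.
by rewrite ltr_pdivrMr// mulr2n mulrDr mulr1 ltrDl.
Qed.

Lemma eps_diff (U W : normedModType R) (g : U -> W) y (A : {linear U -> W}) K :
  (forall h, `|A h| <= K * `|h|) ->
  (forall e, 0 < e -> exists2 d, 0 < d &
     forall h, `|h| <= d -> `|g (y + h) - g y - A h| <= e * `|h|) ->
  differentiable g y /\ 'd g y = A :> (U -> W).
Proof.
move=> AK gA.
have cA : continuous A.
  apply: bounded_linear_continuous; apply/linear_boundedP.
  exists K; split=> [|k Kk h]; first exact: num_real.
  by rewrite (le_trans (AK h))// ler_wpM2r// ltW.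
have gE : g \o shift y = cst (g y) + A +o_ 0 id.
  apply/eqaddoP => e e0; have [d d0 Hd] := gA e e0.
  apply/nbhs_ballP; exists d => //= h; rewrite -ball_normE /= sub0r normrN => hd.
  by have := Hd h (ltW hd); rewrite [y + h]addrC -addrA -opprD.
have dE := diff_unique cA gE; split=> //.
by apply/diff_locallyP; rewrite dE.
Qed.

Lemma linear_eps_diff (U W : normedModType R) (F : U -> W) y (A : U -> W) K :
  linear A -> (forall h, `|A h| <= K * `|h|) ->
  (forall e, 0 < e -> exists2 d, 0 < d &
     forall h, `|h| <= d -> `|F (y + h) - F y - A h| <= e * `|h|) ->
  differentiable F y /\ forall h, 'd F y h = A h.
Proof.
move=> linA AK FA.
pose A' : {linear U -> W} := HB.pack A (GRing.isLinear.Build R U W *:%R A linA).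
by have [dF dE] := @eps_diff U W F y A' K AK FA; split=> // h; rewrite dE.
Qed.

Lemma diff_bounded (U W : normedModType R) (g : U -> W) y : differentiable g y ->
  exists2 K, 0 <= K & forall h, `|'d g y h| <= K * `|h|.
Proof.
move=> /diff_locallyP[/linear_bounded_continuous /linear_boundedP H _].
have [k [kr Hk]] := H.
exists (Num.max k 0 + 1); first by rewrite addr_ge0// le_max lexx orbT.
by move=> h; apply: Hk; rewrite ltr_pwDr// le_max lexx.
Qed.

Lemma diff_hasd (U W : normedModType R) (g : U -> W) (p v : U) s :
  differentiable g (p + s *: v) ->
  hasd (fun s => g (p + s *: v)) s ('d g (p + s *: v) v).
Proof.
move=> dg e e0; pose k := `|v| + 1.
have k0 : 0 < k by rewrite ltr_wpDl.
have ek0 : 0 < e / k by rewrite divr_gt0.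
have [d d0 Hd] := diff_eps dg ek0; exists (d / k); first by rewrite divr_gt0.
move=> s'; rewrite ler_pdivlMr// => sd.
have hv : `|(s' - s) *: v| <= `|s' - s| * k.
  by rewrite normrZ ler_wpM2l// lerDl.
have := Hd ((s' - s) *: v) (le_trans hv sd).
rewrite (_ : p + s *: v + (s' - s) *: v = p + s' *: v); last by lmod R.
rewrite linearZ => /le_trans; apply.
rewrite (le_trans (ler_wpM2l (ltW ek0) hv))// mulrCA -[e / k]/(e * k^-1).
by rewrite -mulrA mulVf ?gt_eqF// mulr1 mulrC.
Qed.

(** The counterpart of [mvt_bad] for a function differentiable at every point, which need not come
    with a Lipschitz constant. *)
Lemma mvt_all (W : normedModType R) (F : R -> W) a b k : a <= b -> 0 <= k ->
  (forall t, a <= t <= b -> exists2 v, hasd F t v & `|v| <= k) ->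
  `|F b - F a| <= k * (b - a).
Proof.
move=> ab k0 Fk; apply/ler_addgt0Pl => e0 e0_gt0.
pose e := e0 / (b - a + 1).
have D0 : 0 < b - a + 1 by rewrite ltr_wpDl// subr_ge0.
have e_gt0 : 0 < e by rewrite divr_gt0.
pose Q s t := `|F t - F s| <= (k + e) * (t - s).
have Qab : Q a b.
  apply: (@cousin _ Q) => // [s t u _ _ Qst Qtu|t tab].
    rewrite /Q -(subrK (F t) (F u)) -addrA (le_trans (ler_normD _ _))//.
    by rewrite (le_trans (lerD Qtu Qst))//; lra.
  have [v Fv vk] := Fk _ tab.
  have [d d0 Hd] := Fv _ e_gt0; exists d => //.
  have est s : `|s - t| <= d -> `|F s - F t| <= (k + e) * `|s - t|.
    move=> sd; rewrite -[F s - F t](subrK ((s - t) *: v)) mulrDl addrC.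
    rewrite (le_trans (ler_normD _ _))// lerD//; last exact: Hd.
    by rewrite normrZ mulrC ler_wpM2r.
  split=> [s as_ /andP[ts st]|u ub /andP[tu ud]]; rewrite /Q.
    by rewrite distrC (le_trans (est s _))// distrC ger0_norm ?subr_ge0//; lra.
  by rewrite (le_trans (est u _))// ger0_norm ?subr_ge0//; lra.
have : e * (b - a + 1) = e0 by rewrite /e divfK ?gt_eqF.
by move: Qab; rewrite /Q => ? ?; nra.
Qed.

Lemma diff_mvt (U W : normedModType R) (g : U -> W) (p v : U) (w : W) e : 0 <= e ->
  (forall s, 0 <= s <= 1 -> differentiable g (p + s *: v)) ->
  (forall s, 0 <= s <= 1 -> `|'d g (p + s *: v) v - w| <= e) ->
  `|g (p + v) - g p - w| <= e.
Proof.
move=> e0 dg de.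
have := @mvt_all _ (fun s => g (p + s *: v) - s *: w) 0 1 e ler01 e0.
rewrite scale1r scale0r addr0 scale1r scale0r !subr0 mulr1 => H.
rewrite addrAC; apply: H => t t01; exists ('d g (p + t *: v) v - w); last exact: de.
by apply: hasdB (hasd_lin _ _); apply: diff_hasd; exact: dg.
Qed.

(** Compactness of [a, b] in the form used throughout: a radius that can be chosen locally uniformly
    can be chosen uniformly, since shrinking it preserves [P]. *)
Lemma curve_unif (P : R -> R -> Prop) a b : a <= b ->
  (forall d d' t, d' <= d -> P d t -> P d' t) ->
  (forall t, a <= t <= b -> exists2 d, 0 < d & exists2 rho, 0 < rho &
     forall s, a <= s <= b -> `|s - t| <= rho -> P d s) ->
  exists2 d, 0 < d & forall t, a <= t <= b -> P d t.
Proof.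
move=> ab Pmono Ploc.
pose Q s t := a <= s -> t <= b -> exists2 d, 0 < d & forall x, s <= x <= t -> P d x.
suff : Q a b by move=> /(_ (lexx a) (lexx b)).
apply: (@cousin _ Q) => // [s t u /andP[as_ st] /andP[tu ub] Qst Qtu _ _|t /andP[at_ tb]].
  have [d d0 Hd] := Qst as_ (le_trans tu ub).
  have [d' d'0 Hd'] := Qtu (le_trans as_ st) ub.
  exists (Num.min d d'); first by rewrite lt_min d0.
  move=> x /andP[sx xu]; case: (leP x t) => xt.
    by apply: (Pmono d); [rewrite ge_min lexx|apply: Hd; rewrite sx].
  by apply: (Pmono d'); [rewrite ge_min lexx orbT|apply: Hd'; rewrite (ltW xt)].
have [|d d0 [rho r0 H]] := Ploc t; first by rewrite at_.
exists rho => //; split=> [s _ /andP[ts st] as_ _|u _ /andP[tu ut] _ ub];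
  exists d => // x /andP[x1 x2]; apply: H; rewrite ?ler_norml; lra.
Qed.

Definition curve_continuous (X : pseudoMetricType R) (c : R -> X) (a b : R) :=
  forall t, a <= t <= b -> forall e, 0 < e -> exists2 rho, 0 < rho &
    forall s, a <= s <= b -> `|s - t| <= rho -> ball (c t) e (c s).

(** In infinite dimension the sets in play are not compact, so continuity is made uniform only
    around a compact curve: one of the two points compared always lies on the curve. *)
Lemma op_curve_unif (X : pseudoMetricType R) (U W : normedModType R) (D : set X)
    (A : X -> U -> W) (c : R -> X) a b : a <= b ->
  op_continuous D A -> (forall p (k : R) h, A p (k *: h) = k *: A p h) ->
  curve_continuous c a b -> (forall t, a <= t <= b -> D (c t)) ->
  forall e, 0 < e -> exists2 d, 0 < d & forall t, a <= t <= b ->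
    forall q, D q -> ball (c t) d q -> forall h, `|A q h - A (c t) h| <= e * `|h|.
Proof.
move=> ab cA hA cc Dc e e0.
apply: (@curve_unif (fun d t => forall q, D q -> ball (c t) d q ->
  forall h, `|A q h - A (c t) h| <= e * `|h|)) => //.
  by move=> d d' t dd H q Dq /(le_ball dd); exact: H.
move=> t tab; have e20 : 0 < e / 2 by rewrite divr_gt0.
have [d d0 Hd] := op_continuousE cA hA (Dc _ tab) e20.
have d20 : 0 < d / 2 by rewrite divr_gt0.
have [rho r0 Hr] := cc _ tab _ d20.
exists (d / 2) => //; exists rho => // s sab sr q Dq sq h.
have ts := Hr _ sab sr.
have h1 := Hd q Dq (ball_split ts sq) h.
have h2 := Hd (c s) (Dc _ sab) (le_ball _ ts) h.
rewrite -(subrK (A (c t) h) (A q h)) -addrA (le_trans (ler_normD _ _))//.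
have := h2 _; rewrite distrC => {}h2.
rewrite (splitr e) mulrDl lerD// h2// ler_pdivrMr// ler_peMr ?ltW//; lra.
Qed.

Lemma op_curve_bounded (X : pseudoMetricType R) (U W : normedModType R) (D : set X)
    (A : X -> U -> W) (c : R -> X) a b : a <= b ->
  op_continuous D A -> (forall p (k : R) h, A p (k *: h) = k *: A p h) ->
  curve_continuous c a b -> (forall t, a <= t <= b -> D (c t)) ->
  (forall p, D p -> exists2 K, 0 <= K & forall h, `|A p h| <= K * `|h|) ->
  exists2 K, 0 <= K & forall t, a <= t <= b -> forall h, `|A (c t) h| <= K * `|h|.
Proof.
move=> ab cA hA cc Dc bA.
(* The bound is stated with the inverse [d] of the constant, so that it is monotone in the direction
   [curve_unif] expects. *)
have [||d d0 H] := @curve_unif (fun d t => forall h, d * `|A (c t) h| <= `|h|) a b ab.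
- by move=> d d' t dd H h; rewrite (le_trans _ (H h))// ler_wpM2r.
- move=> t tab; have [K K0 AK] := bA _ (Dc _ tab).
  have [d d0 Hd] := op_continuousE cA hA (Dc _ tab) ltr01.
  have [rho r0 Hr] := cc _ tab _ d0.
  have K10 : 0 < K + 1 by rewrite ltr_wpDl.
  exists (K + 1)^-1; first by rewrite invr_gt0.
  exists rho => // s sab sr h; rewrite ler_pdivrMl//.
  have h1 := Hd (c s) (Dc _ sab) (Hr _ sab sr) h.
  rewrite -(subrK (A (c t) h) (A (c s) h)) (le_trans (ler_normD _ _))//.
  by rewrite mulrDl addrC lerD.
exists d^-1; first by rewrite invr_ge0 ltW.
by move=> t tab h; rewrite -ler_pdivrMl ?invr_gt0// invrK; exact: H.
Qed.

Lemma ball_step (U : normedModType R) (p q : U) d s : 0 <= s <= 1 -> ball p d q ->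
  ball p d (p + s *: (q - p)).
Proof.
move=> /andP[s0 s1]; rewrite -!ball_normE /= => pq.
rewrite opprD addrA subrr add0r normrN normrZ ger0_norm// distrC.
by rewrite (le_lt_trans _ pq)// ler_piMl.
Qed.

End operators.

(** * Completeness of R^n for an arbitrary norm *)

Section rvec_complete.
Context {R : realType} {n : nat} (nu : vnorm R n).

Lemma rvec_cauchy (u : nat -> rvec nu) :
  (forall e, 0 < e -> exists N, forall k l, (N <= k)%N -> (N <= l)%N ->
     `|u k - u l| <= e) ->
  exists l : rvec nu, forall e, 0 < e -> exists N, forall k, (N <= k)%N ->
    `|u k - l| <= e.
Proof.
move=> Hu; have [K K0 Klb] := vnorm_lower nu; have [K' K'0 Kub] := vnorm_upper nu.
pose v : nat -> 'rV[R]_n := u.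
have /cvg_ex[l vl] : cvg (v @ \oo).
  apply/cauchy_cvgP/cauchy_exP => e e0.
  have eK : 0 < K^-1 * (e / 2) by rewrite mulr_gt0 ?invr_gt0 ?divr_gt0.
  have [N HN] := Hu _ eK; exists (v N); exists N => // k /= Nk.
  rewrite -ball_normE /= (le_lt_trans (Klb _))//.
  have := HN N k (leqnn N) Nk; rewrite ler_pdivlMl// => /le_lt_trans; apply.
  by rewrite ltr_pdivrMr// mulr2n mulrDr mulr1 ltrDl.
exists (l : 'rV[R]_n) => e e0.
have eK : 0 < K'^-1 * e by rewrite mulr_gt0 ?invr_gt0.
have := (cvgrPdist_le _ _).1 vl _ eK => -[N _ HN]; exists N => k Nk.
have := HN k Nk; rewrite ler_pdivlMl// distrC => /(le_trans _); apply.
exact: Kub.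
Qed.

End rvec_complete.

(** * The norm of W^{1,oo} as a Lipschitz constant *)

Section W_norm.
Context {R : realType} {n : nat} (nu : vnorm R n) (r : {posnum R}).
Local Notation mu := (@lebesgue_measure R).

(** The essential supremum bounds the derivative off a null set, and the mean value inequality
    ignores null sets for Lipschitz functions. Through this lemma the bounds on segments in W^{1,oo}
    become Lipschitz estimates for [x]. *)
Lemma Wspace_lip (w : Wspace nu r) (s t : R) : `|w s - w t| <= `|w| * `|s - t|.
Proof.
have [k k0 wk] := Wfun_lip w.
have r0 : - r%:num <= 0 :> R by rewrite oppr_le0 ge0.
have wk' x y : - r%:num <= x <= 0 -> - r%:num <= y <= 0 -> `|w x - w y| <= k * `|x - y|.
  by move=> _ _; exact: wk.
have [Z [mZ Z0 cZ]] := mu_itv_ae (ess_sup_ge (mu_itv (- r%:num) 0)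
  (fun t => `|derive1 (w : R -> rvec nu) t|%:E)).
have [Z' [mZ' Z'0 dZ]] := lip_itv_hasd r0 k0 wk'.
have wN : fine (Wesssup w) <= `|w| by rewrite /Num.norm/= /Wnorm le_max lexx orbT.
have ZZ : (mu (Z `|` Z') <= 0%:E)%E.
  by apply: mu_setU_null => //; move: Z0 => /= ->.
have le_case x y : - r%:num <= x -> x <= y -> y <= 0 -> `|w y - w x| <= `|w| * (y - x).
  move=> rx xy y0.
  have := mvt_bad_lip k0 (normr_ge0 w) wk' (measurableU _ _ mZ mZ') ZZ _ rx xy y0.
  rewrite mulr0 addr0; apply => z zab nZ; exists (derive1 (w : R -> rvec nu) z).
    by apply: dZ => // Zz; apply: nZ; right.
  apply: le_trans wN; rewrite -lee_fin fineK ?Wesssup_fin//; apply: cZ.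
    by move: zab => /andP[/ltW -> /ltW ->].
  by move=> Zz; apply: nZ; left.
have c_case x y : - r%:num <= x <= 0 -> - r%:num <= y <= 0 ->
    `|w x - w y| <= `|w| * `|x - y|.
  move=> /andP[rx x0] /andP[ry y0]; case: (leP x y) => [xy|/ltW yx].
    by rewrite distrC [in leRHS]distrC (ger0_norm (x := y - x)) ?subr_ge0// le_case.
  by rewrite (ger0_norm (x := x - y)) ?subr_ge0// le_case.
rewrite -(Cfun_clamp w s) -(Cfun_clamp w t).
have := clamp_itv r s; have := clamp_itv r t; rewrite !in_itv/= => ht hs.
by rewrite (le_trans (c_case _ _ hs ht))// ler_wpM2l// clamp_lip.
Qed.

End W_norm.


(** * Segments *)

Section real_inequalities.
Context {R : realType}.
Implicit Types (s t u p q d K e rho : R).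

Lemma near_window p q u s : p < u < q -> `|s - u| <= Num.min (u - p) (q - u) ->
  p <= s <= q.
Proof. by rewrite le_min !ler_norml; lra. Qed.

Lemma lt_of_half K d t : 0 < K -> 0 < d -> 0 <= t -> t <= d / (K + K) -> K * t < d.
Proof.
move=> K0 d0 t0; rewrite ler_pdivlMr ?addr_gt0// mulrDr mulrC => h.
have := mulr_ge0 (ltW K0) t0; move: (K * t) h => z; lra.
Qed.

Lemma sub_lt_double s t rho : 0 < rho -> s < t + rho -> s - t < 2 * rho.
Proof. lra. Qed.

Lemma sub_le_half s t rho d : 0 < d -> s < t + rho -> rho <= d / 2 -> s - t <= d.
Proof. lra. Qed.

Lemma quarter_lt rho d : 0 < d -> rho <= d / 4 -> 2 * rho < d.
Proof. lra. Qed.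

Lemma sub_le_double t s e : 0 <= s -> t <= e -> 0 < e -> t - s <= e * 2.
Proof. lra. Qed.

Lemma half_budget e C d : d = e / 2 -> 0 < e -> 0 <= C -> d + C * (d / (C + 1)) <= e.
Proof.
move=> -> e0 C0; have C10 : 0 < C + 1 by rewrite ltr_wpDl.
rewrite [leRHS]splitr lerD2l mulrCA ler_piMr ?divr_ge0 ?(ltW e0)//.
by rewrite ler_pdivrMr// mul1r lerDl.
Qed.

End real_inequalities.

Section lipschitz_local.
Context {R : realType} {V : normedModType R}.

(** A segment sees only a window of length r, so estimates on segments first give Lipschitz bounds
    over distances up to r; real induction removes this limit. *)
Lemma lip_of_local (F : R -> V) a b k rho : 0 < rho ->
  (forall s t, a <= s -> s <= t -> t <= b -> t - s <= rho -> `|F t - F s| <= k * (t - s)) ->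
  forall s t, a <= s <= b -> a <= t <= b -> `|F s - F t| <= k * `|s - t|.
Proof.
move=> rho0 H.
have le_case s t : a <= s -> s <= t -> t <= b -> `|F t - F s| <= k * (t - s).
  move=> as_ st tb; pose Q s t := `|F t - F s| <= k * (t - s).
  apply: (@cousin _ Q) => // [x y z _ _ Qxy Qyz|x /andP[sx xt]].
    rewrite /Q -(subrK (F y) (F z)) -addrA (le_trans (ler_normD _ _))//.
    by rewrite (le_trans (lerD Qyz Qxy))//; lra.
  exists rho => //; split=> [y sy /andP[? ?]|y yt /andP[? ?]]; apply: H; lra.
move=> s t /andP[as_ sb] /andP[at_ tb]; case: (leP s t) => [st|/ltW ts].
  rewrite distrC [in leRHS]distrC (ger0_norm (x := t - s)) ?subr_ge0//; exact: le_case.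
rewrite (ger0_norm (x := s - t)) ?subr_ge0//; exact: le_case.
Qed.

Lemma lip_within (F : R -> V) a b k :
  (forall s t, a <= s <= b -> a <= t <= b -> `|F s - F t| <= k * `|s - t|) ->
  {within `[a, b], continuous F}.
Proof.
move=> Fk; apply/subspace_continuousP => s; rewrite /= in_itv/= => sab.
apply/cvgrPdist_le => e e0; have K0 : 0 < Num.max k 0 + 1.
  by rewrite ltr_wpDl// le_max lexx orbT.
have dl : 0 < e / (Num.max k 0 + 1) by rewrite divr_gt0.
have := cvgr_dist_le (F := nbhs s) (FF := nbhs_filter s) id s cvg_id _ dl.
apply: filterS => t st; rewrite /= in_itv/= => tab; rewrite (le_trans (Fk _ _ sab tab))//.
rewrite (@le_trans _ _ ((Num.max k 0 + 1) * `|s - t|))//.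
  by rewrite ler_wpM2r// (le_trans (_ : k <= Num.max k 0)) ?le_max ?lexx// lerDl.
by rewrite mulrC -ler_pdivlMr.
Qed.

Lemma within_eps (X : pseudoMetricType R) (D : set X) (F : X -> V) :
  {within D, continuous F} -> forall p, D p -> forall e, 0 < e ->
  exists2 d, 0 < d & forall q, D q -> ball p d q -> `|F q - F p| <= e.
Proof.
move=> /subspace_continuousP cF p Dp e e0.
have /nbhs_ballP[d /= d0 H] : nbhs p (fun q => D q -> `|F p - F q| <= e).
  exact: (cvgrPdist_le _ _).1 (cF p Dp) e e0.
by exists d => // q Dq pq; rewrite distrC; exact: H.
Qed.

End lipschitz_local.

Section segment_theory.
Context {R : realType} {n : nat} (nu : vnorm R n) (r : {posnum R}) (a : R).
Local Notation V := (rvec nu).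
Local Notation contW z := {within `[- r%:num, a], continuous z}.
Implicit Types (z y : R -> V).

Lemma segment_cont z t : contW z -> 0 <= t <= a ->
  {within `[t - r%:num, t], continuous z}.
Proof.
move=> cz /andP[t0 ta]; apply: continuous_subspaceW cz => s /=; rewrite !in_itv/=.
by move=> /andP[? ?]; lra.
Qed.

Lemma seg_at z t s : contW z -> 0 <= t <= a -> segment r z t s = z (t + clamp r s).
Proof.
move=> cz ta; rewrite -Cfun_clamp (segmentE (segment_cont cz ta))//.
exact: clamp_itv.
Qed.

Lemma seg_at_sub z t u : contW z -> 0 <= t <= a -> t - r%:num <= u <= t ->
  segment r z t (u - t) = z u.
Proof.
move=> cz ta /andP[h1 h2]; rewrite (seg_at _ cz ta) clamp_id.
  by congr z; ring.
by rewrite in_itv/=; lra.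
Qed.

Lemma seg_le z t S : contW z -> 0 <= t <= a ->
  (forall s, t - r%:num <= s <= t -> `|z s| <= S) -> `|segment r z t| <= S.
Proof.
move=> cz ta H; apply: Cnorm_le => s _; rewrite (seg_at _ cz ta); apply: H.
by have := clamp_itv r s; rewrite in_itv/=; lra.
Qed.

Lemma seg_ext z y t : contW z -> contW y -> 0 <= t <= a ->
  (forall s, t - r%:num <= s <= t -> z s = y s) -> segment r z t = segment r y t.
Proof.
move=> cz cy ta zy; apply/val_inj/funext => s.
change (segment r z t s = segment r y t s).
rewrite (seg_at _ cz ta) (seg_at _ cy ta); apply: zy.
by have := clamp_itv r s; rewrite in_itv/=; lra.
Qed.

Lemma contWD z y : contW z -> contW y -> contW (fun s => z s + y s).
Proof. by move=> cz cy s; apply: cvgD; [exact: cz|exact: cy]. Qed.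

Lemma contWZ (c : R) z : contW z -> contW (fun s => c *: z s).
Proof. by move=> cz s; apply: cvgZl_tmp; exact: cz. Qed.

Lemma contWB z y : contW z -> contW y -> contW (fun s => z s - y s).
Proof. by move=> cz cy s; exact: cvgB (cz s) (cy s). Qed.

Lemma segD z y t : contW z -> contW y -> 0 <= t <= a ->
  segment r (fun s => z s + y s) t = segment r z t + segment r y t.
Proof.
move=> cz cy ta; apply/val_inj/funext => s.
change (segment r (fun s => z s + y s) t s = segment r z t s + segment r y t s).
rewrite (seg_at s (contWD cz cy) ta).
by rewrite -(seg_at s cz ta) -(seg_at s cy ta).
Qed.

Lemma segB z y t : contW z -> contW y -> 0 <= t <= a ->
  segment r (fun s => z s - y s) t = segment r z t - segment r y t.
Proof.
move=> cz cy ta; apply/val_inj/funext => s.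
change (segment r (fun s => z s - y s) t s = segment r z t s - segment r y t s).
rewrite (seg_at s (contWB cz cy) ta).
by rewrite -(seg_at s cz ta) -(seg_at s cy ta).
Qed.

Lemma segZ (c : R) z t : contW z -> 0 <= t <= a ->
  segment r (fun s => c *: z s) t = c *: segment r z t.
Proof.
move=> cz ta; apply/val_inj/funext => s.
change (segment r (fun s => c *: z s) t s = c *: segment r z t s).
rewrite (seg_at s (contWZ (c := c) cz) ta).
by rewrite -(seg_at s cz ta).
Qed.

Lemma seg_lip z M t t' : contW z ->
  (forall s s', - r%:num <= s <= a -> - r%:num <= s' <= a -> `|z s - z s'| <= M * `|s - s'|) ->
  0 <= t <= a -> 0 <= t' <= a -> `|segment r z t - segment r z t'| <= M * `|t - t'|.
Proof.
move=> cz zM ta ta'; apply: Cnorm_le => s _.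
change (`|segment r z t s - segment r z t' s| <= M * `|t - t'|).
rewrite (seg_at s cz ta) (seg_at s cz ta').
have := clamp_itv r s; rewrite in_itv/= => cs.
have h1 : - r%:num <= t + clamp r s <= a by lra.
have h2 : - r%:num <= t' + clamp r s <= a by lra.
have := zM _ _ h1 h2.
by rewrite (_ : t + clamp r s - (t' + clamp r s) = t - t')//; ring.
Qed.

End segment_theory.

(** * The delay equation *)

Section delay.
Context {R : realType} {n : nat} {nu : vnorm R n} {r : {posnum R}} {Theta Xi : normedModType R}.
Local Notation V := (rvec nu).
Local Notation C := (Cspace V r).
Local Notation Gamma := (Gspace nu r Theta Xi).
Local Notation mu := (@lebesgue_measure R).
Variables (T : \bar R) (O1 : set C) (O2 : set V) (O3 : set Theta) (O4 : set Xi).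
Variables (f : R -> C -> V -> Theta -> V) (tau : R -> C -> Xi -> R).
Hypotheses (openO1 : open O1) (openO2 : open O2) (openO3 : open O3) (openO4 : open O4).
Hypothesis tau_range : forall t psi xi, times T t -> O1 psi -> O4 xi ->
  tau t psi xi \in `[0, r%:num].
Hypotheses (hf1 : f1 T O1 O2 O3 f) (hf3 : f3 T O1 O2 O3 f).
Hypotheses (htau2 : tau2 T O1 O4 tau) (htau3 : tau3 T O1 O4 tau)
  (htau4 : tau4 T O1 O4 tau) (htau5 : tau5 T O1 O4 tau).
Variables (a N L : R).
Hypotheses (N_ge0 : 0 <= N) (L_ge0 : 0 <= L) (a_gt0 : 0 < a) (a_le : (a%:E <= T)%E).
Variables (M1 : set C) (M2 : set V) (M3 : set Theta) (M4 : set Xi).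
Hypotheses (admM1 : admissible1 O1 M1) (admM3 : admissible3 O3 M3) (admM4 : admissible4 O4 M4).
Variables (P : set Gamma) (x : Gamma -> R -> V).
Hypothesis openP : open P.
Hypothesis x_sol : forall g, P g -> is_unique_solution O1 O2 f tau a g (x g).
Hypothesis x_adm : forall g (t : R), P g -> t \in `[0, a] ->
  [/\ M1 (segment r (x g) t), M2 (x g (delayed_time tau (x g) (Gxi g) t)),
      M3 (Gtheta g) & M4 (Gxi g)].
Hypothesis x_bound : forall g (t : R), P g -> t \in `[0, a] -> `|segmentW r (x g) t| <= N.
Hypothesis x_lip : forall g g' (t : R), P g -> P g' -> t \in `[0, a] ->
  `|segmentW r (x g) t - segmentW r (x g') t| <= L * `|g - g'|.

Local Notation contW z := {within `[- r%:num, a], continuous z}.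
Local Notation seg g t := (segment r (x g) t).


Let r0 : 0 < r%:num. Proof. exact: gt0. Qed.
Lemma window_itv t y : 0 <= t <= a -> t - r%:num <= y <= t -> - r%:num <= y <= a.
Proof. by have := r0; lra. Qed.

Lemma window_clamp t s : 0 <= t <= a -> - r%:num <= t + clamp r s <= a.
Proof. by have := clamp_itv r s; rewrite in_itv/=; lra. Qed.

Lemma sub_window (t rho s : R) : 0 < t -> t + rho <= a -> t <= s <= t + rho ->
  - r%:num <= s <= a.
Proof. by have := r0; lra. Qed.

Lemma openW t : 0 < t < a -> 0 <= t <= a.
Proof. by move=> /andP[/ltW -> /ltW ->]. Qed.

Lemma closedW t : 0 <= t <= a -> - r%:num <= t <= a.
Proof. by have := r0; lra. Qed.

(** * Solutions: ranges and Lipschitz estimates *)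

Definition utime g t : R := delayed_time tau (x g) (Gxi g) t.
Definition xrhs g t : V := f t (seg g t) (x g (utime g t)) (Gtheta g).

Lemma x_cont g : P g -> contW (x g).
Proof. by move=> /x_sol[[]]. Qed.

Lemma times_a t : 0 <= t <= a -> times T t.
Proof. by move=> /andP[t0 ta]; split=> //; rewrite (le_trans _ a_le)// lee_fin. Qed.

Lemma x_data g t : P g -> 0 <= t <= a ->
  [/\ M1 (seg g t), M3 (Gtheta g), M4 (Gxi g), O1 (seg g t) & O2 (x g (utime g t))].
Proof.
move=> Pg ta; have ti : t \in `[0, a] by rewrite in_itv.
have [? _ ? ?] := x_adm Pg ti; have [[_ _ H _] _] := x_sol Pg.
by have [? ?] := H _ ti.
Qed.

Lemma x_tau_dom g t : P g -> 0 <= t <= a -> tau_dom T O1 O4 (t, seg g t, Gxi g).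
Proof.
move=> Pg ta; have [_ _ m4 o1 _] := x_data Pg ta.
by split=> //=; [exact: times_a|case: admM4 => + _ _; apply].
Qed.

Lemma x_f_dom g t : P g -> 0 <= t <= a ->
  f_dom T O1 O2 O3 (t, seg g t, x g (utime g t), Gtheta g).
Proof.
move=> Pg ta; have [_ m3 _ o1 o2] := x_data Pg ta.
by split=> //=; [exact: times_a|case: admM3 => + _ _; apply].
Qed.

Lemma tau_xrange g t : P g -> 0 <= t <= a -> 0 <= tau t (seg g t) (Gxi g) <= r%:num.
Proof.
move=> Pg ta; have [/= ? ? ?] := x_tau_dom Pg ta.
by have := tau_range (t := t) (psi := seg g t) (xi := Gxi g); rewrite in_itv; apply.
Qed.

Lemma utime_range g t : P g -> 0 <= t <= a -> t - r%:num <= utime g t <= t.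
Proof. by move=> Pg /(tau_xrange Pg); rewrite /utime /delayed_time; lra. Qed.

(** [M1] is the image of a subset of W^{1,oo}, so membership in it ensures that the segment is
    Lipschitz and that [segmentW] is not its default value 0. *)
Lemma segWE g t : P g -> 0 <= t <= a -> segmentW r (x g) t = seg g t :> C.
Proof.
move=> Pg ta; have [m1 _ _ _ _] := x_data Pg ta.
case: admM1 => _ _ [B _ M1E]; rewrite M1E in m1; case: m1 => w _ wE.
by rewrite /segmentW insubdK// -wE; exact: valP.
Qed.

Lemma segW_at g t s : P g -> 0 <= t <= a -> t - r%:num <= s <= t ->
  segmentW r (x g) t (s - t) = x g s.
Proof. by move=> Pg ta ts; rewrite segWE// (seg_at_sub (x_cont Pg)). Qed.

Lemma x_lipschitz g s t : P g -> - r%:num <= s <= a -> - r%:num <= t <= a ->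
  `|x g s - x g t| <= N * `|s - t|.
Proof.
move=> Pg; apply: (lip_of_local r0) => {}s {}t rs st ta str.
(* Segments exist only at nonnegative times; the window of length r that ends at [m] contains both
   points, even when they are negative. *)
pose m := Num.max t 0; have m0 : 0 <= m <= a by rewrite le_max lexx orbT ge_max ta ltW.
have tm : m - r%:num <= t <= m by have := r0; rewrite /m maxEle; case: ifPn; lra.
have sm : m - r%:num <= s <= m by have := r0; rewrite /m maxEle; case: ifPn; lra.
rewrite -(segW_at Pg m0 tm) -(segW_at Pg m0 sm) (le_trans (Wspace_lip _ _ _))//.
rewrite (_ : t - m - (s - m) = t - s); last by ring.
rewrite ger0_norm ?subr_ge0// ler_wpM2r ?subr_ge0//.
by rewrite x_bound// in_itv.
Qed.

Lemma xdiff_lipschitz g g' s t : P g -> P g' -> - r%:num <= s <= a -> - r%:num <= t <= a ->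
  `|(x g' s - x g s) - (x g' t - x g t)| <= L * `|g' - g| * `|s - t|.
Proof.
move=> Pg Pg'; apply: (lip_of_local (F := fun s => x g' s - x g s) r0) => {}s {}t rs st ta str.
pose m := Num.max t 0; have m0 : 0 <= m <= a by rewrite le_max lexx orbT ge_max ta ltW.
have tm : m - r%:num <= t <= m by have := r0; rewrite /m maxEle; case: ifPn; lra.
have sm : m - r%:num <= s <= m by have := r0; rewrite /m maxEle; case: ifPn; lra.
rewrite -(segW_at Pg m0 tm) -(segW_at Pg m0 sm) -(segW_at Pg' m0 tm) -(segW_at Pg' m0 sm).
rewrite (le_trans (Wspace_lip (segmentW r (x g') m - segmentW r (x g) m) _ _))//.
rewrite (_ : t - m - (s - m) = t - s); last by ring.
rewrite ger0_norm ?subr_ge0// ler_wpM2r ?subr_ge0//.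
by rewrite x_lip// in_itv.
Qed.

Lemma xdiff_bound g g' s : P g -> P g' -> - r%:num <= s <= a ->
  `|x g' s - x g s| <= L * `|g' - g|.
Proof.
move=> Pg Pg' sa; pose m := Num.max s 0.
have m0 : 0 <= m <= a by case/andP: sa => _ sa'; rewrite le_max lexx orbT ge_max sa' ltW.
have sm : m - r%:num <= s <= m by have := r0; rewrite /m maxEle; case: ifPn; lra.
rewrite -(segW_at Pg m0 sm) -(segW_at Pg' m0 sm).
rewrite (le_trans (Cnorm_ub (segmentW r (x g') m - segmentW r (x g) m : C) _))//.
rewrite (@le_trans _ _ `|segmentW r (x g') m - segmentW r (x g) m|)//.
  by rewrite [leRHS]/Num.norm/= /Wnorm le_max lexx.
by rewrite x_lip// in_itv.
Qed.

Lemma Gtheta_le (g : Gamma) : `|Gtheta g| <= `|g|.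
Proof. by rewrite [leRHS]/Num.norm/= /Gnorm -addrA addrCA lerDl addr_ge0. Qed.

Lemma Gxi_le (g : Gamma) : `|Gxi g| <= `|g|.
Proof. by rewrite [leRHS]/Num.norm/= /Gnorm lerDr addr_ge0. Qed.

Lemma segdiff_bound g g' t : P g -> P g' -> 0 <= t <= a ->
  `|seg g' t - seg g t| <= L * `|g' - g|.
Proof.
move=> Pg Pg' ta; rewrite -(segB (x_cont Pg') (x_cont Pg) ta).
apply: (seg_le _ ta) => [|s st]; first by apply: contWB; exact: x_cont.
by apply: xdiff_bound => //; exact: window_itv st.
Qed.

Lemma data_close : exists2 K, 1 <= K & forall g g' t t', P g -> P g' ->
  0 <= t <= a -> 0 <= t' <= a -> let D := `|t' - t| + `|g' - g| in
  [/\ `|seg g' t' - seg g t| <= K * D, `|x g' (utime g' t') - x g (utime g t)| <= K * D,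
      `|utime g' t' - utime g t| <= K * D &
      `|tau t' (seg g' t') (Gxi g') - tau t (seg g t) (Gxi g)| <= K * D].
Proof.
have [K2 HK2] := htau2 a_gt0 a_le admM1 admM4.
have [K4 HK4] := htau4 a_gt0 a_le admM1 admM4.
pose k2 := Num.max K2 0; pose k4 := Num.max K4 0.
have k20 : 0 <= k2 by rewrite le_max lexx orbT.
have k40 : 0 <= k4 by rewrite le_max lexx orbT.
pose k := k2 * (N + L + 1) + k4.
have k0 : 0 <= k by rewrite addr_ge0// mulr_ge0// !addr_ge0.
have tau_close g g' t t' : P g -> P g' -> 0 <= t <= a -> 0 <= t' <= a ->
  `|seg g' t' - seg g t| <= (N + L) * (`|t' - t| + `|g' - g|) /\
  `|tau t' (seg g' t') (Gxi g') - tau t (seg g t) (Gxi g)| <= k * (`|t' - t| + `|g' - g|).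
  move=> Pg Pg' ta ta'.
  have [m1 _ m4 _ _] := x_data Pg ta; have [m1' _ m4' _ _] := x_data Pg' ta'.
  have h1 : `|seg g' t' - seg g' t| <= N * `|t' - t|.
    apply: (seg_lip (x_cont Pg')) => // s s' sa sa'; exact: x_lipschitz.
  have h2 := segdiff_bound Pg Pg' ta.
  have n1 := normr_ge0 (t' - t); have n2 := normr_ge0 (g' - g).
  have h3 : `|seg g' t' - seg g t| <= N * `|t' - t| + L * `|g' - g|.
    by rewrite -(subrK (seg g' t) (seg g' t')) -addrA (le_trans (ler_normD _ _))// lerD.
  have h4 : `|seg g' t' - seg g t| <= (N + L) * (`|t' - t| + `|g' - g|).
    by rewrite (le_trans h3)// mulrDl lerD// ler_wpM2l// ?lerDl ?lerDr.
  split=> //.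
  have h5 := HK2 t' (seg g' t') (seg g t) (Gxi g') (Gxi g).
  rewrite in_itv/= in h5; have {}h5 := h5 ta' m1' m1 m4' m4.
  have h6 := HK4 t' t (seg g t) (Gxi g).
  rewrite !in_itv/= in h6; have {}h6 := h6 ta' ta m1 m4.
  have h7 : `|Gxi g' - Gxi g| <= `|g' - g| by exact: (Gxi_le (g' - g)).
  have h8 : K2 * (`|seg g' t' - seg g t| + `|Gxi g' - Gxi g|) <=
      k2 * ((N + L + 1) * (`|t' - t| + `|g' - g|)).
    rewrite (@le_trans _ _ (k2 * (`|seg g' t' - seg g t| + `|Gxi g' - Gxi g|)))//.
      by rewrite ler_wpM2r ?addr_ge0// le_max lexx.
    rewrite ler_wpM2l// (le_trans (lerD h4 h7))// [leRHS]mulrDl mul1r lerD2l.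
    by rewrite lerDr.
  have h9 : K4 * `|t' - t| <= k4 * (`|t' - t| + `|g' - g|).
    rewrite (@le_trans _ _ (k4 * `|t' - t|))//.
      by rewrite ler_wpM2r// le_max lexx.
    by rewrite ler_wpM2l// lerDl.
  rewrite -(subrK (tau t' (seg g t) (Gxi g)) (tau t' _ _)) -addrA.
  rewrite (le_trans (ler_normD _ _))// (le_trans (lerD (le_trans h5 h8) (le_trans h6 h9)))//.
  by rewrite /k [leRHS]mulrDl mulrA.
(* It dominates the constants of the four quantities: [N + L] for the segment, [k] for the delay,
   [k + 1] for the delayed time and [N * (k + 1) + L] for the delayed value. *)
exists (N + L + (k + 1) * (N + 1) + 1).
  by rewrite lerDr !addr_ge0// mulr_ge0// addr_ge0.
move=> g g' t t' Pg Pg' ta ta' D.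
have D0 : 0 <= D by rewrite addr_ge0.
have [s1 t1] := tau_close g g' t t' Pg Pg' ta ta'; rewrite -/D in s1 t1.
have u1 : `|utime g' t' - utime g t| <= (k + 1) * D.
  rewrite /utime /delayed_time opprB addrACA addrC -addrA.
  rewrite (_ : _ + _ = (t' - t) - (tau t' (seg g' t') (Gxi g') - tau t (seg g t) (Gxi g))); last by ring.
  rewrite (le_trans (ler_normB _ _))// mulrDl mul1r addrC lerD//.
  by rewrite /D lerDl.
have x1 : `|x g' (utime g' t') - x g (utime g t)| <= N * ((k + 1) * D) + L * D.
  have ua := utime_range Pg ta; have ua' := utime_range Pg' ta'.
  rewrite -(subrK (x g' (utime g t)) (x g' (utime g' t'))) -addrA (le_trans (ler_normD _ _))//.
  rewrite lerD//.
    rewrite (le_trans (x_lipschitz _ (window_itv ta' ua') (window_itv ta ua)))//.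
    by rewrite ler_wpM2l.
  rewrite (le_trans (xdiff_bound _ _ (window_itv ta ua)))//.
  by rewrite ler_wpM2l// /D lerDr.
have kD : 0 <= k * D by rewrite mulr_ge0.
have ND : 0 <= N * D by rewrite mulr_ge0.
have LD : 0 <= L * D by rewrite mulr_ge0.
have kND : 0 <= k * N * D by rewrite !mulr_ge0.
rewrite (_ : _ * D = N * D + L * D + (k * N * D + k * D + N * D + D) + D); last by ring.
rewrite (_ : N * ((k + 1) * D) + L * D = k * N * D + N * D + L * D) in x1; last by ring.
rewrite mulrDl in s1; rewrite mulrDl mul1r in u1.
move: (k * N * D) (N * D) (L * D) (k * D) kND ND LD kD s1 x1 u1 t1 => c1 c2 c3 c4 p1 p2 p3 p4.
by move=> s1 x1 u1 t1; split; [apply: le_trans s1 _|apply: le_trans x1 _|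
  apply: le_trans u1 _|apply: le_trans t1 _]; lra.
Qed.

Lemma x_hasd g t : P g -> 0 < t < a -> hasd (x g) t (xrhs g t).
Proof.
move=> Pg /andP[t0 ta]; have [[_ _ _ H] _] := x_sol Pg.
have {}H := H t _; rewrite in_itv/= (ltW t0) (ltW ta) in H; have {}H := H isT.
move=> e e0.
have : nbhs t (fun s => s != t -> `[0, a]%classic s ->
    `|xrhs g t - (s - t)^-1 *: (x g s - x g t)| <= e).
  exact: (cvgrPdist_le _ _).1 H e e0.
move=> /nbhs_ballP[d /= d0 Hd].
exists (Num.min (d / 2) (Num.min t (a - t))).
  by rewrite !lt_min subr_gt0 divr_gt0// t0.
move=> s; rewrite !le_min => /and3P[sd st sat].
have [->|nst] := eqVneq s t; first by rewrite !subrr scale0r subrr !normr0 mulr0.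
have st0 : s - t != 0 by rewrite subr_eq0.
have bs : ball t d s by rewrite /ball/= distrC; lra.
have sa : `[0, a]%classic s.
  by move: st sat; rewrite !ler_norml /= in_itv/=; lra.
have := Hd s bs nst sa; rewrite distrC => h.
rewrite (_ : x g s - x g t - _ = (s - t) *: ((s - t)^-1 *: (x g s - x g t) - xrhs g t)).
  by rewrite normrZ mulrC ler_wpM2r.
by rewrite scalerBr scalerA divff// scale1r.
Qed.

Lemma lipschitz_of (F : R -> V) (p q k : R) :
  (forall s t, p <= s <= q -> p <= t <= q -> `|F s - F t| <= k * `|s - t|) ->
  [lipschitz F t | t in `[p, q]%classic].
Proof.
move=> Fk; exists k; split=> [|M kM [s t] /= [sa ta]]; first exact: num_real.
rewrite !in_itv/= in sa ta.
by rewrite (le_trans (Fk _ _ sa ta))// ler_wpM2r// ltW.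
Qed.

(** (tau5) bounds the derivative of the difference of the delays almost everywhere by a multiple of
    |g' - g|. The coarse Lipschitz constant [K + K] of this difference only makes the null set
    negligible in the mean value inequality and leaves no trace in the result. *)
Lemma utime_diff_lipschitz : exists2 K, 0 <= K & forall g g', P g -> P g' ->
  forall s t, 0 <= s <= a -> 0 <= t <= a ->
  `|(utime g' s - utime g s) - (utime g' t - utime g t)| <= K * `|g' - g| * `|s - t|.
Proof.
have [K5 K50 H5] := htau5 a_gt0 a_le admM1 admM4.
have [K K1 dK] := data_close.
have K0 : 0 <= K by rewrite (le_trans ler01).
exists (K5 * (L + 1)); first by rewrite mulr_ge0// addr_ge0.
move=> g g' Pg Pg'.
have aa : 0 <= (0 : R) <= a by apply/andP; split=> //; exact: ltW.
have [_ _ m4 _ _] := x_data Pg aa; have [_ _ m4' _ _] := x_data Pg' aa.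
pose tg g t := tau t (seg g t) (Gxi g).
have tgl h s t : P h -> 0 <= s <= a -> 0 <= t <= a -> `|tg h s - tg h t| <= K * `|s - t|.
  by move=> Ph sa ta; have [_ _ _] := dK h h t s Ph Ph ta sa; rewrite subrr normr0 addr0.
have xl h : P h -> [lipschitz x h t | t in `[- r%:num, a]%classic].
  by move=> Ph; apply: (lipschitz_of (k := N)) => s t sa ta; exact: x_lipschitz.
have mm (t : R) : t \in `[0, a] -> M1 (seg g' t) /\ M1 (seg g t).
  rewrite in_itv/= => ta; have [? _ _ _ _] := x_data Pg ta.
  by have [? _ _ _ _] := x_data Pg' ta.
have /ae_null[Z [mZ Z0 HZ]] := H5 _ _ _ _ m4' m4 (xl _ Pg') (xl _ Pg) mm.
have [Z1 [mZ1 Z10 dZ1]] := lip_itv_hasd_real (ltW a_gt0) K0 (fun s t => tgl g s t Pg).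
have [Z2 [mZ2 Z20 dZ2]] := lip_itv_hasd_real (ltW a_gt0) K0 (fun s t => tgl g' s t Pg').
have ZZ : (mu (Z `|` (Z1 `|` Z2)) <= 0%:E)%E.
  apply: mu_setU_null => //; first exact: measurableU; first by move: Z0 => /= ->.
  apply/eqP; rewrite eq_le measure_ge0 andbT; apply: mu_setU_null => //.
  by move: Z10 => /= ->.
pose G t := tg g' t - tg g t.
have kk : 0 <= K5 * (L + 1) * `|g' - g| by rewrite !mulr_ge0// addr_ge0.
have GK s t : 0 <= s <= a -> 0 <= t <= a -> `|G s - G t| <= (K + K) * `|s - t|.
  move=> sa ta; rewrite /G opprB addrACA addrC -addrA.
  rewrite (_ : _ + _ = (tg g' s - tg g' t) - (tg g s - tg g t)); last by ring.
  by rewrite (le_trans (ler_normB _ _))// mulrDl lerD// tgl.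
have le_case s t : 0 <= s -> s <= t -> t <= a ->
    `|G t - G s| <= K5 * (L + 1) * `|g' - g| * (t - s).
  move=> s0 st ta; have K20 : 0 <= K + K by rewrite addr_ge0.
  have mZZ : measurable (Z `|` (Z1 `|` Z2)) by apply: measurableU => //; exact: measurableU.
  have := mvt_bad_lip K20 kk GK mZZ ZZ _ s0 st ta.
  rewrite mulr0 addr0; apply => y ya nZ.
  exists (derive1 (tg g') y - derive1 (tg g) y).
    apply: hasdB; [apply: dZ2|apply: dZ1] => // Zy; apply: nZ; right; by [right|left].
  have ya' : 0 <= y <= a by move: ya; lra.
  have := HZ y; rewrite in_itv/= => HZy.
  rewrite (le_trans (HZy _ _))//; first by move=> Zy; apply: nZ; left.
  rewrite -mulrA ler_wpM2l// mulrDl mul1r lerD//; last exact: (Gxi_le (g' - g)).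
  by rewrite x_lip// in_itv.
have uG s : utime g' s - utime g s = - G s by rewrite /G /utime /delayed_time /tg; ring.
move=> s t /andP[s0 sa] /andP[t0 ta]; rewrite !uG -opprD normrN.
case: (leP s t) => [st|/ltW ts].
  rewrite distrC [`|s - t|]distrC (ger0_norm (x := t - s)) ?subr_ge0//; exact: le_case.
rewrite (ger0_norm (x := s - t)) ?subr_ge0//; exact: le_case.
Qed.

Definition cf g t : R * C * V * Theta := (t, seg g t, x g (utime g t), Gtheta g).
Definition ct g t : R * C * Xi := (t, seg g t, Gxi g).

Lemma data_ball : exists2 K, 1 <= K & forall g g' t t' d, P g -> P g' ->
  0 <= t <= a -> 0 <= t' <= a -> K * (`|t' - t| + `|g' - g|) < d ->
  [/\ ball (cf g t) d (cf g' t'), ball (ct g t) d (ct g' t'),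
      `|utime g' t' - utime g t| < d &
      `|tau t' (seg g' t') (Gxi g') - tau t (seg g t) (Gxi g)| < d].
Proof.
have [K K1 HK] := data_close; exists K => // g g' t t' d Pg Pg' ta ta'.
have /= := HK g g' t t' Pg Pg' ta ta'; set D := `|t' - t| + `|g' - g|.
move=> [h1 h2 h3 h4] KD.
have D0 : 0 <= D by rewrite addr_ge0.
have DK : D <= K * D by rewrite ler_peMl.
have b1 : `|t - t'| < d.
  by rewrite distrC (le_lt_trans _ KD)// (le_trans _ DK)// /D lerDl.
have b2 : `|Gtheta g - Gtheta g'| < d.
  rewrite distrC (le_lt_trans _ KD)// (le_trans _ DK)//.
  by rewrite (le_trans (Gtheta_le (g' - g)))// /D lerDr.
have b3 : `|Gxi g - Gxi g'| < d.
  rewrite distrC (le_lt_trans _ KD)// (le_trans _ DK)//.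
  by rewrite (le_trans (Gxi_le (g' - g)))// /D lerDr.
have b4 : `|seg g t - seg g' t'| < d by rewrite distrC (le_lt_trans h1 KD).
have b5 : `|x g (utime g t) - x g' (utime g' t')| < d.
  by rewrite distrC (le_lt_trans h2 KD).
split; [| |exact: le_lt_trans h3 KD|exact: le_lt_trans h4 KD].
- split; [split; [split|]|]; rewrite -ball_normE /=; [exact: b1|exact: b4|exact: b5|exact: b2].
- split; [split|]; rewrite -ball_normE /=; [exact: b1|exact: b4|exact: b3].
Qed.

Lemma cf_curve g : P g -> curve_continuous (cf g) 0 a /\ curve_continuous (ct g) 0 a.
Proof.
move=> Pg; have [K K1 HK] := data_ball.
have K0 : 0 < K by rewrite (lt_le_trans ltr01).
have H t s e : 0 <= t <= a -> 0 <= s <= a -> 0 < e -> `|s - t| <= e / (K + K) ->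
    ball (cf g t) e (cf g s) /\ ball (ct g t) e (ct g s).
  move=> ta sa e0; rewrite ler_pdivlMr ?addr_gt0// mulrDr => st.
  have [|? ? _ _] := HK g g t s e Pg Pg ta sa; last by [].
  rewrite subrr normr0 addr0 mulrC; have := normr_ge0 (s - t) => n0.
  have := mulr_ge0 n0 (ltW K0); move: (_ * K) st => q; lra.
split=> t ta e e0; exists (e / (K + K)); rewrite ?divr_gt0 ?addr_gt0// => s sa st.
  by have [] := H t s e ta sa e0 st.
by have [] := H t s e ta sa e0 st.
Qed.

Lemma xrhs_unif g : P g -> forall e, 0 < e -> exists2 d, 0 < d &
  forall s s', 0 <= s <= a -> 0 <= s' <= a -> `|s - s'| <= d ->
    `|xrhs g s - xrhs g s'| <= e.
Proof.
move=> Pg e e0; have [cc _] := cf_curve Pg.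
have e20 : 0 < e / 2 by rewrite divr_gt0.
have [|||d d0 H] := @curve_unif R (fun d t => forall s, 0 <= s <= a -> `|s - t| <= d ->
    `|xrhs g s - xrhs g t| <= e) 0 a.
- exact: ltW.
- by move=> d d' t dd H s sa sd; apply: H => //; exact: le_trans dd.
- move=> t ta; have [d d0 Hd] := within_eps hf1 (x_f_dom Pg ta) e20.
  have [rho rho0 Hr] := cc t ta d d0.
  exists (rho / 2); first by rewrite divr_gt0.
  exists (rho / 2); first by rewrite divr_gt0.
  have near s : 0 <= s <= a -> `|s - t| <= rho -> `|xrhs g s - xrhs g t| <= e / 2.
    by move=> sa st; exact: (Hd (cf g s) (x_f_dom Pg sa) (Hr _ sa st)).
  move=> s sa st s' sa' ss'.
  rewrite -(subrK (xrhs g t) (xrhs g s')) -addrA (le_trans (ler_normD _ _))//.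
  rewrite [leRHS]splitr lerD ?near//.
    rewrite -(subrK s s') -addrA (le_trans (ler_normD _ _))// [leRHS]splitr.
    exact: lerD.
  by rewrite distrC near// (le_trans st)// ler_pdivrMr// ler_peMr ?ltW//; lra.
by exists d => // s s' sa sa' ss; exact: H.
Qed.

(* Before time [r] the delayed argument may hit points where [x g] is not
   differentiable, hence the exceptional set [E]; after time [r] it is positive
   and [x g] is continuously differentiable there. *)
Lemma x_egorov g e eta : P g -> 0 < e -> 0 < eta -> exists E : set R,
  [/\ measurable E, (mu E <= eta%:E)%E & exists2 d, 0 < d &
  (forall t s, 0 < t < a -> t - r%:num <= s <= t -> (t <= r%:num -> ~ E s) ->
    [/\ hasd (x g) s (derive1 (x g) s), `|derive1 (x g) s| <= N &
      forall s', t - r%:num <= s' <= t -> `|s' - s| <= d ->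
        `|x g s' - x g s - (s' - s) *: derive1 (x g) s| <= e * `|s' - s|]) /\
  (forall t t' s s', 0 < t < a -> 0 < t' < a -> t - r%:num <= s <= t ->
    t' - r%:num <= s' <= t' -> (t <= r%:num) = (t' <= r%:num) ->
    (t <= r%:num -> ~ E s /\ ~ E s') -> `|s - s'| <= d ->
    `|derive1 (x g) s - derive1 (x g) s'| <= e)].
Proof.
move=> Pg e0 eta0; have ra : - r%:num <= a by have := r0; have := a_gt0; lra.
pose X := x g \o itv_proj (- r%:num) a.
have XN s t : `|X s - X t| <= N * `|s - t|.
  by apply: lip_itv_proj => // s' t' sa ta; exact: x_lipschitz.
have [E [mE Ee [d1 d10 [H1 H2]]]] :=
  lip_egorov N_ge0 ra XN (lip_ae_derivable_rvec N_ge0 XN) e0 eta0.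
have [d2 d20 H3] := xrhs_unif Pg e0.
(* Outside [-r, a] the solution is unspecified, so two-sided derivatives at the two ends are not
   controlled. *)
have mab : measurable [set - r%:num; a] by apply: measurableU; exact: measurable_set1.
exists (E `|` [set - r%:num; a]); split; first exact: measurableU.
  apply: mu_setU_null => //.
  exact/countable_lebesgue_measure0/finite_set_countable/finite_set2.
have dX s : - r%:num < s < a -> derivable X s 1 ->
    hasd (x g) s (derive1 X s) /\ derive1 (x g) s = derive1 X s.
  move=> sa /derivable_hasd /(hasd_itv_proj _ _ sa) h.
  by split=> //; exact: hasd_derive1.
have dN s : 0 < s < a -> derive1 (x g) s = xrhs g s.
  by move=> sa; apply/hasd_derive1/x_hasd.
have dX_le s : derivable X s 1 -> `|derive1 X s| <= N.
  by move=> /derivable_hasd; apply: (hasd_le ltr01) => s' _; exact: XN.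
have XE s : - r%:num <= s <= a -> X s = x g s by move=> sa; rewrite /X /= itv_proj_id.
have earlyE t s : 0 < t < a -> t - r%:num <= s <= t -> t <= r%:num ->
    ~ (E `|` [set - r%:num; a]) s -> - r%:num < s < a /\ ~ E s.
  move=> /andP[t0 ta] /andP[s1 s2] tr nE; split; last by move=> Es; apply: nE; left.
  rewrite (le_lt_trans s2 ta) andbT lt_neqAle; apply/andP; split; last by lra.
  by apply/eqP => sE; apply: nE; right; left.
exists (Num.min d1 d2); first by rewrite lt_min d10.
split=> [t s ta ts nE|t t' s s' ta ta' ts ts' tt nE].
  case: (leP t r%:num) nE => [tr /(_ isT) nE|rt _].
    have [sa nEs] := earlyE _ _ ta ts tr nE.
    have sa' : - r%:num <= s <= a by move: sa; lra.
    have [ds Hs] := H1 s sa' nEs; have [h1 h2] := dX s sa ds; rewrite h2.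
    split=> //; first exact: dX_le.
    move=> s' ts'; rewrite le_min => /andP[sd _].
    rewrite -(XE s) // -(XE s'); first exact: Hs.
    by move: ts' ta; lra.
  have sa : 0 < s < a by move: ts ta; lra.
  rewrite dN//; split; first exact: x_hasd.
    have q0 : 0 < Num.min (s - 0) (a - s).
      by rewrite lt_min !subr_gt0; case/andP: sa => -> ->.
    apply: hasd_le q0 _ (x_hasd Pg sa) => y /(near_window sa) ya.
    by apply: x_lipschitz => //; apply: closedW => //; exact: openW.
  move=> s' ts'; rewrite le_min => /andP[_ sd].
  have sa' : 0 < s' < a by move: ts' ta; lra.
  (* Past time r the estimate comes from the mean value inequality: [G] has derivative
     [xrhs g y - xrhs g s], of norm at most [e] near [s]. *)
  pose G y := x g y - y *: xrhs g s.
  have Gle p q : p <= q -> s - d2 <= p -> q <= s + d2 -> 0 < p -> q < a ->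
      `|G q - G p| <= e * (q - p).
    move=> pq p1 q1 p0 qa; apply: mvt_all => //; first exact: ltW.
    move=> y /andP[py yq]; exists (xrhs g y - xrhs g s).
      apply: hasdB (hasd_lin _ _); apply: x_hasd => //.
      by rewrite (lt_le_trans p0 py) (le_lt_trans yq qa).
    apply: H3; rewrite ?ler_norml; [|move: sa|]; lra.
  have -> : x g s' - x g s - (s' - s) *: xrhs g s = G s' - G s by rewrite /G; lmod R.
  move: sd; rewrite ler_norml => /andP[sd1 sd2].
  case: (leP s s') => [ss|/ltW ss].
    rewrite ger0_norm ?subr_ge0//; apply: Gle; move: sa sa' d20; lra.
  rewrite distrC [`|s' - s|]distrC ger0_norm ?subr_ge0//.
  by apply: Gle; move: sa sa' d20; lra.
rewrite le_min => /andP[ss1 ss2].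
case: (leP t r%:num) nE tt => [tr /(_ isT) [nE nE'] /esym tr'|rt _ /esym/negbT].
  have [sa nEs] := earlyE _ _ ta ts tr nE; have [sa' nEs'] := earlyE _ _ ta' ts' tr' nE'.
  have sb : - r%:num <= s <= a by move: sa; lra.
  have sb' : - r%:num <= s' <= a by move: sa'; lra.
  have [ds _] := H1 s sb nEs; have [ds' _] := H1 s' sb' nEs'.
  by have [_ ->] := dX s sa ds; have [_ ->] := dX s' sa' ds'; exact: H2.
rewrite -ltNge => rt'.
rewrite !dN; [|move: ts' ta'; lra|move: ts ta; lra].
by apply: H3 => //; [move: ts ta|move: ts' ta']; lra.
Qed.

(** The cut at [Num.min r%:num a] is the end of the interval on which the piecewise monotonicity of
    the delayed time is known. *)
Definition bad_times g (E : set R) : set R :=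
  [set t | 0 <= t <= Num.min r%:num a /\ E (utime g t)].

Lemma bad_timesP g E t : 0 < t < a -> ~ bad_times g E t -> t <= r%:num -> ~ E (utime g t).
Proof.
move=> /andP[t0 ta] nB tr Et; apply: nB; split=> //.
by rewrite (ltW t0) le_min tr ltW.
Qed.

Lemma bad_times_measurable g E : P g -> measurable E -> measurable (bad_times g E).
Proof.
move=> Pg mE; have [K K1 HK] := data_close.
pose u := utime g \o itv_proj 0 a.
have uK s t : `|u s - u t| <= K * `|s - t|.
  apply: lip_itv_proj => // [||s' t' sa ta]; [exact: ltW|exact: le_trans K1|].
  by have [_ _] := HK g g t' s' Pg Pg ta sa; rewrite subrr normr0 addr0.
have mu_ : measurable_fun setT u.
  by apply: continuous_measurable_fun; exact: (lip_cont uK).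
have := mu_ measurableT E mE; rewrite setTI => mU.
rewrite (_ : bad_times g E = `[0, Num.min r%:num a]%classic `&` u @^-1` E).
  exact: measurableI.
have ma : Num.min r%:num a <= a by rewrite ge_min lexx orbT.
apply/seteqP; split=> t; rewrite /bad_times /= in_itv/= => -[/andP[t0 tm] Et]; split;
  rewrite ?t0//; by move: Et; rewrite /u /= itv_proj_id// t0 (le_trans tm).
Qed.

(** [pm_pullback] applies to every [g'] close to [g], because [utime_diff_lipschitz] makes the
    difference of the two delayed times Lipschitz with constant at most the tolerance [k]. [C] and
    [d] depend on [g] and [eta] but not on [E], so [E] may be chosen after them. *)
Lemma pull_times g : P2 tau P x a g -> forall eta, 0 < eta -> exists C d,
  [/\ 0 <= C, 0 < d & forall g', P g' -> `|g' - g| <= d ->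
    forall (E : set R) m, measurable E -> (mu E <= m%:E)%E ->
    (mu (bad_times g' E) <= (eta + C * m)%:E)%E].
Proof.
move=> [Pg [_ _ [s ps mono]]] eta eta0.
have [K K1 HK] := data_close; have [K' K'0 HK'] := utime_diff_lipschitz.
have ma : Num.min r%:num a <= a by rewrite ge_min lexx orbT.
have uK y z : 0 <= y <= Num.min r%:num a -> 0 <= z <= Num.min r%:num a ->
    `|utime g y - utime g z| <= K * `|y - z|.
  move=> /andP[y0 ya] /andP[z0 za].
  have ya' : 0 <= y <= a by rewrite y0 (le_trans ya).
  have za' : 0 <= z <= a by rewrite z0 (le_trans za).
  by have [_ _] := HK g g z y Pg Pg za' ya'; rewrite subrr normr0 addr0.
have K0 : 0 <= K by exact: le_trans K1.
have [C [k [C0 k0 H]]] := pm_pullback ps K0 uK mono eta0.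
exists C, (k / (K' + 1)); split=> //; first by rewrite divr_gt0// ltr_wpDl.
move=> g' Pg' gg E m mE Em.
apply: (H (utime g') _ E _ m) => //.
- move=> y z /andP[y0 ya] /andP[z0 za].
  have ya' : 0 <= y <= a by rewrite y0 (le_trans ya).
  have za' : 0 <= z <= a by rewrite z0 (le_trans za).
  rewrite (le_trans (HK' g g' Pg Pg' _ _ ya' za'))// ler_wpM2r//.
  move: gg; rewrite ler_pdivlMr ?ltr_wpDl// mulrC => /(le_trans _); apply.
  by rewrite ler_wpM2r// lerDl.
- exact: bad_times_measurable.
Qed.

(** With [m = 0] only [eta] remains, and it is arbitrary. This gives a meaning to the derivative of
    [x g] at the delayed time for almost every t. *)
Lemma bad_times_null g E : P2 tau P x a g -> measurable E -> mu E = 0%E ->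
  mu (bad_times g E) = 0%E.
Proof.
move=> g2 mE E0; have Pg : P g by case: g2.
apply/eqP; rewrite eq_le measure_ge0 andbT; apply/lee_addgt0Pr => eta eta0.
have [C [d [C0 d0 H]]] := pull_times g2 eta0.
have := H g Pg _ E 0 mE _; rewrite subrr normr0 mulr0 addr0 add0e; apply.
  exact: ltW.
by move: E0 => /= ->.
Qed.

(** * Linearisation of f and tau along a solution *)

Local Notation F2 q := (D2f f q.1.1.1 q.1.1.2 q.1.2 q.2).
Local Notation F3 q := (D3f f q.1.1.1 q.1.1.2 q.1.2 q.2).
Local Notation F4 q := (D4f f q.1.1.1 q.1.1.2 q.1.2 q.2).
Local Notation S2 q := (D2tau tau q.1.1 q.1.2 q.2).
Local Notation S3 q := (D3tau tau q.1.1 q.1.2 q.2).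

(** [0, T] is not open on the line, so the time component is kept as a hypothesis; openness is used
    for the other arguments only. *)
Lemma dom_near g : P g -> exists2 d, 0 < d & forall t, 0 <= t <= a ->
  (forall q : R * C * V * Theta, times T q.1.1.1 -> ball (cf g t) d q -> f_dom T O1 O2 O3 q) /\
  (forall q : R * C * Xi, times T q.1.1 -> ball (ct g t) d q -> tau_dom T O1 O4 q).
Proof.
move=> Pg; have [cc cc'] := cf_curve Pg.
apply: (@curve_unif _ (fun d t =>
  (forall q : R * C * V * Theta, times T q.1.1.1 -> ball (cf g t) d q -> f_dom T O1 O2 O3 q) /\
  (forall q : R * C * Xi, times T q.1.1 -> ball (ct g t) d q -> tau_dom T O1 O4 q))).
- exact: ltW.
- move=> d d' t dd [H1 H2]; split=> q tq bq; [apply: H1|apply: H2] => //; exact: le_ball bq.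
move=> t ta; have [_ o1 o2 o3] := x_f_dom Pg ta; have [_ _ o4] := x_tau_dom Pg ta.
have /nbhs_ballP[d1 /= d10 B1] := open_nbhs_nbhs (conj openO1 o1).
have /nbhs_ballP[d2 /= d20 B2] := open_nbhs_nbhs (conj openO2 o2).
have /nbhs_ballP[d3 /= d30 B3] := open_nbhs_nbhs (conj openO3 o3).
have /nbhs_ballP[d4 /= d40 B4] := open_nbhs_nbhs (conj openO4 o4).
pose d := Num.min (Num.min d1 d2) (Num.min d3 d4).
have d0 : 0 < d by rewrite !lt_min d10 d20 d30.
have le1 : d <= d1 by rewrite !ge_min lexx.
have le2 : d <= d2 by rewrite !ge_min lexx orbT.
have le3 : d <= d3 by rewrite !ge_min lexx !orbT.
have le4 : d <= d4 by rewrite !ge_min lexx !orbT.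
have dh0 : 0 < d / 2 by rewrite divr_gt0.
have [rho rho0 Hr] := cc t ta _ dh0; have [rho' rho'0 Hr'] := cc' t ta _ dh0.
exists (d / 2) => //; exists (Num.min rho rho'); first by rewrite lt_min rho0.
move=> s sa; rewrite le_min => /andP[sr sr']; split=> q tq bq.
  have [[[_ b1] b2] b3] := ball_split (Hr _ sa sr) bq.
  split=> //; [apply: B1; exact: (le_ball le1 b1)|apply: B2; exact: (le_ball le2 b2)|
    apply: B3; exact: (le_ball le3 b3)].
have [[_ b1] b3] := ball_split (Hr' _ sa sr') bq.
by split=> //; [apply: B1; exact: (le_ball le1 b1)|apply: B4; exact: (le_ball le4 b3)].
Qed.

Lemma F2Z q (k : R) h : F2 q (k *: h) = k *: F2 q h. Proof. exact: linearZ. Qed.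
Lemma F3Z q (k : R) h : F3 q (k *: h) = k *: F3 q h. Proof. exact: linearZ. Qed.
Lemma F4Z q (k : R) h : F4 q (k *: h) = k *: F4 q h. Proof. exact: linearZ. Qed.
Lemma S2Z q (k : R) h : S2 q (k *: h) = k *: S2 q h. Proof. exact: linearZ. Qed.
Lemma S3Z q (k : R) h : S3 q (k *: h) = k *: S3 q h. Proof. exact: linearZ. Qed.

(** Only partial derivatives are given, so the increment is telescoped one argument at a time. On
    each leg the partial derivative stays within [e] of its value on the curve, uniformly in t by
    [op_curve_unif]. *)
Lemma f_lin g e : P g -> 0 < e -> exists2 d, 0 < d & forall t, 0 <= t <= a ->
  forall psi v theta, ball (cf g t) d (t, psi, v, theta) ->
  `|f t psi v theta - xrhs g t - (F2 (cf g t) (psi - seg g t) +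
     F3 (cf g t) (v - x g (utime g t)) + F4 (cf g t) (theta - Gtheta g))| <=
  e * (`|psi - seg g t| + `|v - x g (utime g t)| + `|theta - Gtheta g|).
Proof.
move=> Pg e0; have [cc _] := cf_curve Pg.
have [d0 d00 H0] := dom_near Pg.
have fd t : 0 <= t <= a -> f_dom T O1 O2 O3 (cf g t) by exact: x_f_dom.
case: hf3 => dfs c2 c3 c4.
have [d2 d20 H2] := op_curve_unif (ltW a_gt0) c2 F2Z cc fd e0.
have [d3 d30 H3] := op_curve_unif (ltW a_gt0) c3 F3Z cc fd e0.
have [d4 d40 H4] := op_curve_unif (ltW a_gt0) c4 F4Z cc fd e0.
pose d := Num.min (Num.min d0 d2) (Num.min d3 d4).
exists d; first by rewrite !lt_min d00 d20 d30.
have le0 : d <= d0 by rewrite !ge_min lexx.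
have le2 : d <= d2 by rewrite !ge_min lexx orbT.
have le3 : d <= d3 by rewrite !ge_min lexx !orbT.
have le4 : d <= d4 by rewrite !ge_min lexx !orbT.
move=> t ta psi v theta [[[bt b1] b2] b3]; have tt := times_a ta.
set p1 := seg g t in b1 *; set p2 := x g (utime g t) in b2 *; set p3 := Gtheta g in b3 *.
have d_gt0 : 0 < d by rewrite !lt_min d00 d20 d30.
have dom q1 q2 q3 : ball p1 d q1 -> ball p2 d q2 -> ball p3 d q3 ->
    ball (cf g t) d (t, q1, q2, q3) /\ f_dom T O1 O2 O3 (t, q1, q2, q3).
  move=> h1 h2 h3; have B : ball (cf g t) d (t, q1, q2, q3).
    by split; [split; [split|]|] => //; exact: ballxx.
  by split=> //; apply: (H0 t ta).1 => //; exact: le_ball B.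
have s1 : `|f t psi v theta - f t p1 v theta - F2 (cf g t) (psi - p1)| <= e * `|psi - p1|.
  have := @diff_mvt R _ _ (fun psi' => f t psi' v theta) p1 (psi - p1)
    (F2 (cf g t) (psi - p1)) (e * `|psi - p1|).
  rewrite [p1 + _]addrC subrK; apply => [|s s01|s s01].
  - by rewrite mulr_ge0// ltW.
  - by have [_ D] := dom _ _ _ (ball_step s01 b1) b2 b3; have [+ _ _] := dfs _ D.
  - have [B D] := dom _ _ _ (ball_step s01 b1) b2 b3.
    exact: (H2 t ta _ D (le_ball le2 B)).
have s2 : `|f t p1 v theta - f t p1 p2 theta - F3 (cf g t) (v - p2)| <= e * `|v - p2|.
  have := @diff_mvt R _ _ (fun v' => f t p1 v' theta) p2 (v - p2)
    (F3 (cf g t) (v - p2)) (e * `|v - p2|).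
  rewrite [p2 + _]addrC subrK; apply => [|s s01|s s01].
  - by rewrite mulr_ge0// ltW.
  - have [_ D] := dom _ _ _ (ballxx p1 d_gt0) (ball_step s01 b2) b3.
    by have [_ + _] := dfs _ D.
  - have [B D] := dom _ _ _ (ballxx p1 d_gt0) (ball_step s01 b2) b3.
    exact: (H3 t ta _ D (le_ball le3 B)).
have s3 : `|f t p1 p2 theta - f t p1 p2 p3 - F4 (cf g t) (theta - p3)| <= e * `|theta - p3|.
  have := @diff_mvt R _ _ (fun th' => f t p1 p2 th') p3 (theta - p3)
    (F4 (cf g t) (theta - p3)) (e * `|theta - p3|).
  rewrite [p3 + _]addrC subrK; apply => [|s s01|s s01].
  - by rewrite mulr_ge0// ltW.
  - have [_ D] := dom _ _ _ (ballxx p1 d_gt0) (ballxx p2 d_gt0) (ball_step s01 b3).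
    by have [_ _ +] := dfs _ D.
  - have [B D] := dom _ _ _ (ballxx p1 d_gt0) (ballxx p2 d_gt0) (ball_step s01 b3).
    exact: (H4 t ta _ D (le_ball le4 B)).
rewrite /xrhs -/p1 -/p2 -/p3.
move: s1 s2 s3; set A2 := F2 _ _; set A3 := F3 _ _; set A4 := F4 _ _ => s1 s2 s3.
have -> : f t psi v theta - f t p1 p2 p3 - (A2 + A3 + A4) =
  (f t psi v theta - f t p1 v theta - A2) + (f t p1 v theta - f t p1 p2 theta - A3) +
  (f t p1 p2 theta - f t p1 p2 p3 - A4) by lmod R.
rewrite (le_trans (ler_normD _ _))// mulrDr lerD// mulrDr.
by rewrite (le_trans (ler_normD _ _))// lerD.
Qed.

Lemma tau_lin g e : P g -> 0 < e -> exists2 d, 0 < d & forall t, 0 <= t <= a ->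
  forall psi xi, ball (ct g t) d (t, psi, xi) ->
  `|tau t psi xi - tau t (seg g t) (Gxi g) - (S2 (ct g t) (psi - seg g t) +
     S3 (ct g t) (xi - Gxi g))| <= e * (`|psi - seg g t| + `|xi - Gxi g|).
Proof.
move=> Pg e0; have [_ cc] := cf_curve Pg.
have [d0 d00 H0] := dom_near Pg.
have fd t : 0 <= t <= a -> tau_dom T O1 O4 (ct g t) by exact: x_tau_dom.
case: htau3 => dfs c2 c3.
have [d2 d20 H2] := @op_curve_unif R _ _ R _ _ _ _ _ (ltW a_gt0) c2 S2Z cc fd _ e0.
have [d3 d30 H3] := @op_curve_unif R _ _ R _ _ _ _ _ (ltW a_gt0) c3 S3Z cc fd _ e0.
pose d := Num.min d0 (Num.min d2 d3).
have d_gt0 : 0 < d by rewrite !lt_min d00 d20 d30.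
exists d => //.
have le0 : d <= d0 by rewrite !ge_min lexx.
have le2 : d <= d2 by rewrite !ge_min lexx !orbT.
have le3 : d <= d3 by rewrite !ge_min lexx !orbT.
move=> t ta psi xi [[bt b1] b3]; have tt := times_a ta.
set p1 := seg g t in b1 *; set p3 := Gxi g in b3 *.
have dom q1 q3 : ball p1 d q1 -> ball p3 d q3 ->
    ball (ct g t) d (t, q1, q3) /\ tau_dom T O1 O4 (t, q1, q3).
  move=> h1 h3; have B : ball (ct g t) d (t, q1, q3).
    by split; [split|] => //; exact: ballxx.
  by split=> //; apply: (H0 t ta).2 => //; exact: le_ball B.
have s1 : `|tau t psi xi - tau t p1 xi - S2 (ct g t) (psi - p1)| <= e * `|psi - p1|.
  have := @diff_mvt R _ R (fun psi' => tau t psi' xi) p1 (psi - p1)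
    (S2 (ct g t) (psi - p1)) (e * `|psi - p1|).
  rewrite [p1 + _]addrC subrK; apply => [|s s01|s s01].
  - by rewrite mulr_ge0// ltW.
  - by have [_ D] := dom _ _ (ball_step s01 b1) b3; have [+ _] := dfs _ D.
  - have [B D] := dom _ _ (ball_step s01 b1) b3.
    exact: (H2 t ta _ D (le_ball le2 B)).
have s3 : `|tau t p1 xi - tau t p1 p3 - S3 (ct g t) (xi - p3)| <= e * `|xi - p3|.
  have := @diff_mvt R _ R (fun xi' => tau t p1 xi') p3 (xi - p3)
    (S3 (ct g t) (xi - p3)) (e * `|xi - p3|).
  rewrite [p3 + _]addrC subrK; apply => [|s s01|s s01].
  - by rewrite mulr_ge0// ltW.
  - by have [_ D] := dom _ _ (ballxx p1 d_gt0) (ball_step s01 b3); have [_ +] := dfs _ D.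
  - have [B D] := dom _ _ (ballxx p1 d_gt0) (ball_step s01 b3).
    exact: (H3 t ta _ D (le_ball le3 B)).
move: s1 s3; set A2 := S2 _ _; set A3 := S3 _ _ => s1 s3.
have -> : tau t psi xi - tau t p1 p3 - (A2 + A3) =
  (tau t psi xi - tau t p1 xi - A2) + (tau t p1 xi - tau t p1 p3 - A3) by ring.
by rewrite (le_trans (ler_normD _ _))// mulrDr lerD.
Qed.

Lemma op_bounds g : P g -> exists2 K, 0 <= K & forall t, 0 <= t <= a ->
  [/\ forall h, `|F2 (cf g t) h| <= K * `|h|, forall h, `|F3 (cf g t) h| <= K * `|h|,
      forall h, `|F4 (cf g t) h| <= K * `|h|, forall h, `|S2 (ct g t) h| <= K * `|h| &
      forall h, `|S3 (ct g t) h| <= K * `|h|].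
Proof.
move=> Pg; have [cc cc'] := cf_curve Pg.
have fd t : 0 <= t <= a -> f_dom T O1 O2 O3 (cf g t) by exact: x_f_dom.
have td t : 0 <= t <= a -> tau_dom T O1 O4 (ct g t) by exact: x_tau_dom.
case: hf3 => dfs c2 c3 c4; case: htau3 => dts e2 e3.
have [|k2 k20 H2] := op_curve_bounded (ltW a_gt0) c2 F2Z cc fd.
  by move=> p /dfs[d _ _]; exact: diff_bounded.
have [|k3 k30 H3] := op_curve_bounded (ltW a_gt0) c3 F3Z cc fd.
  by move=> p /dfs[_ d _]; exact: diff_bounded.
have [|k4 k40 H4] := op_curve_bounded (ltW a_gt0) c4 F4Z cc fd.
  by move=> p /dfs[_ _ d]; exact: diff_bounded.
have [|k5 k50 H5] := @op_curve_bounded R _ _ R _ _ _ _ _ (ltW a_gt0) e2 S2Z cc' td.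
  by move=> p /dts[d _]; exact: diff_bounded.
have [|k6 k60 H6] := @op_curve_bounded R _ _ R _ _ _ _ _ (ltW a_gt0) e3 S3Z cc' td.
  by move=> p /dts[_ d]; exact: diff_bounded.
exists (k2 + k3 + k4 + k5 + k6); first by rewrite !addr_ge0.
have w (k z A : R) : 0 <= z -> k <= k2 + k3 + k4 + k5 + k6 -> A <= k * z ->
    A <= (k2 + k3 + k4 + k5 + k6) * z.
  by move=> z0 kk /le_trans; apply; rewrite ler_wpM2r.
move=> t ta; split=> h.
- by apply: w (H2 t ta h) => //; lra.
- by apply: w (H3 t ta h) => //; lra.
- by apply: w (H4 t ta h) => //; lra.
- by apply: w (H5 t ta h) => //; lra.
- by apply: w (H6 t ta h) => //; lra.
Qed.

(** The variational operator with its base points [q], [qt] and the value [p] of x'(u(t)) as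
    independent parameters, so that two times, or two parameters g, can be compared. *)
Definition vop (q : R * C * V * Theta) (qt : R * C * Xi) (p : V)
    (hphi : C) (hth : Theta) (hxi : Xi) : V :=
  F2 q hphi + F4 q hth
  + F3 q (- ((S2 qt hphi + S3 qt hxi) *: p) + hphi (- tau qt.1.1 qt.1.2 qt.2)).

Local Notation dx g t := (derive1 (x g) (utime g t)).
Local Notation VO g t := (vop (cf g t) (ct g t) (dx g t)).

Lemma variational_opE g t hphi hth hxi :
  variational_op f tau g (x g) t hphi hth hxi = VO g t hphi hth hxi.
Proof. by []. Qed.

Lemma vop_linear q qt p (k : R) h1 h2 t1 t2 x1 x2 :
  vop q qt p (k *: h1 + h2) (k *: t1 + t2) (k *: x1 + x2) =
  k *: vop q qt p h1 t1 x1 + vop q qt p h2 t2 x2.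
Proof.
rewrite /vop.
have -> : F2 q (k *: h1 + h2) = k *: F2 q h1 + F2 q h2 by exact: linearP.
have -> : F4 q (k *: t1 + t2) = k *: F4 q t1 + F4 q t2 by exact: linearP.
have -> : S2 qt (k *: h1 + h2) = k * S2 qt h1 + S2 qt h2 by exact: linearP.
have -> : S3 qt (k *: x1 + x2) = k * S3 qt x1 + S3 qt x2 by exact: linearP.
set s := - tau _ _ _.
have -> : (k *: h1 + h2) s = k *: h1 s + h2 s by [].
set w1 := - ((S2 qt h1 + S3 qt x1) *: p) + h1 s.
set w2 := - ((S2 qt h2 + S3 qt x2) *: p) + h2 s.
rewrite (_ : - _ + _ = k *: w1 + w2); last by rewrite /w1 /w2; lmod R.
have -> : F3 q (k *: w1 + w2) = k *: F3 q w1 + F3 q w2 by exact: linearP.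
by lmod R.
Qed.

Lemma vopB q qt p h1 h2 t1 t2 x1 x2 :
  vop q qt p (h1 - h2) (t1 - t2) (x1 - x2) = vop q qt p h1 t1 x1 - vop q qt p h2 t2 x2.
Proof.
have := vop_linear q qt p (- 1) h2 h1 t2 t1 x2 x1.
by rewrite !scaleN1r ![- _ + _]addrC.
Qed.

Lemma vopZ q qt p (k : R) h1 t1 x1 :
  vop q qt p (k *: h1) (k *: t1) (k *: x1) = k *: vop q qt p h1 t1 x1.
Proof.
have := vop_linear q qt p k h1 0 t1 0 x1 0; rewrite !addr0 => ->.
have := vopB q qt p h1 h1 t1 t1 x1 x1; rewrite !subrr => ->.
by rewrite addr0.
Qed.

Lemma vop_bound g : P g -> exists2 K, 0 <= K & forall t p, 0 <= t <= a -> `|p| <= N ->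
  forall h th xi, `|vop (cf g t) (ct g t) p h th xi| <= K * (`|h| + `|th| + `|xi|).
Proof.
move=> Pg; have [K K0 HK] := op_bounds Pg.
exists (K + K * (K * N + 1)); first by rewrite addr_ge0// mulr_ge0// addr_ge0// mulr_ge0.
move=> t p ta pN h th xi; have [b2 b3 b4 e2 e3] := HK t ta.
rewrite /vop; set w := _ + h _; set H := `|h| + `|th| + `|xi|.
have hH : `|h| <= H by rewrite /H -addrA lerDl addr_ge0.
have hxH : `|h| + `|xi| <= H by rewrite /H addrAC lerDl.
have htH : `|h| + `|th| <= H by rewrite /H lerDl.
have H0 : 0 <= H by rewrite !addr_ge0.
have sH : `|S2 (ct g t) h + S3 (ct g t) xi| <= K * H.
  rewrite (le_trans (ler_normD _ _))// (le_trans (lerD (e2 h) (e3 xi)))//.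
  by rewrite -mulrDr ler_wpM2l.
have wH : `|w| <= (K * N + 1) * H.
  rewrite (le_trans (ler_normD _ _))// mulrDl mul1r lerD//.
    by rewrite normrN normrZ mulrAC ler_pM.
  by rewrite (le_trans (Cnorm_ub _ _)).
rewrite (le_trans (ler_normD _ _))// mulrDl lerD//.
  rewrite (le_trans (ler_normD _ _))// (le_trans (lerD (b2 h) (b4 th)))//.
  by rewrite -mulrDr ler_wpM2l.
by rewrite (le_trans (b3 w))// -mulrA ler_wpM2l.
Qed.

(** Evaluation at a moving point is not continuous in operator norm on C. The last term of the bound
    isolates this defect; it is small once [h] is a Lipschitz segment, as it is in every
    application. *)
Lemma vop_compare g : P g -> exists2 K, 0 <= K & forall e, 0 < e ->
  exists2 d, 0 < d & forall t, 0 <= t <= a -> forall q qt p p',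
    f_dom T O1 O2 O3 q -> tau_dom T O1 O4 qt -> ball (cf g t) d q -> ball (ct g t) d qt ->
    `|p| <= N -> `|p' - p| <= d -> forall h th xi,
    `|vop q qt p' h th xi - vop (cf g t) (ct g t) p h th xi| <=
    e * (`|h| + `|th| + `|xi|) +
    K * `|h (- tau qt.1.1 qt.1.2 qt.2) - h (- tau t (seg g t) (Gxi g))|.
Proof.
move=> Pg; have [K K0 HK] := op_bounds Pg; exists K => // e e0.
have [cc cc'] := cf_curve Pg.
have fd t : 0 <= t <= a -> f_dom T O1 O2 O3 (cf g t) by exact: x_f_dom.
have td t : 0 <= t <= a -> tau_dom T O1 O4 (ct g t) by exact: x_tau_dom.
(* The three summands come from D2f and D4f, from the change of D3f on the perturbed argument [w'],
   and from D3f applied to [w' - w]. The condition [e1 <= 1] keeps the perturbed bounds below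
   [K + 1] and [N + 1]. *)
pose k := 1 + ((K + 1) * (N + 1) + 1) + K * (N + 1 + K).
have k0 : 0 < k.
  by rewrite ltr_wpDr ?mulr_ge0 ?addr_ge0// ltr_wpDr// addr_ge0// mulr_ge0// addr_ge0.
have [e1 [e10 e1k e11]] : exists e1, [/\ 0 < e1, e1 * k <= e & e1 <= 1].
  exists (Num.min 1 (e / k)); split; rewrite ?lt_min ?ltr01 ?divr_gt0 ?ge_min ?lexx//.
  by rewrite -ler_pdivlMr// ge_min lexx orbT.
case: hf3 => dfs c2 c3 c4; case: htau3 => dts s2 s3.
have [d2 d20 H2] := op_curve_unif (ltW a_gt0) c2 F2Z cc fd e10.
have [d3 d30 H3] := op_curve_unif (ltW a_gt0) c3 F3Z cc fd e10.
have [d4 d40 H4] := op_curve_unif (ltW a_gt0) c4 F4Z cc fd e10.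
have [d5 d50 H5] := @op_curve_unif R _ _ R _ _ _ _ _ (ltW a_gt0) s2 S2Z cc' td _ e10.
have [d6 d60 H6] := @op_curve_unif R _ _ R _ _ _ _ _ (ltW a_gt0) s3 S3Z cc' td _ e10.
pose d := Num.min (Num.min (Num.min d2 d3) (Num.min d4 d5)) (Num.min d6 e1).
exists d; first by rewrite !lt_min d20 d30 d40 d50 d60 e10.
have le2 : d <= d2 by rewrite !ge_min lexx.
have le3 : d <= d3 by rewrite !ge_min lexx !orbT.
have le4 : d <= d4 by rewrite !ge_min lexx !orbT.
have le5 : d <= d5 by rewrite !ge_min lexx !orbT.
have le6 : d <= d6 by rewrite !ge_min lexx !orbT.
have le7 : d <= e1 by rewrite !ge_min lexx !orbT.
move=> t ta q qt p p' Dq Dqt bq bqt pN pp h th xi.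
have {}H2 := H2 t ta q Dq (le_ball le2 bq); have {}H3 := H3 t ta q Dq (le_ball le3 bq).
have {}H4 := H4 t ta q Dq (le_ball le4 bq); have {}H5 := H5 t ta qt Dqt (le_ball le5 bqt).
have {}H6 := H6 t ta qt Dqt (le_ball le6 bqt).
have [b2 b3 b4 b5 b6] := HK t ta.
have pe : `|p' - p| <= e1 by exact: le_trans le7.
have p'N : `|p'| <= N + 1.
  by rewrite -(subrK p p') addrC (le_trans (ler_normD _ _))// lerD// (le_trans pe).
set H := `|h| + `|th| + `|xi|.
have hH : `|h| <= H by rewrite /H -addrA lerDl addr_ge0.
have hxH : `|h| + `|xi| <= H by rewrite /H addrAC lerDl.
have htH : `|h| + `|th| <= H by rewrite /H lerDl.
have Hge : 0 <= H by rewrite !addr_ge0.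
rewrite /vop; set hu' := h (- tau qt.1.1 _ _); set hu := h (- tau _ (seg g t) _).
set s' := S2 qt h + S3 qt xi; set s := S2 (ct g t) h + S3 (ct g t) xi.
set w' := - (s' *: p') + hu'; set w := - (s *: p) + hu.
have ss : `|s' - s| <= e1 * H.
  have -> : s' - s = (S2 qt h - S2 (ct g t) h) + (S3 qt xi - S3 (ct g t) xi).
    by rewrite opprD addrACA.
  rewrite (le_trans (ler_normD _ _))// (le_trans (lerD (H5 h) (H6 xi)))//.
  by rewrite -mulrDr ler_wpM2l// ltW.
have sK : `|s| <= K * H.
  rewrite (le_trans (ler_normD _ _))// (le_trans (lerD (b5 h) (b6 xi)))//.
  by rewrite -mulrDr ler_wpM2l.
have s'K : `|s'| <= (K + 1) * H.
  rewrite -(subrK s s') addrC (le_trans (ler_normD _ _))// mulrDl lerD//.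
  by rewrite (le_trans ss)// ler_wpM2r.
have w'K : `|w'| <= ((K + 1) * (N + 1) + 1) * H.
  rewrite (le_trans (ler_normD _ _))// [leRHS]mulrDl mul1r lerD//.
    by rewrite normrN normrZ mulrAC ler_pM.
  by rewrite (le_trans (Cnorm_ub _ _)).
have ww : `|w' - w| <= e1 * (N + 1 + K) * H + `|hu' - hu|.
  have -> : w' - w = - ((s' - s) *: p' + s *: (p' - p)) + (hu' - hu).
    by rewrite /w /w'; lmod R.
  rewrite (le_trans (ler_normD _ _))// lerD2r normrN.
  rewrite (_ : e1 * (N + 1 + K) * H = (e1 * H) * (N + 1) + (K * H) * e1); last by ring.
  by rewrite (le_trans (ler_normD _ _))// !normrZ lerD// ler_pM.
have -> : F2 q h + F4 q th + F3 q w' - (F2 (cf g t) h + F4 (cf g t) th + F3 (cf g t) w) =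
  ((F2 q h - F2 (cf g t) h) + (F4 q th - F4 (cf g t) th)) +
  ((F3 q w' - F3 (cf g t) w') + F3 (cf g t) (w' - w)).
  have -> : F3 (cf g t) (w' - w) = F3 (cf g t) w' - F3 (cf g t) w by exact: linearB.
  by lmod R.
have r1 : `|(F2 q h - F2 (cf g t) h) + (F4 q th - F4 (cf g t) th)| <= e1 * H.
  rewrite (le_trans (ler_normD _ _))// (le_trans (lerD (H2 h) (H4 th)))//.
  by rewrite -mulrDr ler_wpM2l// ltW.
have r2 : `|F3 q w' - F3 (cf g t) w'| <= e1 * (((K + 1) * (N + 1) + 1) * H).
  by rewrite (le_trans (H3 w'))// ler_wpM2l// ltW.
have r3 : `|F3 (cf g t) (w' - w)| <= K * (e1 * (N + 1 + K) * H) + K * `|hu' - hu|.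
  by rewrite (le_trans (b3 _))// -mulrDr ler_wpM2l.
rewrite (le_trans (ler_normD _ _))// (le_trans (lerD r1 (ler_normD _ _)))//.
rewrite (le_trans (lerD (lexx _) (lerD r2 r3)))//.
rewrite [leLHS](_ : _ = e1 * k * H + K * `|hu' - hu|); last by rewrite /k; ring.
by rewrite lerD2r ler_wpM2r.
Qed.

(** Off [B] three facts hold with one radius: x'(u(t)) exists and is bounded, the increment of the
    right-hand side is linearised up to e |g' - g|, and x'(u(t)) varies little between times on the
    same side of r. The last fact serves to pass to the limit at density points. *)
Lemma key_estimate g e : P2 tau P x a g -> 0 < e -> exists d B,
  [/\ 0 < d, measurable B, (mu B <= e%:E)%E &
  [/\ forall t, 0 < t < a -> ~ B t -> `|dx g t| <= N,
      forall g', P g' -> `|g' - g| <= d -> forall t, 0 < t < a -> ~ B t ->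
        `|xrhs g' t - xrhs g t -
          VO g t (seg g' t - seg g t) (Gtheta g' - Gtheta g) (Gxi g' - Gxi g)|
        <= e * `|g' - g| &
      forall t t', 0 < t < a -> 0 < t' < a -> ~ B t -> ~ B t' ->
        (t <= r%:num) = (t' <= r%:num) -> `|utime g t - utime g t'| <= d ->
        `|dx g t - dx g t'| <= e]].
Proof.
move=> g2 e0; have Pg : P g by case: g2.
have [K K0 HK] := op_bounds Pg; have [Kd Kd1 HKd] := data_close.
have [Kb Kb1 HKb] := data_ball.
have Kd0 : 0 <= Kd by exact: le_trans Kd1.
have Kb0 : 0 < Kb by exact: lt_le_trans Kb1.
pose k := 1 + (Kd + Kd + 1) + K * (L * Kd + Kd + (Kd + 1) * N).
have k1 : 1 <= k by rewrite /k -addrA lerDl !addr_ge0// mulr_ge0// !addr_ge0// mulr_ge0// addr_ge0.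
have k0 : 0 < k by exact: lt_le_trans k1.
pose e1 := e / k; have e10 : 0 < e1 by rewrite divr_gt0.
have e1k : e1 * k = e by rewrite divfK// gt_eqF.
have e1e : e1 <= e by rewrite -e1k ler_peMr// ltW.
have e20 : 0 < e / 2 by rewrite divr_gt0.
(* Half of [e] pays for the neighbourhoods of the mesh points; [E] is then taken so small that [Cp]
   times its measure fits into the other half. *)
have [Cp [dp [Cp0 dp0 Hp]]] := pull_times g2 e20.
have Cp10 : 0 < Cp + 1 by rewrite ltr_wpDl.
have eta0 : 0 < e / 2 / (Cp + 1) by rewrite divr_gt0.
have [E [mE Ee [de de0 [E1 E2]]]] := x_egorov Pg e10 eta0.
have [df df0 Hf] := f_lin Pg e10; have [dt dt0 Ht] := tau_lin Pg e10.
pose d := Num.min (Num.min e1 (de / Kd)) (Num.min (df / (Kb + Kb)) (dt / (Kb + Kb))).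
have Kdg : 0 < Kd by exact: lt_le_trans Kd1.
have Kb2 : 0 < Kb + Kb by rewrite addr_gt0.
have d0 : 0 < d by rewrite !lt_min e10 !divr_gt0.
have l1 : d <= e1 by rewrite !ge_min lexx.
have l2 : d <= de / Kd by rewrite !ge_min lexx !orbT.
have l3 : d <= df / (Kb + Kb) by rewrite !ge_min lexx !orbT.
have l4 : d <= dt / (Kb + Kb) by rewrite !ge_min lexx !orbT.
have l5 : d <= de.
  by rewrite (le_trans l2)// ler_pdivrMr// ler_peMr// ltW.
exists d, (bad_times g E); split=> //.
- exact: bad_times_measurable.
- rewrite (le_trans (Hp g Pg _ E _ mE Ee)) ?subrr ?normr0 ?(ltW dp0)// lee_fin.
  exact: half_budget.
have nE t : 0 < t < a -> ~ bad_times g E t -> t <= r%:num -> ~ E (utime g t).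
  by move=> ta; exact: bad_timesP.
have wk := openW.
split.
- move=> t ta nB.
  by have [_ ? _] := E1 t (utime g t) ta (utime_range Pg (wk _ ta)) (nE t ta nB).
- move=> g' Pg' gg t ta nB; have ta' := wk _ ta.
  have ur := utime_range Pg ta'; have ur' := utime_range Pg' ta'.
  have [dxh pN Eu] := E1 t (utime g t) ta ur (nE t ta nB).
  have /= := HKd g g' t t Pg Pg' ta' ta'; rewrite subrr normr0 add0r.
  set D := `|g' - g| => -[c1 c2 c3 c4].
  have D0 : 0 <= D by exact: normr_ge0.
  have KbD dd : D <= dd / (Kb + Kb) -> 0 < dd -> Kb * (`|t - t| + `|g' - g|) < dd.
    by rewrite subrr normr0 add0r => Dd dd0; exact: lt_of_half.
  have [bf _ _ _] := HKb g g' t t df Pg Pg' ta' ta' (KbD _ (le_trans gg l3) df0).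
  have [_ bt _ _] := HKb g g' t t dt Pg Pg' ta' ta' (KbD _ (le_trans gg l4) dt0).
  have {}Hf := Hf t ta' _ _ _ bf; have {}Ht := Ht t ta' _ _ bt.
  have {}Eu := Eu (utime g' t) ur'.
  have {}Eu : `|x g (utime g' t) - x g (utime g t) - (utime g' t - utime g t) *: dx g t|
      <= e1 * (Kd * D).
    rewrite (le_trans (Eu _))//.
      rewrite (le_trans c3)// -ler_pdivlMl// mulrC; exact: le_trans gg l2.
    by rewrite ler_wpM2l// ltW.
  have [b2 b3 b4 _ _] := HK t ta'.
  have cth : `|Gtheta g' - Gtheta g| <= D by exact: (Gtheta_le (g' - g)).
  have cxi : `|Gxi g' - Gxi g| <= D by exact: (Gxi_le (g' - g)).
  rewrite -/(xrhs g' t) in Hf.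
  move: Hf Ht; rewrite /vop.
  set dpsi := seg g' t - seg g t; set dv := x g' _ - x g _.
  set dth := Gtheta g' - _; set dxi := Gxi g' - _ => Hf Ht.
  set S := S2 _ _ + S3 _ _ in Ht *.
  set w := - (S *: dx g t) + _.
  have {}Hf : `|xrhs g' t - xrhs g t - (F2 (cf g t) dpsi + F3 (cf g t) dv + F4 (cf g t) dth)|
      <= e1 * ((Kd + Kd + 1) * D).
    rewrite (le_trans Hf)// ler_wpM2l ?(ltW e10)// !mulrDl mul1r.
    exact: lerD (lerD c1 c2) cth.
  have {}Ht : `|utime g' t - utime g t + S| <= e1 * ((Kd + 1) * D).
    rewrite (_ : _ + S = - (tau t (seg g' t) (Gxi g') - tau t (seg g t) (Gxi g) - S)).
      rewrite normrN (le_trans Ht)// ler_wpM2l ?(ltW e10)// mulrDl mul1r.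
      exact: lerD c1 cxi.
    by rewrite /utime /delayed_time; ring.
  have yu : `|(x g' (utime g' t) - x g (utime g' t)) - (x g' (utime g t) - x g (utime g t))|
      <= L * Kd * D * e1.
    rewrite (le_trans (xdiff_lipschitz Pg Pg' (window_itv ta' ur') (window_itv ta' ur)))//.
    rewrite -/D (le_trans (ler_wpM2l _ c3)) ?mulr_ge0//.
    rewrite (_ : L * D * (Kd * D) = L * Kd * D * D); last by ring.
    by rewrite ler_wpM2l ?mulr_ge0// (le_trans gg).
  have yE : dpsi (- tau t (seg g t) (Gxi g)) = x g' (utime g t) - x g (utime g t).
    rewrite (_ : - tau _ _ _ = utime g t - t); last by rewrite /utime /delayed_time; ring.
    change (seg g' t (utime g t - t) - seg g t (utime g t - t) =
      x g' (utime g t) - x g (utime g t)).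
    by rewrite !(seg_at_sub (x_cont _) ta').
  have dvw : `|dv - w| <= L * Kd * D * e1 + (e1 * (Kd * D) + e1 * ((Kd + 1) * D) * N).
    (* With y = x g' - x g, u' = [utime g' t] and S the linearised delay, this splits into y(u') -
       y(u), quadratic in [D]; the Taylor remainder of x at u, controlled off [E]; and (u' - u + S)
       x'(u), controlled by [tau_lin]. *)
    rewrite (_ : dv - w = ((x g' (utime g' t) - x g (utime g' t)) - (x g' (utime g t) - x g (utime g t))) +
      ((x g (utime g' t) - x g (utime g t) - (utime g' t - utime g t) *: dx g t) +
       (utime g' t - utime g t + S) *: dx g t)); last first.
      by rewrite /w /dv yE; lmod R.
    rewrite (le_trans (ler_normD _ _))// lerD// (le_trans (ler_normD _ _))// lerD//.
    by rewrite normrZ ler_pM.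
  have -> : xrhs g' t - xrhs g t - (F2 (cf g t) dpsi + F4 (cf g t) dth + F3 (cf g t) w) =
    (xrhs g' t - xrhs g t - (F2 (cf g t) dpsi + F3 (cf g t) dv + F4 (cf g t) dth)) +
    F3 (cf g t) (dv - w).
    have -> : F3 (cf g t) (dv - w) = F3 (cf g t) dv - F3 (cf g t) w by exact: linearB.
    by lmod R.
  rewrite (le_trans (ler_normD _ _))//.
  rewrite (le_trans (lerD Hf (le_trans (b3 _) (ler_wpM2l K0 dvw))))//.
  rewrite [leLHS](_ : _ = e1 * (k - 1) * D); last by rewrite /k; ring.
  by rewrite ler_wpM2r// -[leRHS]e1k ler_wpM2l ?(ltW e10)// gerBl.
- move=> t t' ta ta' nB nB' tt uu.
  rewrite (le_trans _ e1e)//.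
  apply: (E2 t t' _ _ ta ta' (utime_range Pg (wk _ ta)) (utime_range Pg (wk _ ta')) tt).
    by move=> tr; split; apply: nE => //; rewrite -tt.
  exact: le_trans l5.
Qed.

(** The comparison passes through the derivative of [x g] at the delayed time of g'. The derivative
    of [x g' - x g] is at most L |g' - g|, and [x g] is compared with itself off [E], which both
    delayed times must avoid. Piecewise monotonicity for g' itself lets its delayed time avoid the
    null set where [x g'] is not differentiable. *)
Lemma deriv_compare g e : P2 tau P x a g -> 0 < e -> exists2 d, 0 < d &
  forall g', P2 tau P x a g' -> `|g' - g| <= d -> exists B,
    [/\ measurable B, (mu B <= e%:E)%E & forall t, 0 < t < a -> ~ B t ->
      `|dx g t| <= N /\ `|dx g' t - dx g t| <= e].
Proof.
move=> g2 e0; have Pg : P g by case: g2.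
have [Kd Kd1 HKd] := data_close.
have Kdg : 0 < Kd by exact: lt_le_trans Kd1.
have e20 : 0 < e / 2 by rewrite divr_gt0.
(* [E] is pulled back twice, by the delayed times of g and of g', each time at a cost of at most
   [e / 2]. *)
have e40 : 0 < e / 4 by rewrite divr_gt0.
have [Cp [dp [Cp0 dp0 Hp]]] := pull_times g2 e40.
have Cp10 : 0 < Cp + 1 by rewrite ltr_wpDl.
have eta0 : 0 < e / 4 / (Cp + 1) by rewrite divr_gt0.
have [E [mE Ee [de de0 [E1 E2]]]] := x_egorov Pg e20 eta0.
have L10 : 0 < L + 1 by rewrite ltr_wpDl.
pose d := Num.min dp (Num.min (de / Kd) (e / 2 / (L + 1))).
have d0 : 0 < d by rewrite !lt_min dp0 !divr_gt0.
have l1 : d <= dp by rewrite !ge_min lexx.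
have l2 : d <= de / Kd by rewrite !ge_min lexx !orbT.
have l3 : d <= e / 2 / (L + 1) by rewrite !ge_min lexx !orbT.
exists d => // g' g2' gg; have Pg' : P g' by case: g2'.
have wk := openW.
have ra : - r%:num <= a by have := r0; have := a_gt0; lra.
pose Y := x g' \o itv_proj (- r%:num) a.
have YN s t : `|Y s - Y t| <= N * `|s - t|.
  by apply: lip_itv_proj => // s' t' sa ta; exact: x_lipschitz.
have /ae_null[Z [mZ Z0 dZ]] := lip_ae_derivable_rvec N_ge0 YN.
have mab : measurable [set - r%:num; a] by apply: measurableU; exact: measurable_set1.
pose Z' := Z `|` [set - r%:num; a].
have mZ' : measurable Z' by exact: measurableU.
have Z'0 : mu Z' = 0%E.
  apply/eqP; rewrite eq_le measure_ge0 andbT; apply: mu_setU_null => //.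
    by move: Z0 => /= ->.
  exact/countable_lebesgue_measure0/finite_set_countable/finite_set2.
have mB1 := bad_times_measurable Pg mE; have mB2 := bad_times_measurable Pg' mE.
have mB3 := bad_times_measurable Pg' mZ'.
exists ((bad_times g E `|` bad_times g' E) `|` bad_times g' Z'); split.
- by apply: measurableU => //; exact: measurableU.
- apply: mu_setU_null => //; first exact: measurableU.
    have b1 := Hp g Pg _ E _ mE Ee; have b2 := Hp g' Pg' (le_trans gg l1) E _ mE Ee.
    rewrite subrr normr0 in b1; have {}b1 := b1 (ltW dp0).
    rewrite (le_trans (mu_setU_le mB1 mB2 b1 b2))// lee_fin.
    have eE : e / 4 = e / 2 / 2 by field.
    by rewrite [leRHS]splitr; apply: lerD; exact: (half_budget eE).
  exact: bad_times_null.
move=> t ta nB.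
have nE : t <= r%:num -> ~ E (utime g t).
  by apply: bad_timesP => // Bt; apply: nB; left; left.
have nE' : t <= r%:num -> ~ E (utime g' t).
  by apply: bad_timesP => // Bt; apply: nB; left; right.
have nZ : t <= r%:num -> ~ Z' (utime g' t).
  by apply: bad_timesP => // Bt; apply: nB; right.
have ur := utime_range Pg (wk _ ta); have ur' := utime_range Pg' (wk _ ta).
have [_ pN _] := E1 t _ ta ur nE; split=> //.
have /= := HKd g g' t t Pg Pg' (wk _ ta) (wk _ ta); rewrite subrr normr0 add0r.
move=> [_ _ c3 _].
have h1 : `|derive1 (x g) (utime g' t) - dx g t| <= e / 2.
  apply: (E2 t t _ _ ta ta ur' ur) => //; first by move=> tr; split; [exact: nE'|exact: nE].
  by rewrite (le_trans c3)// -ler_pdivlMl// mulrC (le_trans gg).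
have ui : - r%:num < utime g' t < a.
  move: ta ur' => /andP[t0 ta] /andP[u1 u2]; rewrite (le_lt_trans u2 ta) andbT.
  case: (leP t r%:num) => tr; last by have := r0; lra.
  rewrite lt_neqAle; apply/andP; split; last by lra.
  by apply/eqP => uE; apply: (nZ tr); right; left.
have [dg _ _] := E1 t _ ta ur' nE'.
have dg' : hasd (x g') (utime g' t) (dx g' t).
  case: (leP t r%:num) => tr.
    have /dZ /derivable_hasd /(hasd_itv_proj _ _ ui) h : ~ Z (utime g' t).
      by move=> Zu; apply: (nZ tr); left.
    by rewrite (hasd_derive1 h).
  have ui' : 0 < utime g' t < a by move: ui ur' tr; lra.
  by have h := x_hasd Pg' ui'; rewrite (hasd_derive1 h).
have h2 : `|dx g' t - derive1 (x g) (utime g' t)| <= e / 2.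
  have q0 : 0 < Num.min (utime g' t - - r%:num) (a - utime g' t).
    by rewrite lt_min !subr_gt0; case/andP: ui => -> ->.
  have /= := hasd_le (k := L * `|g' - g|) q0 _ (hasdB dg' dg).
  move=> /(_ _) /le_trans; apply => [s|].
    move=> /(near_window ui) sa; apply: xdiff_lipschitz => //.
    by apply: window_itv ur'; exact: wk.
  rewrite (@le_trans _ _ ((L + 1) * `|g' - g|))//.
    by rewrite ler_wpM2r// lerDl.
  by rewrite mulrC -ler_pdivlMr// (le_trans gg).
rewrite -(subrK (derive1 (x g) (utime g' t)) (dx g' t)) -addrA.
by apply: le_trans (ler_normD _ _) _; rewrite [leRHS]splitr; exact: lerD h2 h1.
Qed.


(** * The variational problem *)

Local Notation lipW M z := (forall s t, - r%:num <= s <= a -> - r%:num <= t <= a ->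
  `|z s - z t| <= M * `|s - t|).

(** Approximate solutions of the variational problem in the direction [h], with defect [e] off [B].
    Difference quotients are of this kind with small [e] and [B]; exact solutions have [e = 0] and a
    null [B]. *)
Definition asol g (h : Gamma) (z : R -> V) (M e : R) (B : set R) : Prop :=
  [/\ lipW M z, forall t, - r%:num <= t <= 0 -> z t = Gphi h t &
      forall t, 0 < t < a -> ~ B t -> exists2 v, hasd z t v &
        `|v - VO g t (segment r z t) (Gtheta h) (Gxi h)| <= e].

Lemma asolS g h z M e (B B' : set R) : B `<=` B' -> asol g h z M e B -> asol g h z M e B'.
Proof.
move=> BB [lz iz dz]; split=> // t ta nB; apply: dz => // Bt; apply: nB; exact: BB.
Qed.

(** The initial values and the parameter directions cancel, so the difference solves the homogeneous
    equation up to the two defects and [gronwall] applies with [A = 0]. The constant depends on [g]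
    only. *)
Lemma asol_close g : P g -> exists2 Cg, 1 <= Cg & forall h z z' M M' e e' B m,
  0 <= M -> 0 <= M' -> 0 <= e -> 0 <= e' -> 0 <= m ->
  asol g h z M e B -> asol g h z' M' e' B -> measurable B -> (mu B <= m%:E)%E ->
  (forall t, 0 < t < a -> ~ B t -> `|dx g t| <= N) ->
  forall s, - r%:num <= s <= a -> `|z s - z' s| <= Cg * (e + e' + (M + M') * m).
Proof.
move=> Pg; have [K K0 HK] := vop_bound Pg.
have [Cg C1 H] := @gronwall R V K a K0 a_gt0; exists Cg => //.
move=> h z z' M M' e e' B m M0 M'0 e0 e'0 m0 [lz iz dz] [lz' iz' dz'] mB Bm dxN.
have cz := lip_within lz; have cz' := lip_within lz'.
have := H r%:num (fun s => z s - z' s) 0 (e + e') (M + M') m B.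
rewrite add0r; apply=> //.
- exact: addr_ge0.
- exact: addr_ge0.
- move=> s t sa ta; rewrite (_ : _ - _ = (z s - z t) - (z' s - z' t)); last by lmod R.
  by rewrite (le_trans (ler_normB _ _))// mulrDl lerD// ?lz ?lz'.
- by move=> t t0; rewrite iz// iz'// subrr normr0.
move=> t ta nB; have [v zv ve] := dz t ta nB; have [v' zv' ve'] := dz' t ta nB.
have ta' := openW ta.
exists (v - v'); first exact: hasdB.
move=> S wS.
set A := VO g t _ _ _ in ve; set A' := VO g t _ _ _ in ve'.
have AA : `|A - A'| <= K * S.
  have -> : A - A' = VO g t (segment r (fun s => z s - z' s) t) (Gtheta h - Gtheta h) (Gxi h - Gxi h).
    by rewrite (segB cz cz' ta') vopB.
  rewrite (le_trans (HK t _ ta' (dxN t ta nB) _ _ _))// !subrr !normr0 !addr0 ler_wpM2l//.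
  apply: (seg_le (contWB cz cz') ta') => s st; apply: wS.
  by move: ta st; lra.
rewrite (_ : v - v' = (A - A') + ((v - A) - (v' - A'))); last by lmod R.
rewrite (le_trans (ler_normD _ _))// lerD// (le_trans (ler_normB _ _))//.
exact: lerD.
Qed.

Lemma ball_in_P g : P g -> exists2 d, 0 < d & forall g', `|g' - g| < d -> P g'.
Proof.
move=> Pg; have /nbhs_ballP[d /= d0 H] := open_nbhs_nbhs (conj openP Pg).
by exists d => // g' gg; apply: H; rewrite -ball_normE /= distrC.
Qed.

Lemma x_init g t : P g -> - r%:num <= t <= 0 -> x g t = Gphi g t.
Proof. by move=> /x_sol[[_ H _ _] _] t0; apply: H; rewrite in_itv. Qed.

Definition quotient g (h : Gamma) (k : R) (t : R) : V := k^-1 *: (x (g + k *: h) t - x g t).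

(** [key_estimate] divided by [k]. One pair [d], [B] serves every direction, under a condition on
    [k * |h|] alone; so the lemma gives the limit k -> 0 for fixed [h] and, with [k = 1], the
    Frechet estimate. *)
Lemma quotient_asol g e : P2 tau P x a g -> 0 < e -> exists d B,
  [/\ 0 < d, measurable B, (mu B <= e%:E)%E &
  [/\ forall t, 0 < t < a -> ~ B t -> `|dx g t| <= N,
      forall t t', 0 < t < a -> 0 < t' < a -> ~ B t -> ~ B t' ->
        (t <= r%:num) = (t' <= r%:num) -> `|utime g t - utime g t'| <= d ->
        `|dx g t - dx g t'| <= e &
      forall h k, 0 < k -> k * `|h| <= d -> [/\ P (g + k *: h),
        asol g h (quotient g h k) (L * `|h|) (e * `|h|) B &
        forall s, - r%:num <= s <= a -> `|quotient g h k s| <= L * `|h|]]].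
Proof.
move=> g2 e0; have Pg : P g by case: g2.
have [d0 d00 HP] := ball_in_P Pg.
have [d1 [B [d10 mB Be [dxN H1 H2]]]] := key_estimate g2 e0.
exists (Num.min d1 (d0 / 2)), B; split=> //; first by rewrite lt_min d10 divr_gt0.
have dd : Num.min d1 (d0 / 2) <= d1 by rewrite ge_min lexx.
split=> // [t t' ta ta' nB nB' tt uu|h k k0 kh]; first by apply: H2 => //; exact: le_trans dd.
have kh1 := le_trans kh dd.
have kh2 : k * `|h| < d0.
  have : Num.min d1 (d0 / 2) <= d0 / 2 by rewrite ge_min lexx orbT.
  by move=> /(le_trans kh); lra.
have gE : g + k *: h - g = k *: h by rewrite addrAC subrr add0r.
have nE : `|g + k *: h - g| = k * `|h| by rewrite gE normrZ gtr0_norm.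
have Pk : P (g + k *: h) by apply: HP; rewrite nE.
have kn : k != 0 by rewrite gt_eqF.
have lq : lipW (L * `|h|) (quotient g h k).
  move=> s t sa ta; rewrite /quotient -scalerBr normrZ normfV gtr0_norm// ler_pdivrMl//.
  by rewrite (le_trans (xdiff_lipschitz Pg Pk sa ta))// nE !mulrA [k * L]mulrC.
split=> //; last first.
  move=> s sa; rewrite /quotient normrZ normfV gtr0_norm// ler_pdivrMl//.
  by rewrite (le_trans (xdiff_bound Pg Pk sa))// nE mulrCA.
split=> // [t t0|t ta nB].
  rewrite /quotient !x_init//.
  change (k^-1 *: ((Gphi g t + k *: Gphi h t) - Gphi g t) = Gphi h t).
  by rewrite addrAC subrr add0r scalerK.
have ta' := openW ta.
exists (k^-1 *: (xrhs (g + k *: h) t - xrhs g t)).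
  by apply: hasdZ; apply: hasdB; exact: x_hasd.
have := H1 _ Pk; rewrite nE => /(_ kh1 t ta nB).
have -> : Gtheta (g + k *: h) - Gtheta g = k *: Gtheta h.
  by change (Gtheta g + k *: Gtheta h - Gtheta g = k *: Gtheta h); rewrite addrAC subrr add0r.
have -> : Gxi (g + k *: h) - Gxi g = k *: Gxi h.
  by change (Gxi g + k *: Gxi h - Gxi g = k *: Gxi h); rewrite addrAC subrr add0r.
have -> : seg (g + k *: h) t - seg g t = k *: segment r (quotient g h k) t.
  rewrite -(segB (x_cont Pk) (x_cont Pg) ta').
  have cB := contWB (x_cont Pk) (x_cont Pg).
  by rewrite [segment r (quotient _ _ _) t](segZ k^-1 cB ta') scalerKV.
rewrite vopZ => h1; rewrite -(scalerK kn (VO _ _ _ _ _)) -scalerBr normrZ normfV.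
by rewrite gtr0_norm// ler_pdivrMl// mulrCA.
Qed.

Lemma dx_ae g : P2 tau P x a g -> {ae mu, forall t, 0 < t < a -> `|dx g t| <= N}.
Proof.
move=> g2; apply: ae_small => e e0.
have [d [B [_ mB Be [H _ _]]]] := quotient_asol g2 e0.
by exists B; split=> // t nB ta; exact: H.
Qed.

Lemma quotient_limit g h : P2 tau P x a g -> exists z : R -> V,
  [/\ lipW (L * `|h|) z, forall t, - r%:num <= t <= 0 -> z t = Gphi h t,
      forall s, - r%:num <= s <= a -> `|z s| <= L * `|h| &
      forall e, 0 < e -> exists n0, forall k, (n0 <= k)%N -> forall s, - r%:num <= s <= a ->
        `|quotient g h k.+1%:R^-1 s - z s| <= e].
Proof.
move=> g2; have Pg : P g by case: g2.
have [Cg C1 HC] := asol_close Pg.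
have C0 : 0 < Cg by exact: lt_le_trans C1.
have cauchy e : 0 < e -> exists n0, forall k l, (n0 <= k)%N -> (n0 <= l)%N ->
    forall s, - r%:num <= s <= a ->
    `|quotient g h k.+1%:R^-1 s - quotient g h l.+1%:R^-1 s| <= e.
  (* Both defects are [e / c * |h|], the Lipschitz constants add up to 2 L |h| and the bad set has
     measure at most [e / c]; the final 1 makes [c] positive. *)
  move=> e0; pose c := Cg * (2 * `|h| + 2 * (L * `|h|)) + 1.
  have c0 : 0 < c.
    by rewrite ltr_wpDl// mulr_ge0 ?(ltW C0)// addr_ge0// !mulr_ge0.
  have ec0 : 0 < e / c by rewrite divr_gt0.
  have [d [B [d0 mB Be [dxN _ H]]]] := quotient_asol g2 ec0.
  have dh0 : 0 < d / (`|h| + 1) by rewrite divr_gt0// ltr_wpDl.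
  have [n0 Hn] := natV_small dh0; exists n0 => k l nk nl s sa.
  have small j : (n0 <= j)%N -> (j.+1%:R^-1 : R) * `|h| <= d.
    move=> /Hn; rewrite ler_pdivlMr ?ltr_wpDl// => /(le_trans _); apply.
    by rewrite ler_wpM2l// lerDl.
  have p j : 0 < (j.+1%:R^-1 : R) by rewrite invr_gt0.
  have [_ Ak _] := H h _ (p k) (small _ nk); have [_ Al _] := H h _ (p l) (small _ nl).
  have Lh : 0 <= L * `|h| by rewrite mulr_ge0.
  have eh : 0 <= e / c * `|h| by rewrite mulr_ge0// ltW.
  rewrite (le_trans (HC h _ _ _ _ _ _ B (e / c) Lh Lh eh eh (ltW ec0) Ak Al mB Be dxN s sa))//.
  rewrite [leLHS](_ : _ = e / c * (c - 1)); last by move: (e / c) => q; rewrite /c; ring.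
  by rewrite mulrAC ler_pdivrMr// ler_pM2l// gerBl.
have /choice[z Hz] : forall s, exists l : V, - r%:num <= s <= a -> forall e, 0 < e ->
    exists n0, forall k, (n0 <= k)%N -> `|quotient g h k.+1%:R^-1 s - l| <= e.
  move=> s; case: (pselect (- r%:num <= s <= a)) => sa; last by exists 0.
  have [|l Hl] := @rvec_cauchy R n nu (fun k => quotient g h k.+1%:R^-1 s).
    by move=> e /cauchy[n0 H]; exists n0 => k l nk nl; exact: H.
  by exists l => _.
have unif e : 0 < e -> exists n0, forall k, (n0 <= k)%N -> forall s, - r%:num <= s <= a ->
    `|quotient g h k.+1%:R^-1 s - z s| <= e.
  move=> /cauchy[n0 H]; exists n0 => k nk s sa; apply/ler_addgt0Pl => e' e'0.
  have [n1 H1] := Hz s sa e' e'0; pose l := maxn n0 n1.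
  have h1 := H k l nk (leq_maxl _ _) s sa; have h2 := H1 l (leq_maxr _ _).
  rewrite -(subrK (quotient g h l.+1%:R^-1 s) (quotient g h _ s)) -addrA addrC.
  by rewrite (le_trans (ler_normD _ _))// lerD.
have [d [B [d0 mB Be [dxN _ H]]]] := quotient_asol g2 ltr01.
have dh0 : 0 < d / (`|h| + 1) by rewrite divr_gt0// ltr_wpDl.
have [n1 Hn] := natV_small dh0.
have Hq j : (n1 <= j)%N -> [/\ lipW (L * `|h|) (quotient g h j.+1%:R^-1),
    forall t, - r%:num <= t <= 0 -> quotient g h j.+1%:R^-1 t = Gphi h t &
    forall s, - r%:num <= s <= a -> `|quotient g h j.+1%:R^-1 s| <= L * `|h|].
  move=> nj; have p : 0 < (j.+1%:R^-1 : R) by rewrite invr_gt0.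
  have [|_ [A1 A2 _] A3] := H h _ p; last by [].
  have := Hn j nj; rewrite ler_pdivlMr ?ltr_wpDl// => /(le_trans _); apply.
  by rewrite ler_wpM2l// ?lerDl// invr_ge0.
have approx e : 0 < e -> exists2 j, (n1 <= j)%N & forall s, - r%:num <= s <= a ->
    `|quotient g h j.+1%:R^-1 s - z s| <= e.
  move=> /unif[n2 H2]; exists (maxn n1 n2); first exact: leq_maxl.
  by apply: H2; exact: leq_maxr.
exists z; split=> //.
- move=> s t sa ta; apply/ler_addgt0Pl => e e0.
  have e20 : 0 < e / 2 by rewrite divr_gt0.
  have [j /Hq[lj _ _] Hj] := approx _ e20.
  have h1 := Hj s sa; have h2 := Hj t ta; have h3 := lj s t sa ta.
  rewrite (_ : z s - z t = (- (quotient g h j.+1%:R^-1 s - z s) + (quotient g h j.+1%:R^-1 t - z t)) +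
    (quotient g h j.+1%:R^-1 s - quotient g h j.+1%:R^-1 t)); last by lmod R.
  rewrite (le_trans (ler_normD _ _))// lerD// (le_trans (ler_normD _ _))// normrN.
  by rewrite [leRHS]splitr lerD.
- move=> t t0; have ta : - r%:num <= t <= a by have := a_gt0; move: t0; lra.
  apply/eqP; rewrite -subr_eq0 -normr_le0; apply/ler_addgt0Pl => e e0; rewrite addr0.
  have [j /Hq[_ ij _] Hj] := approx _ e0.
  by rewrite distrC -(ij t t0); exact: Hj.
- move=> s sa; apply/ler_addgt0Pl => e e0.
  have [j /Hq[_ _ bj] Hj] := approx _ e0.
  rewrite -(subrK (quotient g h j.+1%:R^-1 s) (z s)) (le_trans (ler_normD _ _))// lerD//.
    by rewrite distrC; exact: Hj.
  exact: bj.
Qed.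

(** Off [B], the right-hand side at the limit [z] is continuous up to a multiple of [e]. The time r
    is excluded because x'(u(t)) is compared only between times on the same side of it, which
    [rho <= |t0 - r| / 2] guarantees. *)
Lemma limit_rhs_near g h z e : P2 tau P x a g -> 0 < e -> lipW (L * `|h|) z ->
  (forall s, - r%:num <= s <= a -> `|z s| <= L * `|h|) ->
  exists d B, [/\ 0 < d, measurable B, (mu B <= e%:E)%E &
  [/\ forall t, 0 < t < a -> ~ B t -> `|dx g t| <= N,
      forall k, 0 < k -> k * `|h| <= d -> asol g h (quotient g h k) (L * `|h|) (e * `|h|) B &
      forall t0, 0 < t0 < a -> ~ B t0 -> t0 != r%:num -> exists2 rho, 0 < rho &
        forall t, 0 < t < a -> ~ B t -> `|t - t0| <= rho ->
        `|VO g t (segment r z t) (Gtheta h) (Gxi h) -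
          VO g t0 (segment r z t0) (Gtheta h) (Gxi h)| <= e * ((L + 2) * `|h| + 2)]].
Proof.
move=> g2 e0 lz bz; have Pg : P g by case: g2.
have cz := lip_within lz.
have [Kv Kv0 HKv] := vop_bound Pg; have [Kc Kc0 HKc] := vop_compare Pg.
have [dc dc0 Hdc] := HKc e e0.
have [Kd Kd1 HKd] := data_close; have [Kb Kb1 HKb] := data_ball.
have Kdg : 0 < Kd by exact: lt_le_trans Kd1.
have Kbg : 0 < Kb by exact: lt_le_trans Kb1.
pose e1 := Num.min e dc.
have e10 : 0 < e1 by rewrite lt_min e0.
have e1e : e1 <= e by rewrite ge_min lexx.
have e1d : e1 <= dc by rewrite ge_min lexx orbT.
have [d [B [d0 mB Be [dxN nearB H]]]] := quotient_asol g2 e10.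
have Lh : 0 <= L * `|h| by rewrite mulr_ge0.
exists d, B; split=> //; first by rewrite (le_trans Be)// lee_fin.
split=> // [k k0 kd|t0 ta0 nB0 tr0].
  have [_ [A1 A2 A3] _] := H h k k0 kd; split=> // t ta nB.
  by have [v qv ve] := A3 t ta nB; exists v => //; rewrite (le_trans ve)// ler_wpM2r.
have wk := openW.
pose k1 := Kv * (L * `|h|) + Kc * (L * `|h|) * Kd + 1.
have k10 : 0 < k1 by rewrite ltr_wpDl// addr_ge0// !mulr_ge0// ltW.
pose rho := Num.min (Num.min (`|t0 - r%:num| / 2) (d / Kd)) (Num.min (dc / (Kb + Kb)) (e / k1)).
have tr0' : 0 < `|t0 - r%:num| by rewrite normr_gt0 subr_eq0.
have rho0 : 0 < rho by rewrite !lt_min !divr_gt0// addr_gt0.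
have r1 : rho <= `|t0 - r%:num| / 2 by rewrite !ge_min lexx.
have r2 : rho <= d / Kd by rewrite !ge_min lexx !orbT.
have r3 : rho <= dc / (Kb + Kb) by rewrite !ge_min lexx !orbT.
have r4 : rho <= e / k1 by rewrite !ge_min lexx !orbT.
exists rho => // t ta nB tt0.
have tside : (t <= r%:num) = (t0 <= r%:num).
  have h1 : `|t - t0| <= `|t0 - r%:num| / 2 by exact: le_trans r1.
  move: h1 tr0' tr0; rewrite ler_norml => /andP[h1 h2].
  case: (ltP t0 r%:num) => [lt _ _|ge _ ne].
    rewrite ltr0_norm ?subr_lt0// in h1 h2.
    by rewrite (ltW lt); apply/idP; lra.
  have gt : r%:num < t0 by rewrite lt_neqAle eq_sym ne.
  rewrite gtr0_norm ?subr_gt0// in h1 h2.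
  by rewrite [RHS]leNgt gt/=; apply/negbTE; rewrite -ltNge; lra.
have /= := HKd g g t0 t Pg Pg (wk _ ta0) (wk _ ta); rewrite subrr normr0 addr0.
move=> [_ _ c3 c4].
have u1 : `|utime g t - utime g t0| <= d.
  by rewrite (le_trans c3)// -ler_pdivlMl// mulrC (le_trans tt0 r2).
have p1 : `|dx g t - dx g t0| <= dc.
  by rewrite (le_trans _ e1d)//; apply: nearB.
have [|bf bt _ _] := HKb g g t0 t dc Pg Pg (wk _ ta0) (wk _ ta).
  by rewrite subrr normr0 addr0; apply: lt_of_half => //; exact: le_trans r3.
have V1 := Hdc t0 (wk _ ta0) (cf g t) (ct g t) (dx g t0) (dx g t) (x_f_dom Pg (wk _ ta))
  (x_tau_dom Pg (wk _ ta)) bf bt (dxN _ ta0 nB0) p1 (segment r z t0) (Gtheta h) (Gxi h).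
have V2 := HKv t (dx g t) (wk _ ta) (dxN _ ta nB) (segment r z t - segment r z t0) 0 0.
have zt : `|segment r z t - segment r z t0| <= L * `|h| * `|t - t0|.
  exact: (seg_lip cz lz (wk _ ta) (wk _ ta0)).
have z0 : `|segment r z t0| <= L * `|h|.
  by apply: (seg_le cz (wk _ ta0)) => s st; apply: bz; apply: window_itv st; exact: wk.
have ztau : `|segment r z t0 (- tau t (seg g t) (Gxi g)) -
    segment r z t0 (- tau t0 (seg g t0) (Gxi g))| <= L * `|h| * (Kd * `|t - t0|).
  rewrite !(seg_at _ cz (wk _ ta0)).
  have cl s : - r%:num <= t0 + clamp r s <= a.
    exact: window_clamp (wk _ ta0).
  rewrite (le_trans (lz _ _ (cl _) (cl _)))// ler_wpM2l//.
  rewrite opprD addrACA subrr add0r (le_trans (clamp_lip _ _ _))//.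
  by rewrite -opprD normrN.
have tk : `|t - t0| * k1 <= e by rewrite -ler_pdivlMr// (le_trans tt0).
rewrite (_ : VO g t (segment r z t) (Gtheta h) (Gxi h) - _ =
  VO g t (segment r z t - segment r z t0) 0 0 +
  (VO g t (segment r z t0) (Gtheta h) (Gxi h) - VO g t0 (segment r z t0) (Gtheta h) (Gxi h)));
    last first.
  have := vopB (cf g t) (ct g t) (dx g t) (segment r z t) (segment r z t0)
    (Gtheta h) (Gtheta h) (Gxi h) (Gxi h).
  by rewrite !subrr => ->; lmod R.
have hth := Gtheta_le h; have hxi := Gxi_le h.
rewrite !normr0 !addr0 in V2.
have V2' : `|VO g t (segment r z t - segment r z t0) 0 0| <= Kv * (L * `|h|) * `|t - t0|.
  by rewrite (le_trans V2)// -mulrA ler_wpM2l.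
have V1' := le_trans V1 (lerD
  (ler_wpM2l (ltW e0) (lerD (lerD z0 hth) hxi)) (ler_wpM2l Kc0 ztau)).
rewrite (le_trans (ler_normD _ _))// (le_trans (lerD V2' V1'))//.
rewrite [leLHS](_ : _ = `|t - t0| * k1 - `|t - t0| + e * ((L + 2) * `|h|)); last first.
  by rewrite /k1; ring.
rewrite [leRHS]mulrDr [leRHS]addrC lerD2r.
exact: sub_le_double (normr_ge0 _) tk e0.
Qed.

(* The limit of the difference quotients satisfies the equation at every density
   point of the complement of the exceptional set. *)
Lemma variational_exists g h : P2 tau P x a g -> exists z B,
  [/\ measurable B, mu B = 0%E, asol g h z (L * `|h|) 0 B &
      forall s, - r%:num <= s <= a -> `|z s| <= L * `|h|].
Proof.
move=> g2; have Pg : P g by case: g2.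
have Lh : 0 <= L * `|h| by rewrite mulr_ge0.
have [z [lz iz bz Hz]] := quotient_limit h g2.
have [Kv Kv0 HKv] := vop_bound Pg.
pose ell t := VO g t (segment r z t) (Gtheta h) (Gxi h).
have lz0 s t : 0 <= s <= a -> 0 <= t <= a -> `|z s - z t| <= L * `|h| * `|s - t|.
  by move=> sa ta; apply: lz; exact: closedW.
have [Zd [mZd Zd0 dz]] := lip_itv_hasd (ltW a_gt0) Lh lz0.
(* In turn: the defect of the quotient, the replacement of the quotient by [z] in the operator, the
   variation of the right-hand side near t, and one unit each for the bad set and for the derivative
   of [z] at t. *)
pose c := (`|h| + Kv + ((L + 2) * `|h| + 2) + 2).
have c0 : 0 < c by rewrite ltr_wpDl// !addr_ge0// mulr_ge0// addr_ge0.
have main e : 0 < e -> exists B, [/\ measurable B, (mu B <= e%:E)%E &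
    forall t, ~ B t -> 0 < t < a -> hasd z t (derive1 z t) /\ `|derive1 z t - ell t| <= c * e].
  move=> e0; have [d [B [d0 mB Be [dxN HQ Hn]]]] := limit_rhs_near g2 e0 lz bz.
  have /ae_null[D [mD D0 HD]] := density_point mB.
  have mr := measurable_set1 r%:num.
  have mDr : measurable ((D `|` Zd) `|` [set r%:num]).
    by apply: measurableU => //; exact: measurableU.
  exists (B `|` ((D `|` Zd) `|` [set r%:num])); split.
  - exact: measurableU.
  - apply: mu_setU_null => //; apply/eqP; rewrite eq_le measure_ge0 andbT.
    apply: mu_setU_null => //; [exact: measurableU| |by rewrite mu_set1].
    by apply: mu_setU_null => //; move: D0 => /= ->.
  move=> t nB ta.
  have nBt : ~ B t by move=> Bt; apply: nB; left.
  have nD : ~ D t by move=> Dt; apply: nB; right; left; left.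
  have nZ : ~ Zd t by move=> Dt; apply: nB; right; left; right.
  have tr : t != r%:num by apply/eqP => tE; apply: nB; right; right.
  have dzt := dz t ta nZ; split=> //.
  have [rho1 rho10 near1] := Hn t ta nBt tr.
  pose M' := L * `|h| + `|ell t|.
  have M'0 : 0 <= M' by rewrite addr_ge0.
  (* [M'] is a Lipschitz constant of the function [F] below. At a density point the bad part of the
     ball of radius 2 rho has measure at most 2 rho e / (2 M' + 1), so its cost is at most
     [e * rho]. *)
  have eM0 : 0 < e / (2 * M' + 1) by rewrite divr_gt0// ltr_wpDl// mulr_ge0.
  have [rho2 rho20 dens] := HD t nD nBt _ eM0.
  have [rho3 rho30 Hd] := dzt e e0.
  pose rho := Num.min (Num.min (rho1 / 2) (rho2 / 4)) (Num.min rho3 ((a - t) / 2)).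
  have rho0 : 0 < rho.
    by rewrite !lt_min rho30 !divr_gt0// subr_gt0; case/andP: ta.
  have s1 : rho <= rho1 / 2 by rewrite !ge_min lexx.
  have s2 : rho <= rho2 / 4 by rewrite !ge_min lexx !orbT.
  have s3 : rho <= rho3 by rewrite !ge_min lexx !orbT.
  have s4 : rho <= (a - t) / 2 by rewrite !ge_min lexx !orbT.
  have ta' : t + rho < a by move: ta => /andP[_ ta]; lra.
  (* The derivative of [z] is still unknown, that of the quotients is controlled off [B]. Hence
     [rho] is fixed first, and [z] is then replaced by a quotient so close to it that the error e'
     is arbitrary. *)
  have main_z : `|z (t + rho) - z t - rho *: ell t| <=
      (`|h| + Kv + ((L + 2) * `|h| + 2) + 1) * e * rho.
    apply/ler_addgt0Pl => e' e'0.
    have q0 : 0 < Num.min e (e' / 2) by rewrite lt_min e0 divr_gt0.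
    have [n0 Hk] := Hz _ q0.
    have dh0 : 0 < d / (`|h| + 1) by rewrite divr_gt0// ltr_wpDl.
    have [n1 Hn1] := natV_small dh0.
    pose k := maxn n0 n1; set kk : R := k.+1%:R^-1.
    have kk0 : 0 < kk by rewrite invr_gt0.
    have {}Hk := Hk k (leq_maxl _ _); rewrite -/kk in Hk.
    have kd : kk * `|h| <= d.
      have := Hn1 k (leq_maxr _ _); rewrite -/kk ler_pdivlMr ?ltr_wpDl// => /(le_trans _).
      by apply; rewrite ler_wpM2l ?ltW// ltrDl.
    have [lq _ dq] := HQ kk kk0 kd.
    have cq := lip_within lq; have cz := lip_within lz.
    pose F s := quotient g h kk s - s *: ell t.
    have FM s s' : t <= s <= t + rho -> t <= s' <= t + rho -> `|F s - F s'| <= M' * `|s - s'|.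
      move=> sa sa'; rewrite (_ : F s - F s' = (quotient g h kk s - quotient g h kk s') - (s - s') *: ell t); last first.
        by rewrite /F; lmod R.
      rewrite (le_trans (ler_normB _ _))// mulrDl lerD//; last by rewrite normrZ mulrC.
      have := r0 => r_gt0; move: ta => /andP[t0 _].
      by apply: lq; [apply: sub_window sa|apply: sub_window sa'] => //; exact: ltW.
    pose B' := B `&` ball t (2 * rho).
    have mB' : measurable B' by apply: measurableI => //; exact: measurable_ball.
    have B'm : (mu B' <= (e / (2 * M' + 1) * (2 * rho))%:E)%E.
      by apply: dens; [rewrite mulr_gt0|exact: quarter_lt].
    have tr' : t <= t + rho by rewrite lerDl ltW.
    have kq0 : 0 <= (`|h| + Kv + ((L + 2) * `|h| + 2)) * e.
      by rewrite mulr_ge0 ?(ltW e0)// !addr_ge0// mulr_ge0// addr_ge0.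
    have := mvt_bad (k := (`|h| + Kv + ((L + 2) * `|h| + 2)) * e) tr' M'0 FM mB' B'm.
    rewrite [t + rho - t]addrAC subrr add0r (max_idPl kq0) => H.
    have {H} HF : `|F (t + rho) - F t| <=
        (`|h| + Kv + ((L + 2) * `|h| + 2)) * e * rho + M' * (e / (2 * M' + 1) * (2 * rho)).
      apply: H => s /andP[ts sr] nBs.
      have sB : ~ B s.
        move=> Bs; apply: nBs; split=> //; rewrite /ball/= distrC gtr0_norm ?subr_gt0//.
        exact: sub_lt_double sr.
      have sa : 0 < s < a by move: ta => /andP[t0 _]; rewrite (lt_trans t0 ts) (lt_trans sr ta').
      have sa' : 0 <= s <= a by move: sa => /andP[/ltW -> /ltW ->].
      have [v qv ve] := dq s sa sB; exists (v - ell t).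
        exact: hasdB qv (hasd_lin _ _).
      have v1 : `|VO g s (segment r (quotient g h kk) s) (Gtheta h) (Gxi h) - ell s| <= Kv * e.
        rewrite -vopB (le_trans (HKv s _ sa' (dxN _ sa sB) _ _ _))//.
        rewrite !subrr !normr0 !addr0 ler_wpM2l//.
        rewrite -(segB cq cz sa'); apply: (seg_le (contWB cq cz) sa') => y ys.
        rewrite (le_trans (Hk y _)) ?ge_min ?lexx//.
        exact: window_itv ys.
      have v2 : `|ell s - ell t| <= e * ((L + 2) * `|h| + 2).
        apply: near1 => //; rewrite gtr0_norm ?subr_gt0//.
        exact: (sub_le_half rho10 sr s1).
      rewrite (_ : v - ell t = (v - VO g s (segment r (quotient g h kk) s) (Gtheta h) (Gxi h)) +
        (VO g s (segment r (quotient g h kk) s) (Gtheta h) (Gxi h) - ell s) +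
        (ell s - ell t)); last by lmod R.
      rewrite (le_trans (ler_normD _ _))// [leRHS]mulrDl lerD//; last by rewrite mulrC.
      rewrite (le_trans (ler_normD _ _))// [leRHS]mulrDl lerD//.
      by rewrite mulrC.
    have b2 : M' * (e / (2 * M' + 1) * (2 * rho)) <= e * rho.
      have m1 : 0 < 2 * M' + 1 by rewrite ltr_wpDl// mulr_ge0.
      rewrite (_ : M' * _ = e * rho * (2 * M' / (2 * M' + 1))).
        rewrite ler_piMr//; first by rewrite mulr_ge0// ltW.
        by rewrite ler_pdivrMr// mul1r lerDl.
      by rewrite mulrA; ring.
    have h1 : `|quotient g h kk (t + rho) - z (t + rho)| <= e' / 2.
      rewrite (le_trans (Hk _ _)) ?ge_min ?lexx ?orbT//.
      by apply: (sub_window _ (ltW ta')); [case/andP: ta|rewrite lexx andbT].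
    have h2 : `|quotient g h kk t - z t| <= e' / 2.
      rewrite (le_trans (Hk _ _)) ?ge_min ?lexx ?orbT//.
      by apply: (sub_window _ (ltW ta')); [case/andP: ta|rewrite lexx].
    rewrite (_ : _ - _ = (- (quotient g h kk (t + rho) - z (t + rho)) + (quotient g h kk t - z t)) +
      (F (t + rho) - F t)); last by rewrite /F; lmod R.
    rewrite (le_trans (ler_normD _ _))// lerD//.
      by rewrite (le_trans (ler_normD _ _))// normrN [leRHS]splitr lerD.
    rewrite (le_trans HF)// [X in _ <= X * _](_ : _ = (`|h| + Kv + ((L + 2) * `|h| + 2)) * e + e).
      by rewrite [leRHS]mulrDl lerD2l.
    by ring.
  have := Hd (t + rho); rewrite [t + rho - t]addrAC subrr add0r gtr0_norm// => /(_ s3) dr.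
  have mz := main_z.
  rewrite -(ler_pM2l rho0) -[X in X * `|_|](gtr0_norm rho0) -normrZ.
  rewrite (_ : rho *: _ = (z (t + rho) - z t - rho *: ell t) -
    (z (t + rho) - z t - rho *: derive1 z t)); last by lmod R.
  rewrite (le_trans (ler_normB _ _))// (le_trans (lerD mz dr))//.
  by rewrite le_eqVlt; apply/orP; left; apply/eqP; rewrite /c; ring.
(* The exceptional set still depends on the tolerance; tolerances 1 / (j + 1) and a countable union
   remove this dependence. *)
have /ae_foralln /ae_null[B [mB B0 HB]] : forall j : nat, {ae mu, forall t, 0 < t < a ->
    hasd z t (derive1 z t) /\ `|derive1 z t - ell t| <= c * j.+1%:R^-1}.
  move=> j; apply: ae_small => e e0.
  have q0 : 0 < Num.min e (j.+1%:R^-1) by rewrite lt_min e0 invr_gt0 ltr0n.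
  have [B [mB Be HB]] := main _ q0; exists B; split=> //.
    by rewrite (le_trans Be)// lee_fin ge_min lexx.
  move=> t nB ta; have [h1 h2] := HB t nB ta; split=> //.
  by rewrite (le_trans h2)// ler_pM2l// ge_min lexx orbT.
exists z, B; split=> //; split=> // t ta nB.
exists (derive1 z t); first by have [] := HB t nB 0 ta.
apply/ler_addgt0Pl => e e0; rewrite addr0.
have ec0 : 0 < e / c by rewrite divr_gt0.
have [n0 Hn] := natV_small ec0.
have [_ h1] := HB t nB n0 ta; rewrite (le_trans h1)//.
by have := Hn n0 (leqnn _); rewrite ler_pdivlMr// mulrC.
Qed.

Lemma vsol_close g : P2 tau P x a g -> exists2 Cg, 1 <= Cg &
  forall h z z' M M' e B' m, 0 <= M -> 0 <= M' -> 0 <= e -> 0 < m ->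
  asol g h z M e B' -> measurable B' -> (mu B' <= m%:E)%E ->
  (exists B, [/\ measurable B, mu B = 0%E & asol g h z' M' 0 B]) ->
  forall s, - r%:num <= s <= a -> `|z s - z' s| <= Cg * (e + (M + M') * (m + m)).
Proof.
move=> g2; have Pg : P g by case: g2.
have [Cg C1 HC] := asol_close Pg; exists Cg => // h z z' M M' e B' m M0 M'0 e0 m0.
move=> Az mB' B'm [B [mB B0 Az']] s sa.
(* The set [Bd] secures the bound [N] on x'(u(t)) required by [asol_close]; hence the measure
   [m + m]. *)
have [_ [Bd [_ mBd Bdm [dxN _ _]]]] := quotient_asol g2 m0.
have mBB : measurable (B' `|` Bd) by exact: measurableU.
have := HC h z z' M M' e 0 ((B' `|` Bd) `|` B) (m + m).
rewrite addr0; apply=> //.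
- by rewrite addr_ge0// ltW.
- by apply: asolS Az => t ?; left; left.
- by apply: asolS Az' => t ?; right.
- exact: measurableU.
- apply: mu_setU_null => //; exact: mu_setU_le.
- by move=> t ta nB; apply: dxN => // Bt; apply: nB; left; right.
Qed.

(** * Exact solutions: uniqueness, Frechet estimate, dependence on the parameter *)

Definition vsol g h z M := exists B, [/\ measurable B, mu B = 0%E & asol g h z M 0 B].

Lemma vsol_unique g h z z' M M' : P2 tau P x a g -> 0 <= M -> 0 <= M' ->
  vsol g h z M -> vsol g h z' M' -> forall s, - r%:num <= s <= a -> z s = z' s.
Proof.
move=> g2 M0 M'0 [B [mB B0 Az]] Hz' s sa.
have [Cg C1 HC] := vsol_close g2.
have C0 : 0 < Cg by exact: lt_le_trans C1.
apply/eqP; rewrite -subr_eq0 -normr_le0; apply/ler_addgt0Pl => e e0; rewrite addr0.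
pose c := Cg * (M + M' + 1) * 2.
have c0 : 0 < c by rewrite !mulr_gt0// ltr_wpDl// addr_ge0.
have m0 : 0 < e / c by rewrite divr_gt0.
have Bm : (mu B <= (e / c)%:E)%E by move: B0 => /= ->; rewrite lee_fin ltW.
have := HC h z z' M M' 0 B _ M0 M'0 (lexx 0) m0 Az mB Bm Hz' s sa.
move=> /le_trans; apply; rewrite add0r.
rewrite [leLHS](_ : _ = e / c * (c - Cg * 2)); last by move: (e / c) => q; rewrite /c; ring.
by rewrite mulrAC ler_pdivrMr// ler_pM2l// gerBl mulr_ge0// ltW.
Qed.

(** The increment x(., g + h) - x(., g) is the quotient with [k = 1], hence an approximate solution
    with defect proportional to |h|. No uniformity over directions has to be added to the limit of
    the quotients. *)
Lemma frechet_estimate g e : P2 tau P x a g -> 0 < e -> exists2 d, 0 < d &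
  forall h, `|h| <= d -> P (g + h) /\ forall z, vsol g h z (L * `|h|) ->
    forall s, - r%:num <= s <= a -> `|x (g + h) s - x g s - z s| <= e * `|h|.
Proof.
move=> g2 e0; have [Cg C1 HC] := vsol_close g2.
have C0 : 0 < Cg by exact: lt_le_trans C1.
pose c := Cg * (1 + 4 * L).
have c0 : 0 < c by rewrite mulr_gt0// ltr_pwDl// mulr_ge0.
have ec0 : 0 < e / c by rewrite divr_gt0.
have [d [B [d0 mB Be [_ _ HQ]]]] := quotient_asol g2 ec0.
exists d => // h hd; have [|Pk Aq _] := HQ h 1 ltr01; first by rewrite mul1r.
rewrite scale1r in Pk; split=> // z Hz s sa.
have Lh : 0 <= L * `|h| by rewrite mulr_ge0.
have eh : 0 <= e / c * `|h| by rewrite mulr_ge0// ltW.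
have := HC h _ z _ _ _ B _ Lh Lh eh ec0 Aq mB Be Hz s sa.
rewrite /quotient invr1 !scale1r => /le_trans; apply.
rewrite [leLHS](_ : _ = e / c * c * `|h|); last by move: (e / c) => q; rewrite /c; ring.
by rewrite divfK// gt_eqF.
Qed.

(** An exact solution for g' is an approximate solution for g. Its own Lipschitz constant L |h|
    makes the evaluation term of [vop_compare] small. *)
Lemma vsol_continuous g e : P2 tau P x a g -> 0 < e -> exists2 d, 0 < d &
  forall g', P2 tau P x a g' -> `|g' - g| <= d -> forall h z z',
    vsol g h z (L * `|h|) -> vsol g' h z' (L * `|h|) ->
    (forall s, - r%:num <= s <= a -> `|z' s| <= L * `|h|) ->
    forall s, - r%:num <= s <= a -> `|z' s - z s| <= e * `|h|.
Proof.
move=> g2 e0; have Pg : P g by case: g2.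
have [Cg C1 HC] := vsol_close g2.
have C0 : 0 < Cg by exact: lt_le_trans C1.
have [Kc Kc0 HKc] := vop_compare Pg.
have [Kd Kd1 HKd] := data_close; have [Kb Kb1 HKb] := data_ball.
have Kdg : 0 < Kd by exact: lt_le_trans Kd1.
have Kbg : 0 < Kb by exact: lt_le_trans Kb1.
pose c := Cg * ((L + 2) + Kc * L * Kd + 4 * L).
have c0 : 0 < c.
  rewrite mulr_gt0// ltr_pwDl ?mulr_ge0// ltr_pwDl ?mulr_ge0 ?(ltW Kdg)//.
  by rewrite ltr_wpDl.
pose e1 := e / c; have e10 : 0 < e1 by rewrite divr_gt0.
have [dc dc0 Hdc] := HKc e1 e10.
have m0 : 0 < Num.min e1 dc by rewrite lt_min e10.
have me : Num.min e1 dc <= e1 by rewrite ge_min lexx.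
have md : Num.min e1 dc <= dc by rewrite ge_min lexx orbT.
have [d1 d10 H1] := deriv_compare g2 m0.
pose d := Num.min d1 (Num.min e1 (dc / (Kb + Kb))).
have d0 : 0 < d by rewrite !lt_min d10 e10 divr_gt0// addr_gt0.
have l1 : d <= d1 by rewrite !ge_min lexx.
have l2 : d <= e1 by rewrite !ge_min lexx !orbT.
have l3 : d <= dc / (Kb + Kb) by rewrite !ge_min lexx !orbT.
exists d => // g' g2' gg h z z' Hz [B' [mB' B'0 [lz' iz' dz']]] bz' s sa.
have Pg' : P g' by case: g2'.
have [B [mB Bm HB]] := H1 g' g2' (le_trans gg l1).
have Lh : 0 <= L * `|h| by rewrite mulr_ge0.
have cz' := lip_within lz'.
have Az' : asol g h z' (L * `|h|) (e1 * ((L + 2) + Kc * L * Kd) * `|h|) (B `|` B').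
  split=> // t ta nB.
  have nBt : ~ B t by move=> Bt; apply: nB; left.
  have [v zv ve] := dz' t ta (fun Bt => nB (or_intror Bt)).
  have [pN pp] := HB t ta nBt.
  have ta' := openW ta.
  exists v => //; have /= := HKd g g' t t Pg Pg' ta' ta'; rewrite subrr normr0 add0r.
  move=> [_ _ _ c4].
  have [|bf bt _ _] := HKb g g' t t dc Pg Pg' ta' ta'.
    by rewrite subrr normr0 add0r; apply: lt_of_half => //; exact: le_trans l3.
  have V1 := Hdc t ta' (cf g' t) (ct g' t) (dx g t) (dx g' t) (x_f_dom Pg' ta')
    (x_tau_dom Pg' ta') bf bt pN (le_trans pp md) (segment r z' t) (Gtheta h) (Gxi h).
  have z0 : `|segment r z' t| <= L * `|h|.
    by apply: (seg_le cz' ta') => y yt; apply: bz'; exact: window_itv yt.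
  have ztau : `|segment r z' t (- tau t (seg g' t) (Gxi g')) -
      segment r z' t (- tau t (seg g t) (Gxi g))| <= L * `|h| * (Kd * e1).
    rewrite !(seg_at _ cz' ta').
    have cl y : - r%:num <= t + clamp r y <= a.
      exact: window_clamp ta'.
    rewrite (le_trans (lz' _ _ (cl _) (cl _)))// ler_wpM2l//.
    rewrite opprD addrACA subrr add0r (le_trans (clamp_lip _ _ _))//.
    rewrite -opprD normrN (le_trans c4)// ler_pM2l//.
    exact: le_trans gg l2.
  have hth := Gtheta_le h; have hxi := Gxi_le h.
  have V1' := le_trans V1 (lerD
    (ler_wpM2l (ltW e10) (lerD (lerD z0 hth) hxi)) (ler_wpM2l Kc0 ztau)).
  have {ve} -> : v = VO g' t (segment r z' t) (Gtheta h) (Gxi h).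
    by apply/eqP; rewrite -subr_eq0 -normr_le0.
  by rewrite (le_trans V1')// le_eqVlt; apply/orP; left; apply/eqP; ring.
have mBB : measurable (B `|` B') by exact: measurableU.
have BBm : (mu (B `|` B') <= (Num.min e1 dc)%:E)%E by exact: mu_setU_null.
have eh : 0 <= e1 * ((L + 2) + Kc * L * Kd) * `|h|.
  apply: mulr_ge0 => //; apply: mulr_ge0; first exact: ltW.
  by rewrite addr_ge0// ?addr_ge0// !mulr_ge0// ltW.
have := HC h z' z _ _ _ _ _ Lh Lh eh m0 Az' mBB BBm Hz s sa.
move=> /le_trans; apply.
rewrite (@le_trans _ _ (Cg * (e1 * ((L + 2) + Kc * L * Kd) * `|h| +
  (L * `|h| + L * `|h|) * (e1 + e1))))//.
  by rewrite ler_pM2l// lerD2l ler_wpM2l ?addr_ge0// lerD.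
rewrite [leLHS](_ : _ = e1 * c * `|h|); last by rewrite /c; ring.
by rewrite /e1 divfK// gt_eqF.
Qed.



(** * Back to absolutely continuous solutions *)

Lemma lip_glue (z : R -> V) M1' M2' : 0 <= M1' -> 0 <= M2' ->
  (forall s t, - r%:num <= s <= 0 -> - r%:num <= t <= 0 -> `|z s - z t| <= M1' * `|s - t|) ->
  (forall s t, 0 <= s <= a -> 0 <= t <= a -> `|z s - z t| <= M2' * `|s - t|) ->
  lipW (M1' + M2') z.
Proof.
move=> M10 M20 H1 H2; have r_gt0 := r0; have a0 := a_gt0.
have le_case s t : - r%:num <= s -> s <= t -> t <= a -> `|z s - z t| <= (M1' + M2') * `|s - t|.
  move=> rs st ta; have n0 := normr_ge0 (s - t).
  have m1 : M1' * `|s - t| <= (M1' + M2') * `|s - t| by rewrite ler_wpM2r// lerDl.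
  have m2 : M2' * `|s - t| <= (M1' + M2') * `|s - t| by rewrite ler_wpM2r// lerDr.
  case: (leP t 0) => [t0|/ltW t0].
    by rewrite (le_trans _ m1)//; apply: H1; rewrite ?rs ?t0 ?(le_trans st t0) ?(le_trans rs st).
  case: (leP 0 s) => [s0|/ltW s0].
    by rewrite (le_trans _ m2)//; apply: H2; rewrite ?s0 ?ta ?(le_trans st ta) ?(le_trans s0 st).
  have h1 := H1 s 0; have h2 := H2 0 t.
  rewrite rs s0 oppr_le0 (ltW r_gt0) lexx in h1; rewrite t0 ta lexx (ltW a0) in h2.
  rewrite -(subrK (z 0) (z s)) -addrA (le_trans (ler_normD _ _))//.
  rewrite (le_trans (lerD (h1 isT isT) (h2 isT isT)))// subr0 sub0r normrN.
  rewrite (ler0_norm s0) (ger0_norm t0) (ler0_norm (x := s - t)) ?subr_le0// opprB.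
  rewrite mulrDl; apply: lerD; apply: ler_wpM2l => //.
    by rewrite lerDr.
  by rewrite lerDl oppr_ge0.
move=> s t /andP[rs sa] /andP[rt ta]; case: (leP s t) => [st|/ltW ts]; first exact: le_case.
by rewrite distrC [`|s - t|]distrC; exact: le_case.
Qed.

(** Uniqueness is claimed among absolutely continuous functions, but [vsol_unique] compares
    Lipschitz ones. A solution is continuous, hence bounded; the equation then bounds its derivative
    almost everywhere, and [ac_lip] makes it Lipschitz. *)
Lemma variational_vsol g h z : P2 tau P x a g ->
  is_variational_solution f tau a g (x g) (Gphi h) (Gtheta h) (Gxi h) z ->
  exists2 M, 0 <= M & vsol g h z M.
Proof.
move=> g2 [cz acz iz /ae_null[Z [mZ Z0 dZ]]]; have Pg : P g by case: g2.
have [K K0 HK] := vop_bound Pg.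
have /ae_null[Z' [mZ' Z'0 dxN]] := dx_ae g2.
have ra : - r%:num <= a by have := r0; have := a_gt0; lra.
have [S S0 zS] : exists2 S, 0 <= S & forall s, - r%:num <= s <= a -> `|z s| <= S.
  have cnz : {within `[- r%:num, a], continuous (fun s => `|z s|)}.
    by move=> s; apply: cvg_norm; exact: cz.
  have [c _ cmax] := EVT_max ra cnz; by exists `|z c|.
have mZZ : measurable (Z `|` Z') by exact: measurableU.
have ZZ0 : mu (Z `|` Z') = 0%E.
  apply/eqP; rewrite eq_le measure_ge0 andbT; apply: mu_setU_null => //.
  by move: Z0 => /= ->.
have dz t : 0 < t < a -> ~ (Z `|` Z') t ->
    hasd z t (VO g t (segment r z t) (Gtheta h) (Gxi h)).
  move=> ta nZ; apply/hasd_is_derive; rewrite -variational_opE.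
  apply: dZ; first by move=> Zt; apply: nZ; left.
  by rewrite in_itv/=; move: ta => /andP[/ltW -> /ltW ->].
pose k := K * (S + `|Gtheta h| + `|Gxi h|).
have k0 : 0 <= k by rewrite mulr_ge0// !addr_ge0.
have lz := ac_lip k0 acz mZZ ZZ0 _.
have {}lz : forall s t, 0 <= s <= a -> 0 <= t <= a -> `|z s - z t| <= k * `|s - t|.
  apply: lz => t ta nZ; exists (VO g t (segment r z t) (Gtheta h) (Gxi h)); first exact: dz.
  have ta' := openW ta.
  have pN : `|dx g t| <= N by apply: dxN => // Zt; apply: nZ; right.
  rewrite (le_trans (HK t _ ta' pN _ _ _))// ler_wpM2l// !lerD2r.
  by apply: (seg_le cz ta') => s st; apply: zS; exact: window_itv st.
exists (`|Gphi h| + k); first by rewrite addr_ge0.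
exists (Z `|` Z'); split=> //; split.
- apply: lip_glue => // s t sa ta; rewrite !iz ?in_itv//; exact: Wspace_lip.
- by move=> t t0; rewrite iz// in_itv.
- by move=> t ta nZ; exists (VO g t (segment r z t) (Gtheta h) (Gxi h)); [exact: dz|rewrite subrr normr0].
Qed.

Lemma vsol_variational g h z M : 0 <= M -> vsol g h z M ->
  is_variational_solution f tau a g (x g) (Gphi h) (Gtheta h) (Gxi h) z.
Proof.
move=> M0 [B [mB B0 [lz iz dz]]]; split.
- exact: lip_within lz.
- by apply: lip_ac M0 _ => s t sa ta; apply: lz; exact: closedW.
- by move=> t; rewrite in_itv; exact: iz.
- apply/ae_null; exists (B `|` [set 0; a]).
  have mab : measurable [set 0; a] by apply: measurableU; exact: measurable_set1.
  split; first exact: measurableU.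
    apply/eqP; rewrite eq_le measure_ge0 andbT; apply: mu_setU_null => //.
      by move: B0 => /= ->.
    exact/countable_lebesgue_measure0/finite_set_countable/finite_set2.
  move=> t nB; rewrite in_itv/= => /andP[t0 ta].
  have ta' : 0 < t < a.
    rewrite !lt_neqAle t0 ta !andbT; apply/andP; split; apply/eqP => tE; apply: nB; right.
      by left.
    by right.
  have [|v zv] := dz t ta' _; first by move=> Bt; apply: nB; left.
  rewrite normr_le0 subr_eq0 => /eqP vE; rewrite variational_opE -vE.
  exact/hasd_is_derive.
Qed.

Lemma vsolD g h h' (k : R) z z' M M' : P g -> vsol g h z M -> vsol g h' z' M' ->
  vsol g (k *: h + h') (fun s => k *: z s + z' s) (`|k| * M + M').
Proof.
move=> Pg [B [mB B0 [lz iz dz]]] [B' [mB' B'0 [lz' iz' dz']]].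
have cz := lip_within lz; have cz' := lip_within lz'.
exists (B `|` B'); split; first exact: measurableU.
  apply/eqP; rewrite eq_le measure_ge0 andbT; apply: mu_setU_null => //.
  by move: B0 => /= ->.
split=> [s t sa ta|t t0|t ta nB].
- rewrite (_ : _ - _ = k *: (z s - z t) + (z' s - z' t)); last by lmod R.
  rewrite (le_trans (ler_normD _ _))// mulrDl lerD ?lz'// normrZ -mulrA ler_wpM2l//.
  exact: lz.
- by rewrite iz// iz'.
have [v zv] := dz t ta (fun Bt => nB (or_introl Bt)).
have [v' zv'] := dz' t ta (fun Bt => nB (or_intror Bt)).
have ta' := openW ta.
rewrite !normr_le0 !subr_eq0 => /eqP v'E /eqP vE.
exists (k *: v + v'); first by apply: hasdD => //; exact: hasdZ.
have -> : Gtheta (k *: h + h') = k *: Gtheta h + Gtheta h' by [].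
have -> : Gxi (k *: h + h') = k *: Gxi h + Gxi h' by [].
rewrite (segD (contWZ cz) cz' ta') (segZ k cz ta') vop_linear vE v'E.
by rewrite subrr normr0.
Qed.

Lemma derivative_data : exists Z : Gamma -> Gamma -> R -> V, forall g, P2 tau P x a g ->
  [/\ forall h, vsol g h (Z g h) (L * `|h|),
      forall h s, - r%:num <= s <= a -> `|Z g h s| <= L * `|h|,
      forall t, 0 <= t <= a -> differentiable (fun g' => x g' t) g /\
        forall h, 'd (fun g' => x g' t) g h = Z g h t &
      forall t, 0 <= t <= a -> differentiable (fun g' => seg g' t) g /\
        forall h, 'd (fun g' => seg g' t) g h = segment r (Z g h) t].
Proof.
(* One solution is selected for every parameter and direction, with default 0 off [P2]; linearity in
   the direction comes from uniqueness, not from the selection. *)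
have /choice[Z0 HZ0] : forall gh : Gamma * Gamma, exists z, P2 tau P x a gh.1 ->
    vsol gh.1 gh.2 z (L * `|gh.2|) /\
    forall s, - r%:num <= s <= a -> `|z s| <= L * `|gh.2|.
  move=> [g h] /=; case: (pselect (P2 tau P x a g)) => g2; last by exists 0.
  have [z [B [mB B0 Az bz]]] := variational_exists h g2.
  by exists z => _; split=> //; exists B.
exists (fun g h => Z0 (g, h)) => g g2; have Pg : P g by case: g2.
have vz h : vsol g h (Z0 (g, h)) (L * `|h|) by have [] := HZ0 (g, h) g2.
have bz h s : - r%:num <= s <= a -> `|Z0 (g, h) s| <= L * `|h|.
  by have [_] := HZ0 (g, h) g2; apply.
have lz h : lipW (L * `|h|) (Z0 (g, h)) by have [B [_ _ []]] := vz h.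
have cz h : contW (Z0 (g, h)) by exact: lip_within (lz h).
have Lh (h : Gamma) : 0 <= L * `|h| by rewrite mulr_ge0.
have zlin k h h' s : - r%:num <= s <= a ->
    Z0 (g, k *: h + h') s = k *: Z0 (g, h) s + Z0 (g, h') s.
  apply: (vsol_unique g2 (Lh _) _ (vz _) (vsolD k Pg (vz h) (vz h'))).
  by rewrite addr_ge0// mulr_ge0.
split=> // t ta.
- have ta' := closedW ta.
  apply: (@linear_eps_diff _ _ _ _ _ (fun h => Z0 (g, h) t) L).
  + by move=> k h h'; exact: zlin.
  + by move=> h; exact: bz.
  + move=> e /(frechet_estimate g2)[d d0 H]; exists d => // h hd.
    by have [_ Hz] := H h hd; exact: Hz.
- apply: (@linear_eps_diff _ _ _ _ _ (fun h => segment r (Z0 (g, h)) t) L).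
  + move=> k h h'; rewrite -(segZ k (cz h) ta) -(segD (contWZ (cz h)) (cz h') ta).
    apply: (seg_ext _ (contWD (contWZ (cz h)) (cz h')) ta) => // s st.
    by apply: zlin; exact: window_itv st.
  + by move=> h; apply: (seg_le (cz h) ta) => s st; apply: bz; exact: window_itv st.
  + move=> e /(frechet_estimate g2)[d d0 H]; exists d => // h hd.
    have [Pk Hz] := H h hd.
    rewrite -(segB (x_cont Pk) (x_cont Pg) ta).
    rewrite -(segB (contWB (x_cont Pk) (x_cont Pg)) (cz h) ta).
    apply: (seg_le (contWB (contWB (x_cont Pk) (x_cont Pg)) (cz h)) ta) => s st.
    by apply: Hz => //; exact: window_itv st.
Qed.

Lemma solution_differentiable :
  [/\ forall (t : R) g, t \in `[0, a] -> P2 tau P x a g ->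
        differentiable (fun g' => x g' t) g /\ differentiable (fun g' => seg g' t) g,
      forall g, P2 tau P x a g -> forall h : Gamma,
        exists z : R -> V,
          is_unique_variational_solution f tau a g (x g) (Gphi h) (Gtheta h) (Gxi h) z /\
          forall t : R, t \in `[0, a] ->
            'd (fun g' => x g' t) g h = z t /\ 'd (fun g' => seg g' t) g h = segment r z t,
      op_continuous [set p : R * Gamma | p.1 \in `[0, a] /\ P2 tau P x a p.2]
        (fun (p : R * Gamma) (h : Gamma) => 'd (fun g' => x g' p.1) (p.2 : Gamma) h) &
      op_continuous [set p : R * Gamma | p.1 \in `[0, a] /\ P2 tau P x a p.2]
        (fun (p : R * Gamma) (h : Gamma) => 'd (fun g' => seg g' p.1) (p.2 : Gamma) h)].
Proof.
have [Z HZ] := derivative_data.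
have Lh (h : Gamma) : 0 <= L * `|h| by rewrite mulr_ge0.
(* Half of [e] is for the change of parameter, uniformly in time; the other half is for the change
   of time, by the Lipschitz constant L |h|. Both bounds are linear in |h|, hence give continuity in
   operator norm. *)
have close (p : R * Gamma) e : p.1 \in `[0, a] -> P2 tau P x a p.2 -> 0 < e ->
    \forall q \near p, q.1 \in `[0, a] /\ P2 tau P x a q.2 -> forall h,
      (forall s, - r%:num <= s <= a -> `|Z q.2 h s - Z p.2 h s| <= e / 2 * `|h|) /\
      L * `|h| * `|q.1 - p.1| <= e / 2 * `|h|.
  move: p => [t g] /=; rewrite in_itv/= => ta g2 e0.
  have e20 : 0 < e / 2 by rewrite divr_gt0.
  have L10 : 0 < L + 1 by rewrite ltr_wpDl.
  have [d d0 H] := vsol_continuous g2 e20.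
  have d'0 : 0 < Num.min d (e / 2 / (L + 1)) by rewrite lt_min d0 divr_gt0.
  apply/nbhs_ballP; exists (Num.min d (e / 2 / (L + 1))) => //= -[t' g'] [/= bt bg] [_ g2'] h.
  have [v b _ _] := HZ g g2; have [v' b' _ _] := HZ g' g2'; split.
    move=> s sa; apply: (H g' g2' _ h _ _ (v h) (v' h) (b' h) s sa).
    move: bg; rewrite -ball_normE /= distrC lt_min => /andP[gd _]; exact: ltW.
  rewrite mulrAC ler_wpM2r//.
  have : `|t' - t| <= e / 2 / (L + 1).
    by move: bt; rewrite /ball/= distrC lt_min => /andP[_ /ltW].
  rewrite ler_pdivlMr// mulrC => /(le_trans _); apply.
  by rewrite ler_wpM2r// lerDl.
split.
- move=> t g; rewrite in_itv/= => ta g2; have [_ _ H1 H2] := HZ g g2.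
  by split; [have [] := H1 t ta|have [] := H2 t ta].
- move=> g g2 h; have [v b H1 H2] := HZ g g2; exists (Z g h); split.
    split; first exact: vsol_variational (v h).
    move=> z' /(variational_vsol g2)[M M0 v'] t; rewrite in_itv/= => ta.
    exact: (vsol_unique g2 M0 (Lh h) v' (v h)).
  move=> t; rewrite in_itv/= => ta; have [_ E1] := H1 t ta; have [_ E2] := H2 t ta.
  by rewrite E1 E2.
- apply: op_continuousI => p [pa p2] e e0.
  apply: filterS (close p e pa p2 e0) => q + [qa q2] h => /(_ (conj qa q2) h)[c1 c2].
  rewrite in_itv/= in pa; rewrite in_itv/= in qa.
  have [v b H1 _] := HZ _ p2; have [v' b' H1' _] := HZ _ q2.
  rewrite ((H1' _ qa).2 h) ((H1 _ pa).2 h).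
  have wp := closedW pa.
  have wq := closedW qa.
  rewrite -(subrK (Z p.2 h q.1) (Z q.2 h q.1)) -addrA (le_trans (ler_normD _ _))//.
  rewrite (splitr e) mulrDl lerD ?c1// (le_trans _ c2)//.
  by have [B [_ _ [lz _ _]]] := v h; exact: lz.
- apply: op_continuousI => p [pa p2] e e0.
  apply: filterS (close p e pa p2 e0) => q + [qa q2] h => /(_ (conj qa q2) h)[c1 c2].
  rewrite in_itv/= in pa; rewrite in_itv/= in qa.
  have [v b _ H2] := HZ _ p2; have [v' b' _ H2'] := HZ _ q2.
  rewrite ((H2' _ qa).2 h) ((H2 _ pa).2 h).
  have [B [_ _ [lz _ _]]] := v h; have [B' [_ _ [lz' _ _]]] := v' h.
  have cz := lip_within lz; have cz' := lip_within lz'.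
  rewrite -(subrK (segment r (Z p.2 h) q.1) (segment r (Z q.2 h) q.1)) -addrA.
  rewrite (le_trans (ler_normD _ _))// (splitr e) mulrDl lerD//.
    rewrite -(segB cz' cz qa); apply: (seg_le (contWB cz' cz) qa) => s st.
    by apply: c1; exact: window_itv st.
  by rewrite (le_trans _ c2)//; exact: (seg_lip cz lz).
Qed.

End delay.

Theorem theorem7 (R : realType) (n : nat) (nu : vnorm R n) (r : {posnum R})
    (Theta Xi : normedModType R) (T : \bar R)
    (O1 : set (Cspace (rvec nu) r)) (O2 : set (rvec nu))
    (O3 : set Theta) (O4 : set Xi)
    (f : R -> Cspace (rvec nu) r -> rvec nu -> Theta -> rvec nu)
    (tau : R -> Cspace (rvec nu) r -> Xi -> R)
    (T_gt0 : (0 < T)%E)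
    (openO1 : open O1) (openO2 : open O2) (openO3 : open O3) (openO4 : open O4)
    (tau_range : forall t psi xi, times T t -> O1 psi -> O4 xi ->
      tau t psi xi \in `[0, r%:num])
    (hf1 : f1 T O1 O2 O3 f) (hf2 : f2 T O1 O2 O3 f) (hf3 : f3 T O1 O2 O3 f)
    (htau1 : tau1 T O1 O4 tau) (htau2 : tau2 T O1 O4 tau)
    (htau3 : tau3 T O1 O4 tau) (htau4 : tau4 T O1 O4 tau)
    (htau5 : tau5 T O1 O4 tau)
    (gammahat : Gspace nu r Theta Xi)
    (gammahat_Pi : Pi O1 O2 O3 O4 tau gammahat)
    (delta alpha N L : R)
    (delta_gt0 : 0 < delta) (alpha_gt0 : 0 < alpha) (alpha_le : (alpha%:E <= T)%E)
    (M1 : set (Cspace (rvec nu) r)) (M2 : set (rvec nu))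
    (M3 : set Theta) (M4 : set Xi)
    (admM1 : admissible1 O1 M1) (admM2 : admissible2 O2 M2)
    (admM3 : admissible3 O3 M3) (admM4 : admissible4 O4 M4)
    (convM1 : @convex_set R (Cspace (rvec nu) r) M1)
    (convM2 : @convex_set R (rvec nu) M2)
    (convM3 : @convex_set R Theta M3) (convM4 : @convex_set R Xi M4)
    (P : set (Gspace nu r Theta Xi)) (P_def : P = ball gammahat delta)
    (x : Gspace nu r Theta Xi -> R -> rvec nu)
    (x_sol : forall g, P g -> is_unique_solution O1 O2 f tau alpha g (x g))
    (x_adm : forall g (t : R), P g -> t \in `[0, alpha] ->
      [/\ M1 (segment r (x g) t),
          M2 (x g (delayed_time tau (x g) (Gxi g) t)),
          M3 (Gtheta g) & M4 (Gxi g)])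
    (x_bound : forall g (t : R), P g -> t \in `[0, alpha] ->
      `|segmentW r (x g) t| <= N)
    (x_lip : forall g g' (t : R), P g -> P g' -> t \in `[0, alpha] ->
      `|segmentW r (x g) t - segmentW r (x g') t| <= L * `|g - g'|) :
  [/\ forall (t : R) g, t \in `[0, alpha] -> P2 tau P x alpha g ->
        differentiable (fun g' => x g' t) g /\
        differentiable (fun g' => segment r (x g') t) g,
      forall g, P2 tau P x alpha g -> forall h : Gspace nu r Theta Xi,
        exists z : R -> rvec nu,
          is_unique_variational_solution f tau alpha g (x g)
            (Gphi h) (Gtheta h) (Gxi h) z /\
          forall t : R, t \in `[0, alpha] ->
            'd (fun g' => x g' t) g h = z t /\
            'd (fun g' => segment r (x g') t) g h = segment r z t,
      op_continuous [set p : R * Gspace nu r Theta Xi |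
          p.1 \in `[0, alpha] /\ P2 tau P x alpha p.2]
        (fun (p : R * Gspace nu r Theta Xi) (h : Gspace nu r Theta Xi) =>
          'd (fun g' => x g' p.1) (p.2 : Gspace nu r Theta Xi) h) &
      op_continuous [set p : R * Gspace nu r Theta Xi |
          p.1 \in `[0, alpha] /\ P2 tau P x alpha p.2]
        (fun (p : R * Gspace nu r Theta Xi) (h : Gspace nu r Theta Xi) =>
          'd (fun g' => segment r (x g') p.1)
            (p.2 : Gspace nu r Theta Xi) h)].
Proof.
(* The signs of [N] and [L] are not prescribed, so both are replaced by their maximum with 0. *)
have N0 : 0 <= Num.max N 0 by rewrite le_max lexx orbT.
have L0 : 0 <= Num.max L 0 by rewrite le_max lexx orbT.
have oP : open P by rewrite P_def; exact: ball_open.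
have xb g (t : R) : P g -> t \in `[0, alpha] -> `|segmentW r (x g) t| <= Num.max N 0.
  by move=> Pg ta; rewrite (le_trans (x_bound g t Pg ta))// le_max lexx.
have xl g g' (t : R) : P g -> P g' -> t \in `[0, alpha] ->
    `|segmentW r (x g) t - segmentW r (x g') t| <= Num.max L 0 * `|g - g'|.
  move=> Pg Pg' ta; rewrite (le_trans (x_lip g g' t Pg Pg' ta))// ler_wpM2r//.
  by rewrite le_max lexx.
exact: (solution_differentiable openO1 openO2 openO3 openO4 tau_range hf1 hf3
  htau2 htau3 htau4 htau5 N0 L0 alpha_gt0 alpha_le admM1 admM3 admM4 oP x_sol x_adm xb xl).
Qed.
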